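(* Let $A$ be a locally unital graded algebra that is locally finite-dimensional and bounded below, equipped with a graded triangular basis with weight poset $\Lambda$, and suppose that for each $\lambda\in\Lambda$ the algebra $A_\lambda$ is given the structure of a based affine quasi-hereditary algebra with weight poset $(\mathbf B_\lambda,\leq_\lambda)$. Let $\leq$ be the refined partial order on $\mathbf B$. Then for each $b\in\mathbf B$ the indecomposable projective module $P(b)$ has a pure $\Delta$-flag with top section isomorphic to the pure standard module $\boldsymbol\Delta(b)$ and other sections that are pure $\Delta$-layers of types $a<b$.
   Context: Conventions. $\Bbbk$ is an algebraically closed field; all algebras, categories and functors are $\Bbbk$-linear; graded means $\mathbb Z$-graded. For a graded vector space $V$, $qV$ is the shift $(qV)_d=V_{d-1}$. A locally unital graded algebra is a graded associative algebra $A=\bigoplus_{i,j\in\mathbf I}1_iA1_j$ with a given family of mutually orthogonal homogeneous idempotents $1_i$ $(i\in\mathbf I)$. Graded left modules are locally unital: $V=\bigoplus_{i}1_iV$. $A$-gmod is the abelian category of graded left $A$-modules with degree-preserving homomorphisms. $\operatorname{Hom}_A(V,W)=\bigoplus_{d\in\mathbb Z}\operatorname{Hom}_A(V,W)_d$, where $\operatorname{Hom}_A(V,W)_d$ is the space of $A$-module homomorphisms $f$ with $f(V_n)\subseteq W_{n+d}$ for all $n$. $V$ is locally finite-dimensional if $\dim 1_iV_d<\infty$ for all $i,d$; bounded below if for each $i$ there is $N_i$ with $1_iV_d=0$ for $d<N_i$. $A$ is locally finite-dimensional and bounded below if all $(1_iA1_j)_d$ are finite-dimensional and, for all $i,j$,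 $(1_iA1_j)_d=0$ for $d\ll 0$. Graded triangular basis. For such $A$ this is the following data: a subset $\mathbf S\subseteq\mathbf I$; a poset $(\Lambda,\leq)$ that is lower finite (each $\{\mu\in\Lambda:\mu\leq\lambda\}$ is finite); a function $\mathbf S\to\Lambda$, $s\mapsto\dot s$, with finite (possibly empty) fibers $\mathbf S_\lambda$; homogeneous sets $\mathrm X(i,s)\subset1_iA1_s$, $\mathrm H(s,t)\subset1_sA1_t$, $\mathrm Y(t,j)\subset1_tA1_j$ for $i,j\in\mathbf I$, $s,t\in\mathbf S$. With $\mathrm X(s)=\bigcup_i\mathrm X(i,s)$, $\mathrm Y(t)=\bigcup_j\mathrm Y(t,j)$, the axioms are: (A1) the products $xhy$ for $(x,h,y)\in\bigcup_{s,t\in\mathbf S}\mathrm X(s)\times\mathrm H(s,t)\times\mathrm Y(t)$ form a basis of $A$; (A2) $\mathrm X(s,s)=\mathrm Y(s,s)=\{1_s\}$ for $s\in\mathbf S$; (A3) for $s\neq t$ in $\mathbf S$: $\mathrm X(s,t)\neq\varnothing\Rightarrow\dot s>\dot t$, $\mathrm H(s,t)\neq\varnothing\Rightarrow\dot s=\dot t$, $\mathrm Y(s,t)\neq\varnothing\Rightarrow\dot s<\dot t$; (A4) for each $i\in\mathbf I-\mathbf S$, the sets $\{s\in\mathbf S:\mathrm X(i,s)\neq\varnothing\}$ and $\{s\in\mathbf S:\mathrm Y(s,i)\neq\varnothing\}$ are finite. Functors. For $\lambda\in\Lambda$ let $e_\lambda=\sum_{s\in\mathbf S_\lambda}1_s$;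 let $A_{\geq\lambda}$ be the quotient of $A$ by the two-sided ideal generated by all $e_\mu$ with $\mu\not\geq\lambda$ (with idempotents the images $\bar1_i$), let $\bar e_\lambda$ be the image of $e_\lambda$ in it, and let $A_\lambda=\bar e_\lambda A_{\geq\lambda}\bar e_\lambda$, a unital graded algebra. Let $j^\lambda:A_{\geq\lambda}\text{-gmod}\to A_\lambda\text{-gmod}$, $V\mapsto\bar e_\lambda V$, with left adjoint $j^\lambda_!=A_{\geq\lambda}\bar e_\lambda\otimes_{A_\lambda}-$. $A_{\geq\lambda}$-modules are viewed as $A$-modules by inflation. Modules. Fix a set $\mathbf B=\coprod_{\lambda\in\Lambda}\mathbf B_\lambda$ such that $L_\lambda(b)$ $(b\in\mathbf B_\lambda)$ is a full set of irreducible graded left $A_\lambda$-modules up to isomorphism and degree shift; write $\dot b=\lambda$ if $b\in\mathbf B_\lambda$. Let $P_\lambda(b)$ be a projective cover of $L_\lambda(b)$ in $A_\lambda$-gmod. For $b\in\mathbf B_\lambda$, $\Delta(b)=j^\lambda_!P_\lambda(b)$, viewed as a graded $A$-module. $L(b)$ is the unique irreducible graded quotient of $\Delta(b)$; the $L(b)$ $(b\in\mathbf B)$ form a full set of irreducible graded left $A$-modules up to isomorphism and degree shift. $P(b)$ is a projective cover of $L(b)$ in $A$-gmod. Refined structure. For each $\lambda\in\Lambda$ we are given a partial order $\leq_\lambda$ on the finite set $\mathbf B_\lambda$ and a structure of based affine quasi-hereditary algebra on $A_\lambda$ with weight poset $(\mathbf B_\lambda,\leq_\lambda)$: this means a decomposition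 $A_\lambda=\bigoplus_{p,r\in\mathbf K}1'_pA_\lambda1'_r$ of $A_\lambda$ as a locally unital graded algebra via some mutually orthogonal homogeneous idempotents $1'_p$ $(p\in\mathbf K)$, together with a graded triangular basis for $A_\lambda$ whose set of special idempotents and weight poset are both $\mathbf B_\lambda$ with the map from special indices to weights being the identity, that is, $\mathbf B_\lambda\subseteq\mathbf K$ and there are homogeneous sets $\mathrm X_\lambda(p,b)\subset1'_pA_\lambda1'_b$, $\mathrm H_\lambda(b,c)\subset1'_bA_\lambda1'_c$, $\mathrm Y_\lambda(c,r)\subset1'_cA_\lambda1'_r$ for $p,r\in\mathbf K$, $b,c\in\mathbf B_\lambda$ such that the products $xhy$ for $(x,h,y)\in\bigcup_{p,r\in\mathbf K;\,b,c\in\mathbf B_\lambda}\mathrm X_\lambda(p,b)\times\mathrm H_\lambda(b,c)\times\mathrm Y_\lambda(c,r)$ form a basis of $A_\lambda$, $\mathrm X_\lambda(b,b)=\mathrm Y_\lambda(b,b)=\{1'_b\}$ for $b\in\mathbf B_\lambda$, and for $b\neq c$ in $\mathbf B_\lambda$: $\mathrm X_\lambda(b,c)\neq\varnothing\Rightarrow b>_\lambda c$, $\mathrm H_\lambda(b,c)=\varnothing$, $\mathrm Y_\lambda(b,c)\neq\varnothing\Rightarrow b<_\lambda c$; and such that for each $b\in\mathbf B_\lambda$ the ''Cartan'' algebra $(A_\lambda)_b:=\bar1'_b(A_\lambda)_{\geq b}\bar1'_b$ is graded local, i.e. its quotient by its graded Jacobson radical is $\Bbbk$, where $(A_\lambda)_{\geq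 b}$ is the quotient of $A_\lambda$ by the two-sided ideal generated by all $1'_c$ with $c\in\mathbf B_\lambda$, $c\not\geq_\lambda b$, and $\bar1'_b$ is the image of $1'_b$ in it. The standardization functor of type $b$ for the basis of $A_\lambda$ is $(A_\lambda)_{\geq b}\bar1'_b\otimes_{(A_\lambda)_b}-$, from graded left $(A_\lambda)_b$-modules to graded left $(A_\lambda)_{\geq b}$-modules, the latter being viewed as $A_\lambda$-modules by inflation. Applying this functor to $(A_\lambda)_b$ (the unique irreducible graded $(A_\lambda)_b$-module, up to shift, is $\Bbbk$, with projective cover $(A_\lambda)_b$) gives standard modules $\Delta_\lambda(b)=(A_\lambda)_{\geq b}\bar1'_b$ for $A_\lambda$, $b\in\mathbf B_\lambda$, with irreducible heads, and labels are chosen so that $L_\lambda(b)$ is the head of $\Delta_\lambda(b)$. The refined order on $\mathbf B$ is: $b\leq c$ iff $\dot b<\dot c$, or $\dot b=\dot c=:\lambda$ and $b\leq_\lambda c$. The pure standard module for $b\in\mathbf B_\lambda$ is $\boldsymbol\Delta(b):=j^\lambda_!\Delta_\lambda(b)$. Pure flags. A $\Delta_\lambda$-layer of type $b\in\mathbf B_\lambda$ is a graded $A_\lambda$-module isomorphic to the module obtained by applying the standardization functor of type $b$ for the basis of $A_\lambda$ to a projective graded $(A_\lambda)_b$-module that is locally finite-dimensional and bounded below. A pure $\Delta$-layer of type $b\in\mathbf B_\lambda$ is a graded $A$-module isomorphic to $j^\lambda_!\bar V$ for $\bar V$ a $\Delta_\lambda$-layer of type $b$. $V$ has a pure $\Delta$-flag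 if for some $n\geq0$ there is a graded filtration $0=V_0\subset V_1\subset\dots\subset V_n=V$ and distinct $b_1,\dots,b_n\in\mathbf B$ such that $V_r/V_{r-1}$ is a pure $\Delta$-layer of type $b_r$ for each $r$; its top section is $V_n/V_{n-1}$. *)

(* Defs.v *)
From HB Require Import structures.
From mathcomp Require Import all_boot all_order all_algebra.
From mathcomp Require Import all_classical.

Set Implicit Arguments.
Unset Strict Implicit.
Unset Printing Implicit Defensive.

Import Order.TTheory GRing.Theory.
Local Open Scope ring_scope.
Local Open Scope quotient_scope.

(* A grading V = \bigoplus_d V_d is recorded by the projections of V onto the
   V_d: [gcomp d v] is the component of degree d of v, and V_d is [gdeg d]. *)
Record gvect (k : closedFieldType) := GVect {
  gv_car :> lmodType k;
  gcomp : int -> {linear gv_car -> gv_car};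
  gcomp_proj : forall d e v,
    gcomp d (gcomp e v) = if d == e then gcomp e v else 0;
  gcomp_fin : forall v,
    exists s : seq int, uniq s /\ v = \sum_(d <- s) gcomp d v }.

Arguments gcomp {k g} d.

Definition gdeg k (V : gvect k) (d : int) (v : V) : Prop := gcomp d v = v.

Definition homogeneous k (V : gvect k) (v : V) : Prop := exists d, gdeg d v.

Definition fin_dim k (V : lmodType k) (W : set V) : Prop :=
  exists (n : nat) (b : 'I_n -> V), forall w, W w ->
    exists c : 'I_n -> k, w = \sum_i c i *: b i.

(* Bases are indexed families: F is injective on D when [is_basis D F]. *)
Definition is_basis k (V : lmodType k) (T : choiceType) (D : set T)
    (F : T -> V) : Prop :=
  (forall v, exists (s : seq T) (c : T -> k),
     (forall t, t \in s -> D t) /\ v = \sum_(t <- s) c t *: F t) /\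
  (forall (s : seq T) (c : T -> k), uniq s -> (forall t, t \in s -> D t) ->
     \sum_(t <- s) c t *: F t = 0 -> forall t, t \in s -> c t = 0).

Record gsubsp k (V : gvect k) := GSubsp {
  gs_set :> V -> Prop;
  gs0 : gs_set 0;
  gsD : forall u v, gs_set u -> gs_set v -> gs_set (u + v);
  gsZ : forall (c : k) v, gs_set v -> gs_set (c *: v);
  gs_comp : forall d v, gs_set v -> gs_set (gcomp d v) }.

Record gbilinear k (U V W : gvect k) (mu : U -> V -> W) : Prop := GBilinear {
  gbDl : forall u u' v, mu (u + u') v = mu u v + mu u' v;
  gbDr : forall u v v', mu u (v + v') = mu u v + mu u v';
  gbZl : forall (c : k) u v, mu (c *: u) v = c *: mu u v;
  gbZr : forall (c : k) u v, mu u (c *: v) = c *: mu u v;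
  gb_deg : forall d e u v, gdeg d u -> gdeg e v -> gdeg (d + e) (mu u v) }.

Section GVectTheory.
Variable k : closedFieldType.

Lemma gcomp_deg (V : gvect k) d (v : V) : gdeg d (gcomp d v).
Proof. by rewrite /gdeg gcomp_proj eqxx. Qed.

Lemma gdeg_comp (V : gvect k) d e (v : V) :
  gdeg d v -> gcomp e v = if e == d then v else 0.
Proof. by move=> vd; rewrite -{1}vd gcomp_proj vd. Qed.

Lemma gdegD (V : gvect k) d (u v : V) : gdeg d u -> gdeg d v -> gdeg d (u + v).
Proof. by rewrite /gdeg linearD => -> ->. Qed.

Lemma gdegZ (V : gvect k) d c (v : V) : gdeg d v -> gdeg d (c *: v).
Proof. by rewrite /gdeg linearZ /= => ->. Qed.

Lemma gdeg0 (V : gvect k) d : gdeg d (0 : V).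
Proof. by rewrite /gdeg linear0. Qed.

Lemma gdeg_sum (V : gvect k) d (T : Type) (r : seq T) (P : pred T) (F : T -> V) :
  (forall t, P t -> gdeg d (F t)) -> gdeg d (\sum_(t <- r | P t) F t).
Proof.
by move=> h; apply: big_ind => //; [exact: gdeg0 | move=> u v; exact: gdegD].
Qed.

Lemma gcomp_out (V : gvect k) (s : seq int) (v : V) d :
  v = \sum_(e <- s) gcomp e v -> d \notin s -> gcomp d v = 0.
Proof.
move=> {1}-> ds; rewrite linear_sum /= big_seq big1 // => e es.
by rewrite gcomp_proj; case: eqP ds => // ->; rewrite es.
Qed.

Definition gsupp (V : gvect k) (v : V) : seq int := projT1 (cid (gcomp_fin v)).

Lemma gsupp_uniq (V : gvect k) (v : V) : uniq (gsupp v).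
Proof. by rewrite /gsupp; case: cid => s []. Qed.

Lemma gsuppE (V : gvect k) (v : V) : v = \sum_(d <- gsupp v) gcomp d v.
Proof. by rewrite /gsupp; case: cid => s []. Qed.

Lemma gsupp_out (V : gvect k) (v : V) d : d \notin gsupp v -> gcomp d v = 0.
Proof. exact: gcomp_out (gsuppE v). Qed.

Lemma big_uniq_sub (T : eqType) (W : zmodType) (s r : seq T) (F : T -> W) :
  uniq s -> uniq r -> {subset s <= r} ->
  (forall t, t \notin s -> F t = 0) ->
  \sum_(t <- r) F t = \sum_(t <- s) F t.
Proof.
move=> us ur sr F0; rewrite (bigID (mem s)) /= [X in _ + X]big1 ?addr0; last first.
  by move=> t /F0.
rewrite -big_filter; apply: perm_big; apply: uniq_perm => //.
  exact: filter_uniq.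
by move=> t; rewrite mem_filter; apply/andP/idP => [[]//|ts]; split=> //; apply: sr.
Qed.

Lemma gsupp_sum (V : gvect k) (v : V) (W : zmodType) (F : int -> W) r :
  uniq r -> {subset gsupp v <= r} -> (forall d, gcomp d v = 0 -> F d = 0) ->
  \sum_(d <- r) F d = \sum_(d <- gsupp v) F d.
Proof.
move=> ur sr F0; apply: big_uniq_sub => //; first exact: gsupp_uniq.
by move=> d /gsupp_out/F0.
Qed.

Lemma gcompS (V : gvect k) (v : V) (r : seq int) :
  uniq r -> {subset gsupp v <= r} -> v = \sum_(d <- r) gcomp d v.
Proof. by move=> ur sr; rewrite (gsupp_sum ur sr) -?gsuppE. Qed.

Section Bilin.
Variables (U V W : gvect k) (mu : U -> V -> W) (hmu : gbilinear mu).

Lemma gb0l v : mu 0 v = 0.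
Proof. by rewrite -(scale0r 0) (gbZl hmu) scale0r. Qed.

Lemma gb0r u : mu u 0 = 0.
Proof. by rewrite -(scale0r 0) (gbZr hmu) scale0r. Qed.

Lemma gb_suml T (r : seq T) P (F : T -> U) v :
  mu (\sum_(t <- r | P t) F t) v = \sum_(t <- r | P t) mu (F t) v.
Proof. by apply: (big_morph (mu^~ v)) => [x y|]; rewrite ?(gbDl hmu) ?gb0l. Qed.

Lemma gb_sumr T (r : seq T) P u (F : T -> V) :
  mu u (\sum_(t <- r | P t) F t) = \sum_(t <- r | P t) mu u (F t).
Proof. by apply: (big_morph (mu u)) => [x y|]; rewrite ?(gbDr hmu) ?gb0r. Qed.

Lemma gbNl u v : mu (- u) v = - mu u v.
Proof. by rewrite -scaleN1r (gbZl hmu) scaleN1r. Qed.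

Lemma gbNr u v : mu u (- v) = - mu u v.
Proof. by rewrite -scaleN1r (gbZr hmu) scaleN1r. Qed.

Lemma gbBl u u' v : mu (u - u') v = mu u v - mu u' v.
Proof. by rewrite (gbDl hmu) gbNl. Qed.

Lemma gbBr u v v' : mu u (v - v') = mu u v - mu u v'.
Proof. by rewrite (gbDr hmu) gbNr. Qed.

Lemma gcomp_degl d p u v : gdeg p u -> gcomp d (mu u v) = mu u (gcomp (d - p) v).
Proof.
move=> up; have [s [us vE]] := gcomp_fin v.
rewrite [in LHS]vE gb_sumr linear_sum /=.
have [ds|ds] := boolP (d - p \in s); last first.
  rewrite (gcomp_out vE ds) gb0r big_seq big1 // => e es.
  rewrite (gdeg_comp _ (gb_deg hmu up (gcomp_deg e v))); case: eqP => // de.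
  by rewrite de addrAC subrr add0r es in ds.
rewrite (bigD1_seq (d - p)) //= big1 => [|e ne].
  by rewrite addr0 (gdeg_comp _ (gb_deg hmu up (gcomp_deg _ v))) addrC subrK eqxx.
rewrite (gdeg_comp _ (gb_deg hmu up (gcomp_deg e v))); case: eqP => // de.
by rewrite de addrAC subrr add0r eqxx in ne.
Qed.

Lemma gcomp_degr d p u v : gdeg p v -> gcomp d (mu u v) = mu (gcomp (d - p) u) v.
Proof.
move=> vp; have [s [us uE]] := gcomp_fin u.
rewrite [in LHS]uE gb_suml linear_sum /=.
have [ds|ds] := boolP (d - p \in s); last first.
  rewrite (gcomp_out uE ds) gb0l big_seq big1 // => e es.
  rewrite (gdeg_comp _ (gb_deg hmu (gcomp_deg e u) vp)); case: eqP => // de.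
  by rewrite de addrK es in ds.
rewrite (bigD1_seq (d - p)) //= big1 => [|e ne].
  by rewrite addr0 (gdeg_comp _ (gb_deg hmu (gcomp_deg _ u) vp)) subrK eqxx.
rewrite (gdeg_comp _ (gb_deg hmu (gcomp_deg e u) vp)); case: eqP => // de.
by rewrite de addrK eqxx in ne.
Qed.

Lemma gcomp_bilin d u v :
  gcomp d (mu u v) = \sum_(p <- gsupp u) mu (gcomp p u) (gcomp (d - p) v).
Proof.
rewrite [in LHS](gsuppE u) gb_suml linear_sum; apply: eq_bigr => p _ /=.
exact/gcomp_degl/gcomp_deg.
Qed.

End Bilin.

Section Subspace.
Variables (V : gvect k) (W : gsubsp V).

Lemma gsN v : W v -> W (- v).
Proof. by rewrite -scaleN1r; exact: gsZ. Qed.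

Lemma gsB u v : W u -> W v -> W (u - v).
Proof. by move=> Wu /gsN; exact: gsD. Qed.

Lemma gs_sum T (r : seq T) (P : pred T) (F : T -> V) :
  (forall t, P t -> W (F t)) -> W (\sum_(t <- r | P t) F t).
Proof.
by move=> h; apply: big_ind => //; [exact: gs0 | move=> u v; exact: gsD].
Qed.

Definition gs_pred : {pred V} := fun v => `[< W v >].

Lemma gs_predP v : reflect (W v) (v \in gs_pred).
Proof. exact: asboolP. Qed.

Lemma gs_pred_closed : subsemimod_closed gs_pred.
Proof.
split; first split.
- exact/gs_predP/gs0.
- by move=> u v /gs_predP Wu /gs_predP Wv; apply/gs_predP/gsD.
- by move=> c v /gs_predP Wv; apply/gs_predP/gsZ.
Qed.

HB.instance Definition _ := GRing.isSubmodClosed.Build k V gs_pred gs_pred_closed.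

Definition sub_car := {v : V | gs_pred v}.
HB.instance Definition _ := SubChoice.on sub_car.
HB.instance Definition _ := [SubChoice_isSubLmodule of sub_car by <:].

Lemma sub_carP (x : sub_car) : W (val x).
Proof. exact/gs_predP/(valP x). Qed.

Definition sub_in (v : V) (Wv : W v) : sub_car := exist _ v (asboolT Wv).

Definition sub_comp_fun d (x : sub_car) : sub_car :=
  sub_in (gs_comp d (sub_carP x)).

Lemma sub_comp_linear d : linear (sub_comp_fun d).
Proof. by move=> c x y; apply: val_inj; rewrite /= !linearP. Qed.

Definition sub_comp d : {linear sub_car -> sub_car} :=
  HB.pack (sub_comp_fun d) (GRing.isLinear.Build _ _ _ _ _ (sub_comp_linear d)).

Lemma sub_comp_proj d e v :
  sub_comp d (sub_comp e v) = if d == e then sub_comp e v else 0.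
Proof.
by apply: val_inj; rewrite /= gcomp_proj; case: eqP => //= _; rewrite raddf0.
Qed.

Lemma sub_comp_fin v :
  exists s : seq int, uniq s /\ v = \sum_(d <- s) sub_comp d v.
Proof.
have [s [us vE]] := gcomp_fin (val v); exists s; split=> //.
by apply: val_inj; rewrite raddf_sum.
Qed.

Definition gsub : gvect k := GVect sub_comp_proj sub_comp_fin.

Lemma gdeg_gsub d (x : gsub) : gdeg d x <-> gdeg d (val x).
Proof. by split=> [xd|xd]; [rewrite /gdeg -{2}xd | apply: val_inj]. Qed.

Definition quo_car := Quotient.quot gs_pred.
HB.instance Definition _ := EqQuotient.on quo_car.
HB.instance Definition _ := GRing.Zmodule.on quo_car.

Definition qpi_fun (v : V) : quo_car := \pi_quo_car v.

Lemma qpi_eq u v : qpi_fun u = qpi_fun v <-> W (u - v).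
Proof.
rewrite /qpi_fun; split=> [/eqP|/gs_predP h]; last first.
  by apply/eqP; rewrite -Quotient.idealrBE.
by rewrite -Quotient.idealrBE => /gs_predP.
Qed.

Lemma qpi_repr x : qpi_fun (repr x) = x.
Proof. exact: reprK. Qed.

Lemma qpiD u v : qpi_fun (u + v) = qpi_fun u + qpi_fun v.
Proof. by rewrite /qpi_fun !piE. Qed.

Definition quo_scale (c : k) (x : quo_car) : quo_car := qpi_fun (c *: repr x).

Lemma quo_scaleE c v : quo_scale c (qpi_fun v) = qpi_fun (c *: v).
Proof.
apply/qpi_eq; rewrite -scalerBr; apply: gsZ.
by apply/qpi_eq; rewrite qpi_repr.
Qed.

Lemma quo_scalerA a b x : quo_scale a (quo_scale b x) = quo_scale (a * b) x.
Proof. by rewrite -[x]qpi_repr !quo_scaleE scalerA. Qed.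

Lemma quo_scale1r : left_id 1 quo_scale.
Proof. by move=> x; rewrite -[x]qpi_repr quo_scaleE scale1r. Qed.

Lemma quo_scalerDr : right_distributive quo_scale +%R.
Proof.
by move=> c x y; rewrite -[x]qpi_repr -[y]qpi_repr -qpiD !quo_scaleE scalerDr qpiD.
Qed.

Lemma quo_scalerDl x : {morph quo_scale^~ x : a b / a + b}.
Proof.
by move=> a b /=; rewrite -[x]qpi_repr !quo_scaleE scalerDl qpiD.
Qed.

HB.instance Definition _ := GRing.Zmodule_isLmodule.Build k quo_car
  quo_scalerA quo_scale1r quo_scalerDr quo_scalerDl.

Lemma qpi_linear : linear qpi_fun.
Proof. by move=> c u v; rewrite qpiD -quo_scaleE. Qed.

Definition qpi : {linear V -> quo_car} :=
  HB.pack qpi_fun (GRing.isLinear.Build _ _ _ _ _ qpi_linear).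

Lemma qpi_surj x : exists v, x = qpi v.
Proof. by exists (repr x); rewrite /= qpi_repr. Qed.

Lemma qpi_ker v : qpi v = 0 <-> W v.
Proof. by rewrite -(linear0 qpi) /= qpi_eq subr0. Qed.

Definition qlift_fun (U : lmodType k) (f : V -> U) (x : quo_car) : U := f (repr x).

Section Lift.
Variables (U : lmodType k) (f : {linear V -> U}) (hf : forall v, W v -> f v = 0).

Lemma qlift_funE v : qlift_fun f (qpi v) = f v.
Proof.
apply/eqP; rewrite -subr_eq0 -raddfB; apply/eqP/hf/qpi_eq.
by rewrite qpi_repr.
Qed.

Lemma qlift_linear : linear (qlift_fun f).
Proof.
move=> c x y; have [u ->] := qpi_surj x; have [v ->] := qpi_surj y.
by rewrite -linearP !qlift_funE linearP.
Qed.

Definition qlift : {linear quo_car -> U} :=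
  HB.pack (qlift_fun f) (GRing.isLinear.Build _ _ _ _ _ qlift_linear).

Lemma qliftE v : qlift (qpi v) = f v.
Proof. exact: qlift_funE. Qed.

End Lift.

Lemma quo_comp_subproof d v : W v -> (qpi \o gcomp d) v = 0.
Proof. by move=> Wv; apply/qpi_ker/gs_comp. Qed.

Definition quo_comp d : {linear quo_car -> quo_car} := qlift (@quo_comp_subproof d).

Lemma quo_compE d v : quo_comp d (qpi v) = qpi (gcomp d v).
Proof. exact: qliftE. Qed.

Lemma quo_comp_proj d e x :
  quo_comp d (quo_comp e x) = if d == e then quo_comp e x else 0.
Proof.
have [v ->] := qpi_surj x; rewrite !quo_compE gcomp_proj.
by case: eqP => // _; rewrite linear0.
Qed.

Lemma quo_comp_fin x :
  exists s : seq int, uniq s /\ x = \sum_(d <- s) quo_comp d x.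
Proof.
have [v ->] := qpi_surj x; have [s [us vE]] := gcomp_fin v.
exists s; split=> //; rewrite {1}vE linear_sum; apply: eq_bigr => d _.
by rewrite quo_compE.
Qed.

Definition gquo : gvect k := GVect quo_comp_proj quo_comp_fin.

Lemma gdeg_qpi d v : gdeg d v -> gdeg d (qpi v : gquo).
Proof. by rewrite /gdeg => {2}<-; exact: quo_compE. Qed.

Lemma gdeg_qpi_lift d (x : gquo) : gdeg d x -> exists v, gdeg d v /\ x = qpi v.
Proof.
move=> xd; have [v xE] := qpi_surj x; exists (gcomp d v).
split; first exact: gcomp_deg.
by rewrite -quo_compE -xE.
Qed.

End Subspace.
End GVectTheory.
Record galg (k : closedFieldType) := GAlg {
  ga_car :> gvect k;
  amul : ga_car -> ga_car -> ga_car;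
  amul_bilin : gbilinear amul;
  amulA : forall a b c, amul a (amul b c) = amul (amul a b) c }.

Arguments amul {k g} a b.

(* The family [one] of mutually orthogonal homogeneous idempotents gives
   A = \bigoplus_(i, j) 1_i A 1_j (the sum is direct by orthogonality). *)
Record lunital k (A : galg k) (I : choiceType) (one : I -> A) : Prop := LUnital {
  lu_homog : forall i, homogeneous (one i);
  lu_idem : forall i, amul (one i) (one i) = one i;
  lu_orth : forall i j, i <> j -> amul (one i) (one j) = 0;
  lu_dec : forall a, exists s : seq I, uniq s /\
    a = \sum_(i <- s) \sum_(j <- s) amul (amul (one i) a) (one j) }.

Record lualg (k : closedFieldType) := LUAlg {
  lu_alg :> galg k;
  lu_idx : choiceType;
  lu_one : lu_idx -> lu_alg;
  lu_unital : lunital lu_one }.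

Arguments lu_one {k} l i.

(* Graded left modules V, with V = \bigoplus_i 1_i V. *)
Record gmod k (A : lualg k) := GMod {
  gm_car :> gvect k;
  act : A -> gm_car -> gm_car;
  act_bilin : gbilinear act;
  actA : forall a b v, act (amul a b) v = act a (act b v);
  act_unital : forall v, exists s : seq (lu_idx A), uniq s /\
    v = \sum_(i <- s) act (lu_one A i) v }.

Arguments act {k A g} a v.

Record gbimod k (C D : lualg k) := GBimod {
  bm_car :> gvect k;
  lact : C -> bm_car -> bm_car;
  ract : bm_car -> D -> bm_car;
  lact_bilin : gbilinear lact;
  ract_bilin : gbilinear ract;
  lactA : forall a b m, lact (amul a b) m = lact a (lact b m);
  ractA : forall m a b, ract m (amul a b) = ract (ract m a) b;
  lractA : forall a m b, lact a (ract m b) = ract (lact a m) b;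
  lact_unital : forall m, exists s : seq (lu_idx C), uniq s /\
    m = \sum_(i <- s) lact (lu_one C i) m;
  ract_unital : forall m, exists s : seq (lu_idx D), uniq s /\
    m = \sum_(i <- s) ract m (lu_one D i) }.

Section UnitalTheory.
Variable k : closedFieldType.

Lemma idem_deg0 (A : galg k) (e : A) :
  homogeneous e -> amul e e = e -> gdeg 0 e.
Proof.
move=> [d ed] ee; have := gb_deg (amul_bilin A) ed ed; rewrite ee => edd.
have := gdeg_comp d edd; rewrite (ed : gcomp d e = e).
rewrite -[X in X == _]addr0 (inj_eq (addrI d)).
by case: eqP => [d0 _|_ ->]; [rewrite -d0 in ed | exact: gdeg0].
Qed.

Section Sums.
Variables (A : galg k) (I : choiceType) (one : I -> A) (lu : lunital one).

Let mulb := amul_bilin A.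

Lemma one_deg0 i : gdeg 0 (one i).
Proof. exact: idem_deg0 (lu_homog lu i) (lu_idem lu i). Qed.

Definition idsum (s : seq I) : A := \sum_(i <- s) one i.

Lemma idsum_deg0 s : gdeg 0 (idsum s).
Proof. by apply: gdeg_sum => i _; exact: one_deg0. Qed.

Lemma one_idsum i s : uniq s -> i \in s -> amul (one i) (idsum s) = one i.
Proof.
move=> us si; rewrite /idsum (gb_sumr mulb) (bigD1_seq i) //= (lu_idem lu).
by rewrite big1 ?addr0 // => j /eqP ji; apply: (lu_orth lu) => /esym.
Qed.

Lemma idsum_one i s : uniq s -> i \in s -> amul (idsum s) (one i) = one i.
Proof.
move=> us si; rewrite /idsum (gb_suml mulb) (bigD1_seq i) //= (lu_idem lu).
by rewrite big1 ?addr0 // => j /eqP ji; apply: (lu_orth lu).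
Qed.

Lemma idsum_mull r s : uniq s -> {subset r <= s} ->
  amul (idsum s) (idsum r) = idsum r.
Proof.
move=> us rs; rewrite {2 3}/idsum (gb_sumr mulb) big_seq [RHS]big_seq.
by apply: eq_bigr => i /rs si; rewrite idsum_one.
Qed.

Lemma idsum_mulr r s : uniq s -> {subset r <= s} ->
  amul (idsum r) (idsum s) = idsum r.
Proof.
move=> us rs; rewrite {1 3}/idsum (gb_suml mulb) big_seq [RHS]big_seq.
by apply: eq_bigr => i /rs si; rewrite one_idsum.
Qed.

Lemma idsum_idem s : uniq s -> amul (idsum s) (idsum s) = idsum s.
Proof. by move=> us; apply: idsum_mull. Qed.

Lemma idsum_dec s a :
  \sum_(i <- s) \sum_(j <- s) amul (amul (one i) a) (one j) =
  amul (amul (idsum s) a) (idsum s).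
Proof.
rewrite {1}/idsum !(gb_suml mulb); apply: eq_bigr => i _.
by rewrite (gb_sumr mulb).
Qed.

Lemma idsum_local a : exists s, [/\ uniq s, amul (idsum s) a = a &
  amul a (idsum s) = a].
Proof.
have [s [us]] := lu_dec lu a; rewrite idsum_dec => aE; exists s; split=> //.
  by rewrite {1}aE !(amulA (g := A)) idsum_idem // -aE.
by rewrite {1}aE -!(amulA (g := A)) idsum_idem // !(amulA (g := A)) -aE.
Qed.

End Sums.

Section Module.
Variables (A : lualg k) (V : gmod A).
Let one := lu_one A.
Let lu : lunital one := lu_unital A.
Let actb := act_bilin V.

Lemma act_idsum s (v : V) : \sum_(i <- s) act (one i) v = act (idsum one s) v.
Proof. by rewrite (gb_suml actb). Qed.

Lemma act_idsum_sub (r s : seq (lu_idx A)) (v : V) : uniq s -> {subset r <= s} ->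
  act (idsum one r) v = v -> act (idsum one s) v = v.
Proof. by move=> us rs vE; rewrite -{1}vE -actA idsum_mull. Qed.

End Module.

Lemma unital_sum (A : lualg k) (V : gvect k) (ac : A -> V -> V) (T : Type) (r : seq T)
    (F : T -> V) : gbilinear ac ->
  (forall a b v, ac (amul a b) v = ac a (ac b v)) ->
  (forall t, exists s : seq (lu_idx A), uniq s /\
     F t = \sum_(i <- s) ac (lu_one A i) (F t)) ->
  exists s : seq (lu_idx A), uniq s /\
    \sum_(t <- r) F t = \sum_(i <- s) ac (lu_one A i) (\sum_(t <- r) F t).
Proof.
move=> acb acA h; elim: r => [|t r [s [us IH]]].
  by exists [::]; rewrite !big_nil.
have [s' [us' Ft]] := h t; exists (undup (s ++ s')); split; first exact: undup_uniq.
have sub1 : {subset s <= undup (s ++ s')}.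
  by move=> x xs; rewrite mem_undup mem_cat xs.
have sub2 : {subset s' <= undup (s ++ s')}.
  by move=> x xs; rewrite mem_undup mem_cat xs orbT.
rewrite big_cons -(gb_suml acb) (gbDr acb) -/(idsum _ _); congr (_ + _).
  rewrite -(gb_suml acb) in Ft.
  by rewrite {2}Ft -acA idsum_mull ?undup_uniq //; exact: lu_unital.
rewrite -(gb_suml acb) in IH.
by rewrite {2}IH -acA idsum_mull ?undup_uniq //; exact: lu_unital.
Qed.

End UnitalTheory.

(* Hom_A(V, W)_d *)
Record ghom k (A : lualg k) (V W : gmod A) (d : int) (f : {linear V -> W}) : Prop :=
  GHom {
    gh_act : forall a v, f (act a v) = act a (f v);
    gh_deg : forall n v, gdeg n v -> gdeg (n + d) (f v) }.

Definition surj (T U : Type) (f : T -> U) : Prop := forall y, exists x, f x = y.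

Definition giso k (A : lualg k) (V W : gmod A) : Prop :=
  exists f : {linear V -> W}, ghom 0 f /\ bijective f.

(* q^d V is isomorphic to W *)
Definition giso_shift k (A : lualg k) (V W : gmod A) (d : int) : Prop :=
  exists f : {linear V -> W}, ghom d f /\ bijective f.

Record gsubmod k (A : lualg k) (V : gmod A) := GSubmod {
  gsm_sub :> gsubsp V;
  gsm_act : forall a v, gsm_sub v -> gsm_sub (act a v) }.

Section SubQuotient.
Variables (k : closedFieldType) (A : lualg k) (V : gmod A) (W : gsubmod V).

Let actb := act_bilin V.

Definition sub_act (a : A) (x : gsub W) : gsub W :=
  sub_in (gsm_act a (sub_carP x)).

Lemma sub_act_bilin : gbilinear sub_act.
Proof.
split=> [a b x|a x y|c a x|c a x|d e a x ad xe].
- by apply: val_inj; rewrite /= (gbDl actb).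
- by apply: val_inj; rewrite /= (gbDr actb).
- by apply: val_inj; rewrite /= (gbZl actb).
- by apply: val_inj; rewrite /= (gbZr actb).
by apply/gdeg_gsub; apply: (gb_deg actb) => //; apply/gdeg_gsub.
Qed.

Lemma sub_actA a b x : sub_act (amul a b) x = sub_act a (sub_act b x).
Proof. by apply: val_inj; rewrite /= actA. Qed.

Lemma sub_act_unital x : exists s : seq (lu_idx A), uniq s /\
  x = \sum_(i <- s) sub_act (lu_one A i) x.
Proof.
have [s [us xE]] := act_unital (val x); exists s; split=> //.
by apply: val_inj; rewrite raddf_sum.
Qed.

Definition gmod_sub : gmod A := GMod sub_act_bilin sub_actA sub_act_unital.

Definition quo_act (a : A) (x : gquo W) : gquo W := qpi W (act a (repr x)).

Lemma quo_actE a v : quo_act a (qpi W v) = qpi W (act a v).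
Proof.
apply/qpi_eq; rewrite -(gbBr actb); apply/gsm_act/qpi_eq.
exact: qpi_repr.
Qed.

Lemma quo_act_bilin : gbilinear quo_act.
Proof.
split=> [a b x|a x y|c a x|c a x|d e a x ad xe].
- by have [v ->] := qpi_surj x; rewrite !quo_actE (gbDl actb) linearD.
- have [u ->] := qpi_surj x; have [v ->] := qpi_surj y.
  by rewrite -linearD !quo_actE (gbDr actb) linearD.
- by have [v ->] := qpi_surj x; rewrite !quo_actE (gbZl actb) linearZ.
- by have [v ->] := qpi_surj x; rewrite -linearZ !quo_actE (gbZr actb) linearZ.
have [v [ve ->]] := gdeg_qpi_lift xe; rewrite quo_actE.
by apply: gdeg_qpi; apply: (gb_deg actb).
Qed.

Lemma quo_actA a b x : quo_act (amul a b) x = quo_act a (quo_act b x).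
Proof. by have [v ->] := qpi_surj x; rewrite !quo_actE actA. Qed.

Lemma quo_act_unital x : exists s : seq (lu_idx A), uniq s /\
  x = \sum_(i <- s) quo_act (lu_one A i) x.
Proof.
have [v ->] := qpi_surj x; have [s [us vE]] := act_unital v; exists s; split=> //.
by rewrite {1}vE linear_sum; apply: eq_bigr => i _; rewrite quo_actE.
Qed.

Definition gmod_quo : gmod A := GMod quo_act_bilin quo_actA quo_act_unital.

End SubQuotient.

Section Subquotient.
Variables (k : closedFieldType) (A : lualg k) (V : gmod A) (N M : gsubmod V).

Definition restr_set (x : gmod_sub M) : Prop := N (val x).

Lemma restr0 : restr_set 0.
Proof. exact: gs0. Qed.

Lemma restrD x y : restr_set x -> restr_set y -> restr_set (x + y).
Proof. exact: gsD. Qed.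

Lemma restrZ c x : restr_set x -> restr_set (c *: x).
Proof. exact: gsZ. Qed.

Lemma restr_comp d x : restr_set x -> restr_set (gcomp d x).
Proof. exact: gs_comp. Qed.

Lemma restr_act a x : restr_set x -> restr_set (act a x).
Proof. exact: gsm_act. Qed.

Definition restr_submod : gsubmod (gmod_sub M) :=
  @GSubmod _ _ (gmod_sub M) (GSubsp restr0 restrD restrZ restr_comp) restr_act.

(* M / N when N is contained in M; in general M / (M \cap N). *)
Definition gsection : gmod A := gmod_quo restr_submod.

End Subquotient.
Record gideal k (A : galg k) := GIdeal {
  gid_sub :> gsubsp A;
  gid_mull : forall a x, gid_sub x -> gid_sub (amul a x);
  gid_mulr : forall a x, gid_sub x -> gid_sub (amul x a) }.

Section QuotientAlgebra.
Variables (k : closedFieldType) (A : lualg k) (J : gideal A).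

Let mulb := amul_bilin A.

Definition quo_mul (x y : gquo J) : gquo J := qpi J (amul (repr x) (repr y)).

Lemma quo_mulE a b : quo_mul (qpi J a) (qpi J b) = qpi J (amul a b).
Proof.
apply/qpi_eq; set a' := repr _; set b' := repr _.
have -> : amul a' b' - amul a b = amul (a' - a) b' + amul a (b' - b).
  by rewrite (gbBl mulb) (gbBr mulb) addrA subrK.
by apply: gsD; [apply: gid_mulr|apply: gid_mull]; apply/qpi_eq/qpi_repr.
Qed.

Lemma quo_mul_bilin : gbilinear quo_mul.
Proof.
split=> [x y z|x y z|c x y|c x y|d e x y xd ye].
- have [a ->] := qpi_surj x; have [b ->] := qpi_surj y; have [c ->] := qpi_surj z.
  by rewrite -linearD !quo_mulE (gbDl mulb) linearD.
- have [a ->] := qpi_surj x; have [b ->] := qpi_surj y; have [c ->] := qpi_surj z.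
  by rewrite -linearD !quo_mulE (gbDr mulb) linearD.
- have [a ->] := qpi_surj x; have [b ->] := qpi_surj y.
  by rewrite -linearZ !quo_mulE (gbZl mulb) linearZ.
- have [a ->] := qpi_surj x; have [b ->] := qpi_surj y.
  by rewrite -linearZ !quo_mulE (gbZr mulb) linearZ.
have [a [ad ->]] := gdeg_qpi_lift xd; have [b [be ->]] := gdeg_qpi_lift ye.
by rewrite quo_mulE; apply: gdeg_qpi; apply: (gb_deg mulb).
Qed.

Lemma quo_mulA x y z : quo_mul x (quo_mul y z) = quo_mul (quo_mul x y) z.
Proof.
have [a ->] := qpi_surj x; have [b ->] := qpi_surj y; have [c ->] := qpi_surj z.
by rewrite !quo_mulE amulA.
Qed.

Definition galg_quo : galg k := GAlg quo_mul_bilin quo_mulA.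

Definition quo_one (i : lu_idx A) : galg_quo := qpi J (lu_one A i).

Lemma quo_unital : lunital quo_one.
Proof.
have lu := lu_unital A; split=> [i|i|i j ij|x].
- by have [d ed] := lu_homog lu i; exists d; apply: gdeg_qpi.
- by apply: etrans (quo_mulE _ _) _; rewrite (lu_idem lu).
- by apply: etrans (quo_mulE _ _) _; rewrite (lu_orth lu) // linear0.
have [a ->] := qpi_surj x; have [s [us aE]] := lu_dec lu a; exists s; split=> //.
rewrite {1}aE linear_sum; apply: eq_bigr => i _; rewrite linear_sum.
apply: eq_bigr => j _; apply/esym.
by apply: etrans (congr1 (quo_mul^~ _) (quo_mulE _ _)) _; exact: quo_mulE.
Qed.

Definition lualg_quo : lualg k := LUAlg quo_unital.

(* The pull-back of a module along the canonical surjection A -> A / J. *)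
Section Inflation.
Variable V : gmod lualg_quo.

Definition infl_act (a : A) (v : V) : V := act (qpi J a : lualg_quo) v.

Lemma infl_bilin : gbilinear infl_act.
Proof.
have actb := act_bilin V; split=> [a b v|a u v|c a v|c a v|d e a v ad ve].
- by rewrite /infl_act linearD (gbDl actb).
- exact: (gbDr actb).
- by rewrite /infl_act linearZ (gbZl actb).
- exact: (gbZr actb).
by apply: (gb_deg actb) => //; apply: gdeg_qpi.
Qed.

Lemma inflA a b v : infl_act (amul a b) v = infl_act a (infl_act b v).
Proof. by rewrite /infl_act -actA /amul /= quo_mulE. Qed.

Lemma infl_unital v : exists s : seq (lu_idx A), uniq s /\
  v = \sum_(i <- s) infl_act (lu_one A i) v.
Proof. exact: (act_unital v). Qed.

Definition infl : gmod A := GMod infl_bilin inflA infl_unital.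

End Inflation.
End QuotientAlgebra.

Inductive ideal_gen k (A : galg k) (E : set A) : A -> Prop :=
| IG_in x of E x : ideal_gen E x
| IG_0 : ideal_gen E 0
| IG_D x y of ideal_gen E x & ideal_gen E y : ideal_gen E (x + y)
| IG_Z (c : k) x of ideal_gen E x : ideal_gen E (c *: x)
| IG_mull a x of ideal_gen E x : ideal_gen E (amul a x)
| IG_mulr a x of ideal_gen E x : ideal_gen E (amul x a).

Section GeneratedIdeal.
Variables (k : closedFieldType) (A : galg k) (E : set A).
Hypothesis Ehom : forall x, E x -> homogeneous x.

Lemma ig_sum T (r : seq T) (P : pred T) (F : T -> A) :
  (forall t, P t -> ideal_gen E (F t)) -> ideal_gen E (\sum_(t <- r | P t) F t).
Proof.
by move=> h; apply: big_ind => //; [exact: IG_0 | move=> u v; exact: IG_D].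
Qed.

Lemma ig_comp d x : ideal_gen E x -> ideal_gen E (gcomp d x).
Proof.
have mulb := amul_bilin A; move=> xE; elim: xE d => {x} [x Ex|
  |x y _ IHx _ IHy|c x _ IH|a x _ IH|a x _ IH] d.
- have [e xe] := Ehom Ex; rewrite (gdeg_comp _ xe).
  by case: eqP => _; [exact: IG_in | exact: IG_0].
- by rewrite linear0; exact: IG_0.
- by rewrite linearD; apply: IG_D; [exact: IHx | exact: IHy].
- by rewrite linearZ /=; apply: IG_Z; exact: IH.
- by rewrite (gcomp_bilin mulb); apply: ig_sum => p _; apply: IG_mull; exact: IH.
rewrite [x in amul x _]gsuppE (gb_suml mulb) linear_sum; apply: ig_sum => p _ /=.
by rewrite (gcomp_degl mulb _ _ (gcomp_deg _ _)); apply/IG_mulr/IH.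
Qed.

Definition gen_ideal : gideal A :=
  @GIdeal _ _ (@GSubsp _ _ (ideal_gen E) (@IG_0 _ _ E) (@IG_D _ _ E) (@IG_Z _ _ E)
    ig_comp) (@IG_mull _ _ E) (@IG_mulr _ _ E).

End GeneratedIdeal.

Record hidem k (C : galg k) := HIdem {
  hi_elt :> C;
  hi_homog : homogeneous hi_elt;
  hi_idem : amul hi_elt hi_elt = hi_elt }.

Section Corner.
Variables (k : closedFieldType) (C : lualg k) (e : hidem C).

Let mulb := amul_bilin C.
Let e0 : gdeg 0 (e : C) := idem_deg0 (hi_homog e) (hi_idem e).

Definition corner_set (x : C) : Prop := exists y, x = amul (amul e y) e.

Lemma corner_set_comp d x : corner_set x -> corner_set (gcomp d x).
Proof.
move=> [y ->]; exists (gcomp d y).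
by rewrite (gcomp_degr mulb _ _ e0) subr0 (gcomp_degl mulb _ _ e0) subr0.
Qed.

Lemma corner_set0 : corner_set 0.
Proof. by exists 0; rewrite (gb0r mulb) (gb0l mulb). Qed.

Lemma corner_setD x y : corner_set x -> corner_set y -> corner_set (x + y).
Proof.
by move=> [a ->] [b ->]; exists (a + b); rewrite (gbDr mulb) (gbDl mulb).
Qed.

Lemma corner_setZ c x : corner_set x -> corner_set (c *: x).
Proof.
by move=> [a ->]; exists (c *: a); rewrite (gbZr mulb) (gbZl mulb).
Qed.

(* e C e *)
Definition corner_sub : gsubsp C :=
  GSubsp corner_set0 corner_setD corner_setZ corner_set_comp.

Lemma corner_el x : corner_set x -> amul e x = x.
Proof. by move=> [y ->]; rewrite !(amulA (g := C)) hi_idem. Qed.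

Lemma corner_er x : corner_set x -> amul x e = x.
Proof. by move=> [y ->]; rewrite -!(amulA (g := C)) hi_idem. Qed.

Lemma cornerM x y : corner_set x -> corner_set y -> corner_set (amul x y).
Proof.
move=> cx cy; exists (amul x y).
by rewrite (amulA (g := C)) (corner_el cx) -(amulA (g := C)) (corner_er cy).
Qed.

Definition corner_mul (x y : gsub corner_sub) : gsub corner_sub :=
  sub_in (W := corner_sub) (cornerM (sub_carP x) (sub_carP y)).

Lemma corner_bilin : gbilinear corner_mul.
Proof.
split=> [x y z|x y z|c x y|c x y|d f x y xd yf].
- by apply: val_inj; rewrite /= (gbDl mulb).
- by apply: val_inj; rewrite /= (gbDr mulb).
- by apply: val_inj; rewrite /= (gbZl mulb).
- by apply: val_inj; rewrite /= (gbZr mulb).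
by apply/gdeg_gsub; apply: (gb_deg mulb) => //; apply/gdeg_gsub.
Qed.

Lemma corner_mulA x y z : corner_mul x (corner_mul y z) = corner_mul (corner_mul x y) z.
Proof. by apply: val_inj; rewrite /= (amulA (g := C)). Qed.

Definition corner_alg : galg k := GAlg corner_bilin corner_mulA.

Lemma corner_set_e : corner_set e.
Proof. by exists e; rewrite !hi_idem. Qed.

Definition corner_one (i : unit) : corner_alg := sub_in (W := corner_sub) corner_set_e.

Lemma corner_unital : lunital corner_one.
Proof.
split=> [i|i|[] []//|x].
- by exists 0; apply/gdeg_gsub.
- by apply: val_inj; rewrite /= hi_idem.
exists [:: tt]; split=> //; rewrite !big_seq1; apply: val_inj => /=.
have cx : corner_set (val x) := sub_carP x.
by rewrite (corner_el cx) (corner_er cx).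
Qed.

Definition corner : lualg k := LUAlg corner_unital.

Definition leftid_set (x : C) : Prop := exists y, x = amul y e.

Lemma leftid_set_comp d x : leftid_set x -> leftid_set (gcomp d x).
Proof.
by move=> [y ->]; exists (gcomp d y); rewrite (gcomp_degr mulb _ _ e0) subr0.
Qed.

Lemma leftid_set0 : leftid_set 0.
Proof. by exists 0; rewrite (gb0l mulb). Qed.

Lemma leftid_setD x y : leftid_set x -> leftid_set y -> leftid_set (x + y).
Proof. by move=> [a ->] [b ->]; exists (a + b); rewrite (gbDl mulb). Qed.

Lemma leftid_setZ c x : leftid_set x -> leftid_set (c *: x).
Proof. by move=> [a ->]; exists (c *: a); rewrite (gbZl mulb). Qed.

(* C e *)
Definition leftid_sub : gsubsp C :=
  GSubsp leftid_set0 leftid_setD leftid_setZ leftid_set_comp.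

Lemma leftid_mull a x : leftid_set x -> leftid_set (amul a x).
Proof. by move=> [y ->]; exists (amul a y); rewrite (amulA (g := C)). Qed.

Lemma leftid_mulr x a : corner_set a -> leftid_set (amul x a).
Proof. by move=> [y ->]; exists (amul x (amul e y)); rewrite !(amulA (g := C)). Qed.

Definition leftid_lact (a : C) (x : gsub leftid_sub) : gsub leftid_sub :=
  sub_in (W := leftid_sub) (leftid_mull a (sub_carP x)).

Definition leftid_ract (x : gsub leftid_sub) (a : corner) : gsub leftid_sub :=
  sub_in (W := leftid_sub) (leftid_mulr (val x) (sub_carP a)).

Lemma leftid_lact_bilin : gbilinear leftid_lact.
Proof.
split=> [x y z|x y z|c x y|c x y|d f x y xd yf].
- by apply: val_inj; rewrite /= (gbDl mulb).
- by apply: val_inj; rewrite /= (gbDr mulb).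
- by apply: val_inj; rewrite /= (gbZl mulb).
- by apply: val_inj; rewrite /= (gbZr mulb).
by apply/gdeg_gsub; apply: (gb_deg mulb) => //; apply/gdeg_gsub.
Qed.

Lemma leftid_ract_bilin : gbilinear leftid_ract.
Proof.
split=> [x y z|x y z|c x y|c x y|d f x y xd yf].
- by apply: val_inj; rewrite /= (gbDl mulb).
- by apply: val_inj; rewrite /= (gbDr mulb).
- by apply: val_inj; rewrite /= (gbZl mulb).
- by apply: val_inj; rewrite /= (gbZr mulb).
by apply/gdeg_gsub; apply: (gb_deg mulb) => //; apply/gdeg_gsub.
Qed.

Lemma leftid_lactA a b x : leftid_lact (amul a b) x = leftid_lact a (leftid_lact b x).
Proof. by apply: val_inj; rewrite /= (amulA (g := C)). Qed.

Lemma leftid_ractA x a b :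
  leftid_ract x (amul a b) = leftid_ract (leftid_ract x a) b.
Proof. by apply: val_inj; rewrite /= (amulA (g := C)). Qed.

Lemma leftid_lractA a x b :
  leftid_lact a (leftid_ract x b) = leftid_ract (leftid_lact a x) b.
Proof. by apply: val_inj; rewrite /= (amulA (g := C)). Qed.

Lemma leftid_lact_unital x : exists s : seq (lu_idx C), uniq s /\
  x = \sum_(i <- s) leftid_lact (lu_one C i) x.
Proof.
have [s [us sx _]] := idsum_local (lu_unital C) (val x); exists s; split=> //.
by apply: val_inj; rewrite raddf_sum /= -(gb_suml mulb).
Qed.

Lemma leftid_ract_unital x : exists s : seq (lu_idx corner), uniq s /\
  x = \sum_(i <- s) leftid_ract x (lu_one corner i).
Proof.
exists [:: tt]; split=> //; rewrite big_seq1; apply: val_inj => /=.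
by have [y ->] := sub_carP x; rewrite -(amulA (g := C)) hi_idem.
Qed.

(* C e as a (C, e C e)-bimodule, and as a left C-module *)
Definition leftid_bimod : gbimod C corner :=
  GBimod leftid_lact_bilin leftid_ract_bilin leftid_lactA leftid_ractA
    leftid_lractA leftid_lact_unital leftid_ract_unital.

Definition leftid_mod : gmod C :=
  GMod leftid_lact_bilin leftid_lactA leftid_lact_unital.

End Corner.

(* The list [:: (m_1, v_1); ...; (m_n, v_n)] stands for the formal sum
   m_1 (x) v_1 + ... + m_n (x) v_n, and [tens_rel] is the congruence generated by
   bilinearity and by the balancing relations m b (x) v = m (x) b v. *)
Inductive tens_rel k (C D : lualg k) (M : gbimod C D) (V : gmod D) :
    seq (M * V) -> seq (M * V) -> Prop :=
| TR_refl x : tens_rel x x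
| TR_sym x y of tens_rel x y : tens_rel y x
| TR_trans x y z of tens_rel x y & tens_rel y z : tens_rel x z
| TR_cat x x' y y' of tens_rel x x' & tens_rel y y' : tens_rel (x ++ y) (x' ++ y')
| TR_catC x y : tens_rel (x ++ y) (y ++ x)
| TR_0l v : tens_rel [:: (0, v)] [::]
| TR_0r m : tens_rel [:: (m, 0)] [::]
| TR_Dl m m' v : tens_rel [:: (m + m', v)] [:: (m, v); (m', v)]
| TR_Dr m v v' : tens_rel [:: (m, v + v')] [:: (m, v); (m, v')]
| TR_Z (c : k) m v : tens_rel [:: (c *: m, v)] [:: (m, c *: v)]
| TR_bal m b v : tens_rel [:: (ract m b, v)] [:: (m, act b v)].

Section Tensor.
Variables (k : closedFieldType) (C D : lualg k) (M : gbimod C D) (V : gmod D).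

Let T := seq (M * V).
Implicit Types x y z : T.

Definition tens_relb : rel T := fun x y => `[< tens_rel x y >].

Lemma tens_relb_equiv : equiv_class_of tens_relb.
Proof.
split=> [x|x y|y x z].
- by apply/asboolP/TR_refl.
- by apply/asboolP/asboolP; exact: TR_sym.
by move=> /asboolP xy /asboolP yz; apply/asboolP; exact: TR_trans yz.
Qed.

Canonical tens_equiv := EquivRelPack tens_relb_equiv.
Canonical tens_encModRel := defaultEncModRel tens_relb.

Definition tens_car := {eq_quot tens_relb}.
HB.instance Definition _ := EqQuotient.on tens_car.
HB.instance Definition _ := Choice.on tens_car.

Definition tpi (x : T) : tens_car := \pi_tens_car x.

Lemma tpi_eq x y : tpi x = tpi y <-> tens_rel x y.
Proof.
rewrite /tpi; split=> [/eqP|h]; first by rewrite piE => /asboolP.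
by apply/eqP; rewrite piE; apply/asboolP.
Qed.

Lemma tpi_repr t : tpi (repr t) = t.
Proof. exact: reprK. Qed.

Definition tens_add (s t : tens_car) : tens_car := tpi (repr s ++ repr t).

Lemma tens_addE x y : tens_add (tpi x) (tpi y) = tpi (x ++ y).
Proof. by apply/tpi_eq/TR_cat; apply/tpi_eq/tpi_repr. Qed.

Definition zformal (c : k) (x : T) : T := [seq (c *: p.1, p.2) | p <- x].

Lemma zformal_rel c x y : tens_rel x y -> tens_rel (zformal c x) (zformal c y).
Proof.
elim=> {x y} [x|x y _ IH|x y z _ IH1 _ IH2|x x' y y' _ IH1 _ IH2|x y|v|m|m m' v
  |m v v'|a m v|m b v]; rewrite /zformal ?map_cat /=.
- exact: TR_refl.
- exact: TR_sym.
- exact: TR_trans IH2.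
- exact: TR_cat.
- exact: TR_catC.
- by rewrite scaler0; exact: TR_0l.
- exact: TR_0r.
- by rewrite scalerDr; exact: TR_Dl.
- exact: TR_Dr.
- by rewrite scalerA mulrC -scalerA; exact: TR_Z.
by rewrite -(gbZl (ract_bilin M)); exact: TR_bal.
Qed.

Definition tens_scale (c : k) (t : tens_car) : tens_car := tpi (zformal c (repr t)).

Lemma tens_scaleE c x : tens_scale c (tpi x) = tpi (zformal c x).
Proof. by apply/tpi_eq/zformal_rel/tpi_eq/tpi_repr. Qed.

Definition tens_zero : tens_car := tpi [::].
Definition tens_opp : tens_car -> tens_car := tens_scale (-1).

Lemma tens_addA : associative tens_add.
Proof.
move=> r s t; rewrite -[r]tpi_repr -[s]tpi_repr -[t]tpi_repr.
by rewrite !tens_addE catA.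
Qed.

Lemma tens_addC : commutative tens_add.
Proof.
move=> s t; rewrite -[s]tpi_repr -[t]tpi_repr !tens_addE.
exact/tpi_eq/TR_catC.
Qed.

Lemma tens_add0 : left_id tens_zero tens_add.
Proof. by move=> s; rewrite -[s]tpi_repr tens_addE. Qed.

Lemma tens_zformalD a b x : tens_rel (zformal (a + b) x) (zformal a x ++ zformal b x).
Proof.
elim: x => [|[m v] x IH] /=; first exact: TR_refl.
rewrite scalerDl -cat1s; apply: TR_trans (TR_cat (TR_Dl _ _ _) IH) _ => /=.
rewrite -[X in tens_rel X]cat1s -[X in tens_rel _ X]cat1s.
apply: TR_cat; first exact: TR_refl.
rewrite -cat1s catA; apply: TR_trans (TR_cat (TR_catC _ _) (TR_refl _)) _.
by rewrite -catA; exact: TR_refl.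
Qed.

Lemma tens_zformal0 x : tens_rel (zformal 0 x) [::].
Proof.
elim: x => [|[m v] x IH] /=; first exact: TR_refl.
by rewrite scale0r -cat1s -[[::]]cat0s; apply: TR_cat => //; exact: TR_0l.
Qed.

Lemma zformal1 x : zformal 1 x = x.
Proof. by rewrite -[RHS]map_id; apply: eq_map => -[m v] /=; rewrite scale1r. Qed.

Lemma tens_addN : left_inverse tens_zero tens_opp tens_add.
Proof.
move=> s; rewrite -[s]tpi_repr /tens_opp tens_scaleE tens_addE; apply/tpi_eq.
rewrite -{2}[repr s]zformal1; apply: TR_trans (TR_sym (tens_zformalD _ _ _)) _.
by rewrite addNr; exact: tens_zformal0.
Qed.

HB.instance Definition _ :=
  GRing.isZmodule.Build tens_car tens_addA tens_addC tens_add0 tens_addN.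

Lemma tpiD x y : tpi (x ++ y) = tpi x + tpi y.
Proof. by rewrite -tens_addE. Qed.

Lemma tens_scalerA a b t : tens_scale a (tens_scale b t) = tens_scale (a * b) t.
Proof.
rewrite -[t]tpi_repr !tens_scaleE; congr tpi; rewrite /zformal -map_comp.
by apply: eq_map => -[m v] /=; rewrite scalerA.
Qed.

Lemma tens_scale1r : left_id 1 tens_scale.
Proof. by move=> t; rewrite -[t]tpi_repr tens_scaleE zformal1. Qed.

Lemma tens_scalerDr : right_distributive tens_scale +%R.
Proof.
move=> c s t; rewrite -[s]tpi_repr -[t]tpi_repr -tpiD !tens_scaleE.
by rewrite /zformal map_cat tpiD.
Qed.

Lemma tens_scalerDl t : {morph tens_scale^~ t : a b / a + b}.
Proof.
move=> a b; rewrite -[t]tpi_repr !tens_scaleE -tpiD.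
exact/tpi_eq/tens_zformalD.
Qed.

HB.instance Definition _ := GRing.Zmodule_isLmodule.Build k tens_car
  tens_scalerA tens_scale1r tens_scalerDr tens_scalerDl.

Definition tens (m : M) (v : V) : tens_car := tpi [:: (m, v)].

Lemma tpi_sum x : tpi x = \sum_(p <- x) tens p.1 p.2.
Proof.
elim: x => [|[m v] x IH]; first by rewrite big_nil.
by rewrite big_cons -IH -cat1s tpiD.
Qed.

Lemma tens_gen t : exists x : T, t = \sum_(p <- x) tens p.1 p.2.
Proof. by exists (repr t); rewrite -tpi_sum tpi_repr. Qed.

Lemma tensDl m m' v : tens (m + m') v = tens m v + tens m' v.
Proof. by rewrite /tens -tpiD; apply/tpi_eq/TR_Dl. Qed.

Lemma tensDr m v v' : tens m (v + v') = tens m v + tens m v'.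
Proof. by rewrite /tens -tpiD; apply/tpi_eq/TR_Dr. Qed.

Lemma tensZl c m v : tens (c *: m) v = c *: tens m v.
Proof. by rewrite -[RHS]/(tens_scale _ _) /tens tens_scaleE. Qed.

Lemma tensZr c m v : tens m (c *: v) = c *: tens m v.
Proof. by rewrite -tensZl; apply/esym/tpi_eq/TR_Z. Qed.

Lemma tens_bal m b v : tens (ract m b) v = tens m (act b v).
Proof. exact/tpi_eq/TR_bal. Qed.

Lemma tens0l v : tens 0 v = 0.
Proof. by rewrite -(scale0r 0) tensZl scale0r. Qed.

Lemma tens0r m : tens m 0 = 0.
Proof. by rewrite -(scale0r 0) tensZr scale0r. Qed.

Lemma tens_suml (J : Type) (r : seq J) P (F : J -> M) v :
  tens (\sum_(j <- r | P j) F j) v = \sum_(j <- r | P j) tens (F j) v.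
Proof. by apply: (big_morph (tens^~ v)) => [a b|]; rewrite ?tensDl ?tens0l. Qed.

Lemma tens_sumr (J : Type) (r : seq J) P m (F : J -> V) :
  tens m (\sum_(j <- r | P j) F j) = \sum_(j <- r | P j) tens m (F j).
Proof. by apply: (big_morph (tens m)) => [a b|]; rewrite ?tensDr ?tens0r. Qed.

Section Lift.
Variables (U : lmodType k) (f : M -> V -> U).

Record balanced : Prop := Balanced {
  balDl : forall m m' v, f (m + m') v = f m v + f m' v;
  balDr : forall m v v', f m (v + v') = f m v + f m v';
  balZl : forall c m v, f (c *: m) v = c *: f m v;
  balZr : forall c m v, f m (c *: v) = c *: f m v;
  bal_act : forall m b v, f (ract m b) v = f m (act b v) }.

Hypothesis hf : balanced.

Definition tlift_seq (x : T) : U := \sum_(p <- x) f p.1 p.2.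

Lemma tlift_rel x y : tens_rel x y -> tlift_seq x = tlift_seq y.
Proof.
rewrite /tlift_seq.
elim=> {x y} [x|x y _ IH|x y z _ IH1 _ IH2|x x' y y' _ IH1 _ IH2|x y|v|m|m m' v
  |m v v'|a m v|m b v] //; rewrite ?big_cat ?big_cons ?big_nil /= ?addr0.
- exact: etrans IH2.
- by rewrite IH1 IH2.
- by rewrite addrC.
- by rewrite -(scale0r 0) (balZl hf) scale0r.
- by rewrite -(scale0r 0) (balZr hf) scale0r.
- exact: (balDl hf).
- exact: (balDr hf).
- by rewrite (balZl hf) (balZr hf).
exact: (bal_act hf).
Qed.

Definition tlift_fun (t : tens_car) : U := tlift_seq (repr t).

Lemma tlift_funE x : tlift_fun (tpi x) = tlift_seq x.
Proof. exact/tlift_rel/tpi_eq/tpi_repr. Qed.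

Lemma tlift_linear : linear tlift_fun.
Proof.
move=> c s t; rewrite -[s]tpi_repr -[t]tpi_repr -[c *: _]/(tens_scale _ _).
rewrite tens_scaleE -tpiD !tlift_funE /tlift_seq big_cat big_map scaler_sumr.
by congr (_ + _); apply: eq_bigr => p _; rewrite /= (balZl hf).
Qed.

Definition tlift : {linear tens_car -> U} :=
  HB.pack tlift_fun (GRing.isLinear.Build _ _ _ _ _ tlift_linear).

Lemma tliftE m v : tlift (tens m v) = f m v.
Proof. by rewrite /= tlift_funE /tlift_seq big_seq1. Qed.

End Lift.

Lemma tens_ext (U : lmodType k) (f g : {linear tens_car -> U}) :
  (forall m v, f (tens m v) = g (tens m v)) -> f =1 g.
Proof.
move=> fg t; have [x ->] := tens_gen t; rewrite !linear_sum.
by apply: eq_bigr => p _; rewrite fg.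
Qed.

Definition tcomp_fun d (m : M) (v : V) : tens_car :=
  \sum_(p <- gsupp m) tens (gcomp p m) (gcomp (d - p) v).

Lemma tcomp_funE d m v (r : seq int) : uniq r -> {subset gsupp m <= r} ->
  tcomp_fun d m v = \sum_(p <- r) tens (gcomp p m) (gcomp (d - p) v).
Proof.
by move=> ur sr; rewrite (gsupp_sum ur sr) // => p ->; rewrite tens0l.
Qed.

Lemma tcomp_bal d : balanced (tcomp_fun d).
Proof.
split=> [m m' v|m v v'|c m v|c m v|m b v].
- pose r := undup (gsupp m ++ gsupp m' ++ gsupp (m + m')).
  rewrite !(tcomp_funE d v (r := r)) ?undup_uniq //.
  + by rewrite -big_split; apply: eq_bigr => p _; rewrite linearD tensDl.
  + by move=> p pm; rewrite mem_undup !mem_cat pm orbT.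
  + by move=> p pm; rewrite mem_undup !mem_cat pm.
  by move=> p pm; rewrite mem_undup !mem_cat pm !orbT.
- by rewrite -big_split; apply: eq_bigr => p _; rewrite linearD tensDr.
- pose r := undup (gsupp m ++ gsupp (c *: m)).
  rewrite !(tcomp_funE d v (r := r)) ?undup_uniq //.
  + by rewrite scaler_sumr; apply: eq_bigr => p _; rewrite linearZ tensZl.
  + by move=> p pm; rewrite mem_undup mem_cat pm.
  by move=> p pm; rewrite mem_undup mem_cat pm orbT.
- rewrite scaler_sumr; apply: eq_bigr => p _.
  by rewrite linearZ tensZr.
pose r := undup (gsupp (ract m b) ++ [seq p + q | p <- gsupp m, q <- gsupp b]).
rewrite (tcomp_funE d v (r := r)) ?undup_uniq //; last first.
  by move=> p pm; rewrite mem_undup mem_cat pm.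
have rb := ract_bilin M; have ab := act_bilin V.
transitivity (\sum_(p <- gsupp m) \sum_(q <- gsupp b)
    tens (ract (gcomp p m) (gcomp q b)) (gcomp (d - (p + q)) v)).
  transitivity (\sum_(s <- r) \sum_(p <- gsupp m) \sum_(q <- gsupp b)
      if s == p + q then tens (ract (gcomp p m) (gcomp q b)) (gcomp (d - s) v) else 0).
    apply: eq_bigr => s _; rewrite (gcomp_bilin rb) tens_suml.
    apply: eq_bigr => p _; rewrite [in LHS](gsuppE b) linear_sum.
    rewrite (gb_sumr rb) tens_suml; apply: eq_bigr => q _.
    rewrite gcomp_proj; case: eqP => [<-|ne]; first by rewrite [p + _]addrC subrK eqxx.
    case: eqP => [se|_]; last by rewrite (gb0r rb) tens0l.
    by case: ne; rewrite se addrAC subrr add0r.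
  rewrite exchange_big big_seq [RHS]big_seq; apply: eq_bigr => p pm.
  rewrite exchange_big big_seq [RHS]big_seq; apply: eq_bigr => q qb.
  rewrite (bigD1_seq (p + q)) ?undup_uniq //=; last first.
    by rewrite mem_undup mem_cat; apply/orP; right; apply/allpairsP; exists (p, q).
  by rewrite eqxx big1 ?addr0 // => s /negPf ->.
rewrite /tcomp_fun; apply: eq_bigr => p _.
rewrite (gcomp_bilin ab) tens_sumr; apply: eq_bigr => q _.
by rewrite tens_bal opprD addrA.
Qed.

Definition tcomp d : {linear tens_car -> tens_car} := tlift (tcomp_bal d).

Lemma tcompE d m v : tcomp d (tens m v) =
  \sum_(p <- gsupp m) tens (gcomp p m) (gcomp (d - p) v).
Proof. exact: tliftE. Qed.

Lemma tcomp_sum d (J : Type) (r : seq J) (F : J -> tens_car) :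
  tcomp d (\sum_(j <- r) F j) = \sum_(j <- r) tcomp d (F j).
Proof. exact: linear_sum. Qed.

Lemma tcomp_hom d p q m v : gdeg p m -> gdeg q v ->
  tcomp d (tens m v) = if d == p + q then tens m v else 0.
Proof.
move=> mp vq; rewrite tcompE.
have -> : tens m v = \sum_(s <- gsupp m) tens (gcomp s m) v.
  by rewrite -tens_suml -gsuppE.
case: (d =P p + q) => [->|ne].
  apply: eq_bigr => s _; rewrite (gdeg_comp _ mp); case: eqP => [->|_].
    by rewrite (gdeg_comp _ vq) addrAC subrr add0r eqxx.
  by rewrite !tens0l.
apply: big1 => s _; rewrite (gdeg_comp _ mp); case: eqP => [->|_]; last exact: tens0l.
rewrite (gdeg_comp _ vq); case: eqP => [e|_]; last exact: tens0r.
by case: ne; rewrite -e addrC subrK.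
Qed.

Lemma tens_gen_hom t : exists x : seq (int * int * (M * V)),
  (forall p, p \in x -> gdeg p.1.1 p.2.1 /\ gdeg p.1.2 p.2.2) /\
  t = \sum_(p <- x) tens p.2.1 p.2.2.
Proof.
have [x ->] := tens_gen t; elim: x => [|[m v] x [y [yh yE]]].
  by exists [::]; rewrite !big_nil.
exists ([seq (p, q, (gcomp p m, gcomp q v)) | p <- gsupp m, q <- gsupp v] ++ y).
split=> [p|].
  rewrite mem_cat => /orP[/allpairsP[[a b] /= [_ _ ->]]|/yh//].
  by split; exact: gcomp_deg.
rewrite big_cons big_cat /= yE big_allpairs_dep /=; congr (_ + _).
rewrite {1}(gsuppE m) tens_suml; apply: eq_bigr => p _.
by rewrite {1}(gsuppE v) tens_sumr.
Qed.

Lemma tcomp_proj d e t : tcomp d (tcomp e t) = if d == e then tcomp e t else 0.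
Proof.
have [x [xh ->]] := tens_gen_hom t; rewrite !tcomp_sum.
transitivity (\sum_(p <- x) if d == e then tcomp e (tens p.2.1 p.2.2) else 0).
  rewrite big_seq [RHS]big_seq; apply: eq_bigr => p /xh [h1 h2].
  rewrite (tcomp_hom _ h1 h2); case: (e =P _) => [->|_]; last first.
    by rewrite linear0; case: ifP.
  exact: tcomp_hom.
by case: eqP => // _; rewrite big1.
Qed.

Lemma tcomp_fin t : exists s : seq int, uniq s /\ t = \sum_(d <- s) tcomp d t.
Proof.
have [x [xh ->]] := tens_gen_hom t.
exists (undup [seq p.1.1 + p.1.2 | p <- x]); split; first exact: undup_uniq.
under [RHS]eq_bigr do rewrite tcomp_sum.
rewrite exchange_big big_seq [RHS]big_seq; apply: eq_bigr => p px.
have [h1 h2] := xh _ px.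
rewrite (bigD1_seq (p.1.1 + p.1.2)) ?undup_uniq //; last first.
  by rewrite mem_undup; apply/mapP; exists p.
rewrite (tcomp_hom _ h1 h2) eqxx big1 => [|s /negPf ne]; first exact/esym/addr0.
by rewrite (tcomp_hom _ h1 h2) ne.
Qed.

(* (M (x)_D V)_d is spanned by the m (x) v with m in M_p, v in V_q, p + q = d *)
Definition gtens : gvect k := GVect tcomp_proj tcomp_fin.

Lemma gdeg_tens p q m v : gdeg p m -> gdeg q v -> gdeg (p + q) (tens m v : gtens).
Proof. by move=> mp vq; rewrite /gdeg [LHS](tcomp_hom _ mp vq) eqxx. Qed.

Lemma tact_bal (a : C) : balanced (fun m v => tens (lact a m) v).
Proof.
have lb := lact_bilin M; split=> [m m' v|m v v'|c m v|c m v|m b v].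
- by rewrite (gbDr lb) tensDl.
- exact: tensDr.
- by rewrite (gbZr lb) tensZl.
- exact: tensZr.
by rewrite lractA tens_bal.
Qed.

Definition tact (a : C) (t : gtens) : gtens := tlift (tact_bal a) t.

Lemma tactE a m v : tact a (tens m v) = tens (lact a m) v.
Proof. exact: tliftE. Qed.

Lemma tact_sum a (J : Type) (r : seq J) (F : J -> gtens) :
  tact a (\sum_(j <- r) F j) = \sum_(j <- r) tact a (F j).
Proof. exact: linear_sum. Qed.

Lemma gdeg_tens_gen d (t : gtens) : gdeg d t -> exists x : seq (int * int * (M * V)),
  (forall p, p \in x ->
     [/\ gdeg p.1.1 p.2.1, gdeg p.1.2 p.2.2 & p.1.1 + p.1.2 = d]) /\
  t = \sum_(p <- x) tens p.2.1 p.2.2.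
Proof.
move=> td; have [x [xh tE]] := tens_gen_hom t.
exists [seq p <- x | d == p.1.1 + p.1.2]; split=> [p|].
  by rewrite mem_filter => /andP[/eqP-> /xh []].
transitivity (tcomp d t); first exact/esym.
rewrite big_filter tE tcomp_sum [RHS]big_mkcond /= big_seq [RHS]big_seq.
apply: eq_bigr => p /xh [h1 h2]; exact: tcomp_hom.
Qed.

Lemma tact_bilin : gbilinear tact.
Proof.
have lb := lact_bilin M; split=> [a b t|a s t|c a t|c a t|d e a t ad te].
- have [x ->] := tens_gen t; rewrite !tact_sum -big_split; apply: eq_bigr => p _.
  by rewrite !tactE (gbDl lb) tensDl.
- exact: linearD.
- have [x ->] := tens_gen t; rewrite !tact_sum scaler_sumr; apply: eq_bigr => p _.
  by rewrite !tactE (gbZl lb) tensZl.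
- exact: linearZ.
have [x [xh ->]] := gdeg_tens_gen te; rewrite tact_sum big_seq; apply: gdeg_sum.
move=> p /xh [h1 h2 <-]; rewrite tactE addrA; apply: gdeg_tens => //.
exact: (gb_deg lb).
Qed.

Lemma tactA a b t : tact (amul a b) t = tact a (tact b t).
Proof.
have [x ->] := tens_gen t.
rewrite (tact_sum b) (tact_sum a) (tact_sum (amul a b)); apply: eq_bigr => p _.
by rewrite !tactE lactA.
Qed.

Lemma tact_unital t : exists s : seq (lu_idx C), uniq s /\
  t = \sum_(i <- s) tact (lu_one C i) t.
Proof.
have [x ->] := tens_gen t; apply: unital_sum tact_bilin tactA _ => p.
have [s [us mE]] := lact_unital p.1; exists s; split=> //.
rewrite {1}mE tens_suml; apply: eq_bigr => i _.
by rewrite tactE.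
Qed.

(* M (x)_D V *)
Definition tensor : gmod C := GMod tact_bilin tactA tact_unital.

End Tensor.
Section ModuleNotions.
Variables (k : closedFieldType) (A : lualg k).

Definition irreducible (V : gmod A) : Prop :=
  (exists v : V, v <> 0) /\
  forall W : gsubmod V, (forall v, W v -> v = 0) \/ (forall v, W v).

Definition projective (P : gmod A) : Prop :=
  forall (V W : gmod A) (g : {linear V -> W}) (f : {linear P -> W}),
    ghom 0 g -> surj g -> ghom 0 f ->
    exists h : {linear P -> V}, ghom 0 h /\ forall x, g (h x) = f x.

(* P is projective, with a surjection p onto L whose kernel is superfluous:
   N + Ker p = P implies N = P. *)
Definition proj_cover (P L : gmod A) : Prop :=
  projective P /\
  exists p : {linear P -> L}, [/\ ghom 0 p, surj p &
    forall N : gsubmod P, (forall x, exists2 y, N y & p (x - y) = 0) ->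
      forall x, N x].

Definition maximal_submod (V : gmod A) (M : gsubmod V) : Prop :=
  (exists v, ~ M v) /\
  forall N : gsubmod V, (forall v, M v -> N v) -> (exists v, ~ N v) ->
    forall v, N v -> M v.

Definition radical (V : gmod A) (v : V) : Prop :=
  forall M : gsubmod V, maximal_submod M -> M v.

(* L is isomorphic to V / rad V *)
Definition is_head (V L : gmod A) : Prop :=
  exists p : {linear V -> L}, [/\ ghom 0 p, surj p &
    forall v, p v = 0 <-> radical v].

Definition irr_quotient (V L : gmod A) : Prop :=
  irreducible L /\ exists p : {linear V -> L}, ghom 0 p /\ surj p.

Definition full_irr (T : Type) (L : T -> gmod A) : Prop :=
  [/\ forall b, irreducible (L b),
      forall b c d, giso_shift (L b) (L c) d -> b = c &
      forall V : gmod A, irreducible V -> exists b d, giso_shift (L b) V d].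

(* (1_i V)_d *)
Definition wt_deg (V : gmod A) (i : lu_idx A) (d : int) (v : V) : Prop :=
  gdeg d v /\ act (lu_one A i) v = v.

Definition lfd_mod (V : gmod A) : Prop :=
  forall i d, fin_dim (@wt_deg V i d).

Definition bb_mod (V : gmod A) : Prop :=
  forall i, exists N : int, forall d, (d < N)%R ->
    forall v : V, wt_deg i d v -> v = 0.

(* (1_i A 1_j)_d *)
Definition peirce (i j : lu_idx A) (d : int) (a : A) : Prop :=
  gdeg d a /\ amul (amul (lu_one A i) a) (lu_one A j) = a.

Definition lfd_alg : Prop := forall i j d, fin_dim (peirce i j d).

Definition bb_alg : Prop :=
  forall i j, exists N : int, forall d, (d < N)%R ->
    forall a, peirce i j d a -> a = 0.

Lemma regular_unital (v : A) : exists s : seq (lu_idx A), uniq s /\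
  v = \sum_(i <- s) amul (lu_one A i) v.
Proof.
have [s [us sv _]] := idsum_local (lu_unital A) v; exists s; split=> //.
by rewrite -(gb_suml (amul_bilin A)).
Qed.

Definition regular : gmod A :=
  GMod (amul_bilin A) (fun a b v => esym (amulA a b v)) regular_unital.

(* The quotient by the graded Jacobson radical (the intersection of the maximal
   graded left ideals) is k: it is the kernel of a surjective homomorphism of
   graded algebras to k. *)
Definition graded_local : Prop :=
  exists eps : {linear A -> k^o},
    [/\ surj eps,
        forall a b, eps (amul a b) = eps a * eps b,
        forall d a, d <> 0 -> gdeg d a -> eps a = 0 &
        forall a, eps a = 0 <-> radical (V := regular) a].

End ModuleNotions.

(* Modules over A = \bigoplus 1'_p A 1'_r viewed as modules over
   A = \bigoplus 1_i A 1_j, for two families of idempotents of the same A. *)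
Section ChangeIdempotents.
Variables (k : closedFieldType) (A : lualg k).
Variables (K : choiceType) (one' : K -> A) (lu' : lunital one').
Variable V : gmod (LUAlg lu').

Lemma chg_unital (v : V) : exists s : seq (lu_idx A), uniq s /\
  v = \sum_(i <- s) act (lu_one A i : LUAlg lu') v.
Proof.
have [r [_ vE]] := act_unital v.
have [s [us su _]] := idsum_local (lu_unital A) (idsum one' r).
exists s; split=> //; rewrite -(gb_suml (act_bilin V)) -/(idsum _ _).
rewrite -(gb_suml (act_bilin V)) -/(idsum _ _) in vE.
rewrite {2}vE; apply: etrans (actA (A := LUAlg lu') _ _ _).
by rewrite [amul _ _]su.
Qed.

Definition gmod_chg : gmod A :=
  @GMod k A V (@act _ (LUAlg lu') V) (act_bilin V) (@actA _ _ V) chg_unital.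

End ChangeIdempotents.

(* The special index set S is given by an injection [spi] into the index set;
   [wt] is the function s |-> \dot s. *)
Record weights k (A : lualg k) disp (L : porderType disp) := Weights {
  spec : choiceType;
  spi : spec -> lu_idx A;
  spi_inj : injective spi;
  wt : spec -> L }.

Arguments spi {k A disp L w} s.
Arguments wt {k A disp L w} s.

Definition spone k (A : lualg k) disp (L : porderType disp) (w : weights A L)
  (s : spec w) : A := lu_one A (spi s).

Definition prod3 k (A : galg k) (p : A * A * A) : A := amul (amul p.1.1 p.1.2) p.2.

Local Open Scope classical_set_scope.

Record gtbasis k (A : lualg k) disp (L : porderType disp) (w : weights A L) :=
  GTBasis {
    gtX : lu_idx A -> spec w -> set A;
    gtH : spec w -> spec w -> set A;
    gtY : spec w -> lu_idx A -> set A;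
    gt_lower_finite : forall l : L, finite_set [set m | (m <= l)%O];
    gt_fibers : forall l : L, finite_set [set s : spec w | wt s = l];
    gtX_in : forall i s x, gtX i s x ->
      homogeneous x /\ exists a, x = amul (amul (lu_one A i) a) (spone s);
    gtH_in : forall s t h, gtH s t h ->
      homogeneous h /\ exists a, h = amul (amul (spone s) a) (spone t);
    gtY_in : forall t j y, gtY t j y ->
      homogeneous y /\ exists a, y = amul (amul (spone t) a) (lu_one A j);
    gt_basis : is_basis
      [set p : A * A * A | exists s t : spec w,
         [/\ exists i, gtX i s p.1.1, gtH s t p.1.2 & exists j, gtY t j p.2]]
      (@prod3 k A);
    gtX_one : forall s, gtX (spi s) s = [set spone s];
    gtY_one : forall s, gtY s (spi s) = [set spone s];
    gtX_tri : forall s t, s <> t -> gtX (spi s) t !=set0 -> (wt t < wt s)%O;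
    gtH_tri : forall s t, s <> t -> gtH s t !=set0 -> wt s = wt t;
    gtY_tri : forall s t, s <> t -> gtY s (spi t) !=set0 -> (wt s < wt t)%O;
    gtX_fin : forall i, ~ range (@spi _ _ _ _ w) i ->
      finite_set [set s | gtX i s !=set0];
    gtY_fin : forall i, ~ range (@spi _ _ _ _ w) i ->
      finite_set [set s | gtY s i !=set0] }.

Section Strata.
Variables (k : closedFieldType) (A : lualg k) (disp : Order.disp_t).
Variables (L : porderType disp) (w : weights A L).

Let lu := lu_unital A.

(* e_l, a finite sum when the fibers of [wt] are finite *)
Definition esum (l : L) : A := \sum_(s \in [set s : spec w | wt s = l]) spone s.

Lemma esum_homog l : homogeneous (esum l).
Proof. by exists 0; apply: gdeg_sum => s _; exact: (one_deg0 (lu_unital A)). Qed.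

Lemma esum_idem l : amul (esum l) (esum l) = esum l.
Proof.
rewrite /esum; set r := finite_support _ _ _.
have ur : uniq (map (@spi _ _ _ _ w) r).
  by rewrite map_inj_uniq; [exact: finite_support_uniq | exact: spi_inj].
have -> : \sum_(s <- r) spone s = idsum (lu_one A) (map (@spi _ _ _ _ w) r).
  by rewrite /idsum big_map.
exact: idsum_idem.
Qed.

Definition not_ge (l : L) : set A := [set x | exists2 m, ~~ (l <= m)%O & x = esum m].

Lemma not_ge_homog l x : not_ge l x -> homogeneous x.
Proof. by move=> [m _ ->]; exact: esum_homog. Qed.

(* A_(>= l) *)
Definition A_ge (l : L) : lualg k := lualg_quo (gen_ideal (@not_ge_homog l)).

Definition ebar_elt (l : L) : A_ge l := qpi _ (esum l).

Lemma ebar_homog l : homogeneous (ebar_elt l).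
Proof. by have [d ed] := esum_homog l; exists d; apply: gdeg_qpi. Qed.

Lemma ebar_idem l : amul (ebar_elt l) (ebar_elt l) = ebar_elt l.
Proof. by apply: etrans (quo_mulE _ _ _) _; rewrite esum_idem. Qed.

Definition ebar (l : L) : hidem (A_ge l) := HIdem (@ebar_homog l) (@ebar_idem l).

(* A_l *)
Definition A_loc (l : L) : lualg k := corner (ebar l).

(* j^l_! V = A_(>= l) \bar e_l (x)_(A_l) V *)
Definition jshriek (l : L) (V : gmod (A_loc l)) : gmod (A_ge l) :=
  tensor (leftid_bimod (ebar l)) V.

(* j^l_! followed by inflation to A *)
Definition standardize (l : L) (V : gmod (A_loc l)) : gmod A := infl (jshriek V).

End Strata.

Record baqh k (D : lualg k) disp (Bl : finPOrderType disp) := Baqh {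
  bq_idx : choiceType;
  bq_one : bq_idx -> D;
  bq_unital : lunital bq_one;
  bq_in : Bl -> bq_idx;
  bq_inj : injective bq_in;
  bq_alg : lualg k := LUAlg bq_unital;
  bq_wts : weights bq_alg Bl := @Weights k bq_alg disp Bl Bl bq_in bq_inj id;
  bq_basis : gtbasis bq_wts;
  bq_local : forall b : Bl, graded_local (A_loc bq_wts b) }.

Section Layers.
Variables (k : closedFieldType) (D : lualg k) (disp : Order.disp_t).
Variables (Bl : finPOrderType disp) (R : baqh D Bl) (b : Bl).

(* \bar 1'_b D_(>= b) \bar 1'_b *)
Definition cartan : lualg k := A_loc (bq_wts R) b.

(* D_(>= b) \bar 1'_b *)
Definition std_mod : gmod D := gmod_chg (infl (leftid_mod (ebar (bq_wts R) b))).

(* V is a \Delta_l-layer of type b, for D = A_l *)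
Definition std_layer (V : gmod D) : Prop :=
  exists Q : gmod cartan, [/\ projective Q, lfd_mod Q, bb_mod Q &
    giso V (gmod_chg (standardize Q))].

End Layers.

Section PureFlags.
Variables (k : closedFieldType) (A : lualg k) (disp dB : Order.disp_t).
Variables (L : porderType disp) (w : weights A L) (B : L -> finPOrderType dB).
Variable R : forall l, baqh (A_loc w l) (B l).

Definition pure_std (b : {l : L & B l}) : gmod A :=
  standardize (std_mod (R (tag b)) (tagged b)).

Definition pure_layer (b : {l : L & B l}) (V : gmod A) : Prop :=
  exists Vb : gmod (A_loc w (tag b)),
    std_layer (R (tag b)) (tagged b) Vb /\ giso V (standardize Vb).

(* The refined order on {l : L & B l} is the lexicographic order that the library
   puts on dependent pairs. *)
Record pure_flag (V : gmod A) (n : nat) (F : nat -> gsubmod V)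
    (t : 'I_n -> {l : L & B l}) : Prop := PureFlag {
  pf_bot : forall v, F 0%N v -> v = 0;
  pf_top : forall v, F n v;
  pf_sub : forall r, (r < n)%N -> forall v, F r v -> F r.+1 v;
  pf_inj : injective t;
  pf_layer : forall r : 'I_n, pure_layer (t r) (gsection (F r) (F r.+1)) }.

End PureFlags.

(* Main.v *)
From HB Require Import structures.
Require Import Defs.
From mathcomp Require Import all_boot all_order all_algebra.
From mathcomp Require Import finmap.
From mathcomp Require Import all_classical.

Set Implicit Arguments.
Unset Strict Implicit.
Unset Printing Implicit Defensive.

(** The flag of P(b) consists of trace submodules. For each type a = (mu, c), lift
  the idempotent of A_mu attached to c to an element eps_a of A [refined_idem]. A
  set of types defines the two-sided ideal of A generated by its eps_a, hence a
  submodule of P(b). The flag arises by adding the finitely many types a <= b one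
  at a time along a linear extension of the refined order, with b last. Write J for
  the ideal generated by the e_nu with nu not above mu, so that A_(>= mu) = A / J.

  Sections are layers. By well-founded induction on weights, the products x h y
  whose weight lies in a lower set span the ideal generated by the corresponding
  e_nu [special_cell]. So, modulo smaller weights, A e_mu is the direct sum of the
  right A_mu-modules x A_mu, each isomorphic to some 1_s A_mu [Xcoord], and e_mu A is
  the direct sum of the left A_mu-modules A_mu y [Ycoord]. A projective module P has
  a dual basis, an expansion v = sum of f_y(v) g_y. The Y-coordinates turn it into a
  dual basis of the stratum W = e_mu (P / J P), which is therefore projective over
  A_mu [strat_dual_basis]. The X-coordinates show that the products x p with p in 1_s P are
  independent modulo J P [strat_coord]. Hence standardization is exact on W and embeds
  into P / J P: a subquotient of W standardizes to the subquotient of P that it generates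
  [strat_subquotient]. Applied to A_mu with its quasi-hereditary structure, the same
  theorem identifies the sections of W [std_layer_section]. Together this shows that
  adding one type adds a pure layer of that type [step_layer].

  Only types <= b occur, and the top section is pure standard. Let lambda be the
  weight of b. The A_lambda-module L_lambda(b) embeds into L(b), which therefore
  contains the image v of the generator of the standard module Delta_lambda(b)
  [irr_top_vector]. Let u be a lift of v to P(b) with u in eps_b P(b). Since
  the kernel of P(b) -> L(b) is superfluous, u generates P(b), and so the type b
  completes the flag. The class of u generates W for mu = lambda. As W is projective,
  it is split off the free module on this generator by an idempotent, whose image
  in the Cartan algebra of b is nonzero because v is killed by the smaller types. The
  Cartan algebra is graded local, so this image is 1 [local_idem], and the top section
  of W is Delta_lambda(b) itself [top_section]. *)

Import Order.TTheory GRing.Theory.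
Local Open Scope ring_scope.
Local Open Scope classical_set_scope.

Local Notation "a ** b" := (amul a b) (at level 40, left associativity).

(** * Bases and lower finite orders *)

Definition lin_of (R : nzRingType) (U V : lmodType R) (f : U -> V) (fl : linear f) :
  {linear U -> V} := HB.pack f (GRing.isLinear.Build _ _ _ _ _ fl).

(** Collecting the terms of a formal combination over a list of pairs makes its
  indices distinct, as linear independence requires. *)
Lemma big_group (T : choiceType) (U W : nmodType) (f : T -> U -> W)
    (r : seq (T * U)) :
  (forall t, f t 0 = 0) -> (forall t u v, f t (u + v) = f t u + f t v) ->
  \sum_(p <- r) f p.1 p.2 =
  \sum_(t <- undup [seq p.1 | p <- r]) f t (\sum_(p <- r | p.1 == t) p.2).
Proof.
move=> f0 fD.
under [RHS]eq_bigr => t _ do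
  rewrite (big_morph (f t) (fun u v => fD t u v) (f0 t)).
rewrite (exchange_big_dep predT) //= big_seq [RHS]big_seq.
apply: eq_bigr => p pr.
rewrite -big_filter (_ : [seq _ <- _ | _] = [:: p.1]) ?big_seq1 //.
rewrite (eq_filter (a2 := pred1 p.1)) => [|t]; last by rewrite /= eq_sym.
rewrite filter_pred1_uniq ?undup_uniq // mem_undup.
by apply/mapP; exists p.
Qed.

Section BasisExtension.
Variables (k : closedFieldType) (V : lmodType k) (T : choiceType).
Variables (D : set T) (F : T -> V) (bas : is_basis D F).

Lemma basis_ind (Q : V -> Prop) :
  Q 0 -> (forall u v, Q u -> Q v -> Q (u + v)) ->
  (forall (c : k) v, Q v -> Q (c *: v)) ->
  (forall t, D t -> Q (F t)) -> forall v, Q v.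
Proof.
move=> Q0 QD QZ QF v; have [s [c [sD ->]]] := bas.1 v.
rewrite big_seq; apply: (big_ind Q) => // t /sD Dt.
exact/QZ/QF.
Qed.

Lemma basis_rel (U : lmodType k) (g : T -> U) (r : seq (T * k)) :
  (forall p, p \in r -> D p.1) ->
  \sum_(p <- r) p.2 *: F p.1 = 0 -> \sum_(p <- r) p.2 *: g p.1 = 0.
Proof.
move=> rD; rewrite (big_group (f := fun t c => c *: F t)) => [|t|t c d].
- move=> r0; rewrite (big_group (f := fun t c => c *: g t)) => [|t|t c d].
  + rewrite big_seq big1 // => t tr.
    rewrite (bas.2 _ (fun t => \sum_(p <- r | p.1 == t) p.2) _ _ r0) ?scale0r //.
      exact: undup_uniq.
    by move=> t'; rewrite mem_undup => /mapP[p /rD pD ->].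
  + exact: scale0r.
  exact: scalerDl.
- exact: scale0r.
exact: scalerDl.
Qed.

(** Coordinates with respect to a basis, and all the maps that read off a factor
  of a basis element, are instances of this extension property. *)
Lemma basis_ext (U : lmodType k) (g : T -> U) :
  exists G : {linear V -> U}, forall t, D t -> G (F t) = g t.
Proof.
have rep v : exists r : seq (T * k),
    (forall p, p \in r -> D p.1) /\ v = \sum_(p <- r) p.2 *: F p.1.
  have [s [c [sD ->]]] := bas.1 v; exists [seq (t, c t) | t <- s].
  by split=> [p /mapP[t /sD Dt ->]//|]; rewrite big_map.
pose R v := projT1 (cid (rep v)).
have RD v p : p \in R v -> D p.1 by rewrite /R; case: cid => ? [h] _ /=; exact: h.
have RE v : v = \sum_(p <- R v) p.2 *: F p.1 by rewrite /R; case: cid => ? [].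
pose G v := \sum_(p <- R v) p.2 *: g p.1.
pose zr c (r : seq (T * k)) := [seq (p.1, c * p.2) | p <- r].
have zrD c r : (forall p, p \in r -> D p.1) -> forall p, p \in zr c r -> D p.1.
  by move=> h p /mapP[q /h Dq ->].
have zrE (W : lmodType k) (f : T -> W) c r :
    \sum_(p <- zr c r) p.2 *: f p.1 = c *: \sum_(p <- r) p.2 *: f p.1.
  by rewrite big_map scaler_sumr; apply: eq_bigr => p _; rewrite scalerA.
have G_lin : linear G.
  move=> c u v; apply/eqP; rewrite -subr_eq0 opprD addrA; apply/eqP.
  have := @basis_rel U g (R (c *: u + v) ++ zr (- c) (R u) ++ zr (- 1) (R v)).
  rewrite !big_cat /= !zrE -!RE => h; rewrite -[- G v]scaleN1r -scaleNr -addrA /G.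
  apply: h => [p|].
    by rewrite !mem_cat => /or3P[/RD|/(zrD _ _ (RD u))|/(zrD _ _ (RD v))].
  by rewrite scaleNr scaleN1r -opprD subrr.
exists (lin_of G_lin) => t Dt /=.
apply/eqP; rewrite -subr_eq0; apply/eqP.
have := @basis_rel U g (R (F t) ++ [:: (t, -1)]).
rewrite !big_cat !big_seq1 /= -RE !scaleN1r; apply; last exact: subrr.
by move=> p; rewrite mem_cat => /orP[/RD//|]; rewrite inE => /eqP->.
Qed.

End BasisExtension.

Section LowerFinite.
Variables (disp : Order.disp_t) (L : porderType disp).
Hypothesis lfin : forall l : L, finite_set [set m | (m <= l)%O].

(** A strictly monotone rank; it gives well-founded induction here, and a linear
  extension of the order on types later. *)
Definition height (l : L) : nat := #|` fset_set [set m | (m <= l)%O]|%fset.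

Lemma height_lt l m : (m < l)%O -> (height m < height l)%N.
Proof.
move=> ml; apply: fproper_ltn_card; rewrite fproperE; apply/andP; split.
  apply/fsubsetP => x; rewrite !in_fset_set // !inE /= => xm.
  exact: le_trans xm (ltW ml).
apply/fsubsetP => /(_ l); rewrite !in_fset_set // !inE /= lexx => /(_ isT) lm.
by move: (lt_le_trans ml lm); rewrite ltxx.
Qed.

Lemma lower_finite_ind (Q : L -> Prop) :
  (forall l, (forall m, (m < l)%O -> Q m) -> Q l) -> forall l, Q l.
Proof.
move=> h l; have [n] := ubnP (height l); elim: n l => // n IH l ln.
by apply: h => m /height_lt ml; apply: IH; exact: leq_trans ml ln.
Qed.

End LowerFinite.

(** * Ideals and coordinates of a triangular basis *)

Inductive lspan (k : closedFieldType) (V : lmodType k) (E : V -> Prop) : V -> Prop :=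
| LS_in v of E v : lspan E v
| LS_0 : lspan E 0
| LS_D u v of lspan E u & lspan E v : lspan E (u + v)
| LS_Z (c : k) v of lspan E v : lspan E (c *: v).

Section LinearSpan.
Variables (k : closedFieldType) (V : lmodType k).

Lemma lspan_map (U : lmodType k) (f : {linear V -> U}) (E : V -> Prop)
    (E' : U -> Prop) :
  (forall v, E v -> lspan E' (f v)) -> forall v, lspan E v -> lspan E' (f v).
Proof.
move=> h v; elim=> {v} [v /h//||u v _ hu _ hv|c v _ hv].
- by rewrite linear0; exact: LS_0.
- by rewrite linearD; exact: LS_D.
by rewrite linearZ /=; exact: LS_Z.
Qed.

Lemma lspan_sub (E E' : V -> Prop) :
  (forall v, E v -> lspan E' v) -> forall v, lspan E v -> lspan E' v.
Proof. exact: (lspan_map (f := idfun)). Qed.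

End LinearSpan.

Lemma ideal_gen_sub k (A : galg k) (E : set A) (K : gideal A) :
  (forall x, E x -> K x) -> forall x, ideal_gen E x -> K x.
Proof.
move=> EK x; elim=> {x} [x /EK//||x y _ hx _ hy|c x _ hx|a x _ hx|a x _ hx].
- exact: gs0.
- exact: gsD.
- exact: gsZ.
- exact: gid_mull.
exact: gid_mulr.
Qed.

Section TriangularBasis.
Variables (k : closedFieldType) (A : lualg k).
Variables (disp : Order.disp_t) (L : porderType disp) (w : weights A L).

Let mulb := amul_bilin A.
Let lu := lu_unital A.

Local Notation one := (lu_one A).

Definition mull (a : A) : {linear A -> A} :=
  lin_of (fun c x y => etrans (gbDr mulb a _ _) (congr1 (+%R^~ _) (gbZr mulb c a x))).

Definition mulr (a : A) : {linear A -> A} :=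
  lin_of (f := fun x : A => x ** a)
    (fun c x y => etrans (gbDl mulb _ _ a) (congr1 (+%R^~ _) (gbZl mulb c x a))).

Lemma mullE a x : mull a x = a ** x. Proof. by []. Qed.
Lemma mulrE a x : mulr a x = x ** a. Proof. by []. Qed.

Definition esums (G : set L) : set A := [set x | exists2 m, G m & x = esum w m].

Lemma esums_homog G x : esums G x -> homogeneous x.
Proof. by move=> [m _ ->]; exact: esum_homog. Qed.

Definition weight_ideal (G : set L) : gideal A := gen_ideal (@esums_homog G).

Hypothesis T : gtbasis w.
Local Notation X := (gtX T).
Local Notation H := (gtH T).
Local Notation Y := (gtY T).

Lemma spone_idem (s : spec w) : spone s ** spone s = spone s.
Proof. exact: (lu_idem lu). Qed.

Lemma spone_orth (s t : spec w) : s <> t -> spone s ** spone t = 0.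
Proof. by move=> st; apply: (lu_orth lu) => /(@spi_inj _ _ _ _ w). Qed.

Lemma esum_seq (l : L) : exists r : seq (spec w),
  [/\ uniq r, forall s, s \in r <-> wt s = l & esum w l = \sum_(s <- r) spone s].
Proof.
have fin := gt_fibers T l.
exists (fset_set [set s : spec w | wt s = l]); split.
- exact: fset_uniq.
- by move=> s; split=> h; [move: h | ]; rewrite in_fset_set ?inE.
by rewrite /esum fsbig_finite.
Qed.

Lemma esum_sponel (s : spec w) : esum w (wt s) ** spone s = spone s.
Proof.
have [r [ur rP ->]] := esum_seq (wt s); rewrite (gb_suml mulb) (bigD1_seq s) //=.
  by rewrite spone_idem big1 ?addr0 // => t /eqP ts; exact: spone_orth.
exact/rP.
Qed.

Lemma esum_sponer (s : spec w) : spone s ** esum w (wt s) = spone s.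
Proof.
have [r [ur rP ->]] := esum_seq (wt s); rewrite (gb_sumr mulb) (bigD1_seq s) //=.
  by rewrite spone_idem big1 ?addr0 // => t /eqP ts; apply: spone_orth => /esym.
exact/rP.
Qed.

Lemma X_l i s x : X i s x -> one i ** x = x.
Proof. by case/gtX_in=> _ [a ->]; rewrite !amulA (lu_idem lu). Qed.

Lemma X_r i s x : X i s x -> x ** spone s = x.
Proof. by case/gtX_in=> _ [a ->]; rewrite -!amulA spone_idem. Qed.

Lemma X_ne i j s x : X i s x -> j <> i -> one j ** x = 0.
Proof.
by move=> /X_l <- ji; rewrite amulA (lu_orth lu) // (gb0l mulb).
Qed.

Lemma H_l s t h : H s t h -> spone s ** h = h.
Proof. by case/gtH_in=> _ [a ->]; rewrite !amulA spone_idem. Qed.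

Lemma H_r s t h : H s t h -> h ** spone t = h.
Proof. by case/gtH_in=> _ [a ->]; rewrite -!amulA spone_idem. Qed.

Lemma Y_l t j y : Y t j y -> spone t ** y = y.
Proof. by case/gtY_in=> _ [a ->]; rewrite !amulA spone_idem. Qed.

Lemma Y_r t j y : Y t j y -> y ** one j = y.
Proof. by case/gtY_in=> _ [a ->]; rewrite -!amulA (lu_idem lu). Qed.

Lemma Y_ne t i j y : Y t j y -> j <> i -> y ** one i = 0.
Proof.
by move=> /Y_r <- ji; rewrite -amulA (lu_orth lu) // (gb0r mulb).
Qed.

Lemma H_wt s t h : H s t h -> wt s = wt t.
Proof.
case: (pselect (s = t)) => [->//|st] hh.
by apply: (gtH_tri (g := T) st); exists h.
Qed.

Variant X_special_spec (s t : spec w) (x : A) : Prop :=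
| XS_one of s = t & x = spone s
| XS_lt of (wt t < wt s)%O.

Lemma X_special s t x : X (spi s) t x -> X_special_spec s t x.
Proof.
case: (pselect (s = t)) => [<-|st] hx.
  by move: hx; rewrite gtX_one => ->; exact: XS_one.
by apply/XS_lt/(gtX_tri (g := T) st); exists x.
Qed.

Variant Y_special_spec (t s : spec w) (y : A) : Prop :=
| YS_one of t = s & y = spone t
| YS_lt of (wt t < wt s)%O.

Lemma Y_special t s y : Y t (spi s) y -> Y_special_spec t s y.
Proof.
case: (pselect (t = s)) => [<-|st] hx.
  by move: hx; rewrite gtY_one => ->; exact: YS_one.
by apply/YS_lt/(gtY_tri (g := T) st); exists y.
Qed.

(** An element of [1_s A] is a combination of basis elements [x h y] in which [x]
  is either [1_s] or factors through a smaller weight. *)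
Section SpecialInduction.
Variable Q : A -> Prop.
Hypotheses (Q0 : Q 0) (QD : forall a b, Q a -> Q b -> Q (a + b)).
Hypothesis QZ : forall (c : k) a, Q a -> Q (c *: a).

Lemma special_left_ind (s : spec w) :
  (forall t h j y, H s t h -> Y t j y -> Q (h ** y)) ->
  (forall s' t x h j y, X (spi s) s' x -> (wt s' < wt s)%O -> H s' t h ->
     Y t j y -> Q (x ** h ** y)) ->
  forall a, spone s ** a = a -> Q a.
Proof.
move=> Qy Qx a <-; elim/(basis_ind (gt_basis T)): a
  => [|a b Qa Qb|c a Qa|[[x h] y] [s' [t /= [[i xX] hH [j yY]]]]].
- by rewrite (gb0r mulb).
- by rewrite (gbDr mulb); exact: QD.
- by rewrite (gbZr mulb); exact: QZ.
rewrite /prod3 /= !amulA; case: (pselect (spi s = i)) => [si|ne]; last first.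
  by rewrite (X_ne xX ne) !(gb0l mulb).
rewrite -si in xX; rewrite [spone s ** x](X_l xX).
case: (X_special xX) => [e xE|lt]; last exact: Qx xX lt hH yY.
rewrite -e in hH.
by rewrite xE (H_l hH); exact: Qy hH yY.
Qed.

Lemma special_right_ind (t : spec w) :
  (forall s i x h, X i s x -> H s t h -> Q (x ** h)) ->
  (forall s i t' x h y, X i s x -> H s t' h -> Y t' (spi t) y ->
     (wt t' < wt t)%O -> Q (x ** h ** y)) ->
  forall a, a ** spone t = a -> Q a.
Proof.
move=> Qx Qy a <-; elim/(basis_ind (gt_basis T)): a
  => [|a b Qa Qb|c a Qa|[[x h] y] [s [t' /= [[i xX] hH [j yY]]]]].
- by rewrite (gb0l mulb).
- by rewrite (gbDl mulb); exact: QD.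
- by rewrite (gbZl mulb); exact: QZ.
rewrite /prod3 /= -amulA; case: (pselect (j = spi t)) => [si|ne]; last first.
  by rewrite (Y_ne yY ne) !(gb0r mulb).
rewrite si in yY; rewrite [y ** _](Y_r yY).
case: (Y_special yY) => [e yE|lt]; last exact: Qy xX hH yY lt.
rewrite e in hH yE.
by rewrite yE -amulA (H_r hH); exact: Qx xX hH.
Qed.

End SpecialInduction.

Definition tri_prod (G : set L) (a : A) : Prop := exists s t i x h j y,
  [/\ X i s x, H s t h, Y t j y & G (wt s) /\ a = x ** h ** y].

Lemma tri_prodS (G G' : set L) a : G `<=` G' ->
  lspan (tri_prod G) a -> lspan (tri_prod G') a.
Proof.
move=> GG; apply: lspan_sub => v [s [t [i [x [h [j [y [? ? ? [/GG ? ?]]]]]]]]].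
by apply: LS_in; exists s, t, i, x, h, j, y.
Qed.

(** The well-founded induction that makes the cell filtration work: expanding
  both [a 1_s] and [1_s b] in the basis leaves a product of Cartan elements in
  the middle, which is again a combination of Cartan elements up to products
  through strictly smaller special idempotents. *)
Lemma special_cell (s : spec w) a b :
  lspan (tri_prod [set l | (l <= wt s)%O]) (a ** spone s ** b).
Proof.
pose Q (l : L) := forall (t : spec w) a b, wt t = l ->
  lspan (tri_prod [set m | (m <= l)%O]) (a ** spone t ** b).
suff h : forall l, Q l by exact: h.
apply: (lower_finite_ind (gt_lower_finite T)) => l IH {}s {}a {}b sl.
have low a' b' (t : spec w) : (wt t < l)%O ->
    lspan (tri_prod [set m | (m <= l)%O]) (a' ** spone t ** b').
  move=> tl; apply: (tri_prodS _ (IH _ tl t a' b' erefl)) => m /=.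
  by move/le_trans; apply; exact: ltW.
have as1 : (a ** spone s) ** spone s = a ** spone s by rewrite -amulA spone_idem.
have [LD LZ] := (@LS_D _ _ (tri_prod [set m | (m <= l)%O]),
                 @LS_Z _ _ (tri_prod [set m | (m <= l)%O])).
have L0 := @LS_0 _ _ (tri_prod [set m | (m <= l)%O]).
move: (a ** spone s) as1; apply: special_right_ind.
- by rewrite (gb0l mulb).
- by move=> u v hu hv; rewrite (gbDl mulb); exact: LD.
- by move=> c u hu; rewrite (gbZl mulb); exact: LZ.
- move=> s' i x h xX hH.
  rewrite -(H_r hH) amulA -amulA.
  have sb : spone s ** (spone s ** b) = spone s ** b by rewrite amulA spone_idem.
  move: (spone s ** b) sb; apply: special_left_ind.
  + by rewrite (gb0r mulb).
  + by move=> u v hu hv; rewrite (gbDr mulb); exact: LD.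
  + by move=> c u hu; rewrite (gbZr mulb); exact: LZ.
  + move=> t h' j y hH' yY; rewrite amulA.
    have -> : x ** h ** h' ** y = x ** (h ** h') ** spone t ** y.
      by rewrite amulA -[_ ** h' ** spone t]amulA (H_r hH').
    have hh : spone s' ** (h ** h') = h ** h' by rewrite amulA (H_l hH).
    move: (h ** h') hh; apply: special_left_ind.
    * by rewrite (gb0r mulb) !(gb0l mulb).
    * by move=> u v hu hv; rewrite (gbDr mulb) !(gbDl mulb); exact: LD.
    * by move=> c u hu; rewrite (gbZr mulb) !(gbZl mulb); exact: LZ.
    * move=> t3 h3 j3 y3 hH3 yY3; rewrite -[_ ** spone t]amulA -[_ ** spone t]amulA.
      case: (pselect (j3 = spi t)) => [jt|ne]; last first.
        by rewrite (Y_ne yY3 ne) !(gb0r mulb) (gb0l mulb).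
      rewrite jt in yY3; rewrite [y3 ** _](Y_r yY3).
      case: (Y_special yY3) => [e y3E|lt].
        rewrite e in hH3 y3E; rewrite y3E (H_r hH3); apply: LS_in.
        exists s', t, i, x, h3, j, y; split=> //; split=> //=.
        by rewrite (H_wt hH) sl.
      rewrite -(Y_l yY3) !amulA -amulA; apply: low.
      by rewrite -sl (H_wt hH') .
    move=> s3 t3 x3 h3 j3 y3 xX3 lt hH3 yY3.
    rewrite -(X_r xX3) !amulA -!amulA 2!amulA; apply: low.
    by rewrite -sl -(H_wt hH).
  move=> s3 t3 x3 h3 j3 y3 xX3 lt hH3 yY3.
  rewrite -(X_r xX3) !amulA -!amulA [x ** _]amulA 2!amulA; apply: low.
  by rewrite -sl.
move=> s' i t x h y xX hH yY lt.
rewrite -(Y_l yY) !amulA -[_ ** y ** b]amulA; apply: low.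
by rewrite -sl.
Qed.

Lemma weight_ideal_sub (G G' : set L) a :
  G `<=` G' -> weight_ideal G a -> weight_ideal G' a.
Proof.
by move=> GG; apply: ideal_gen_sub => x [m /GG mG ->]; apply: IG_in; exists m.
Qed.

Lemma weight_ideal_spone (G : set L) (s : spec w) a b : G (wt s) ->
  weight_ideal G (a ** spone s ** b).
Proof.
move=> Gs; rewrite -esum_sponel; apply/gid_mulr/gid_mull/gid_mulr.
by apply: IG_in; exists (wt s).
Qed.

Lemma weight_ideal_X (G : set L) i (s : spec w) x a : G (wt s) -> X i s x ->
  weight_ideal G (x ** a).
Proof. by move=> Gs /X_r <-; exact: weight_ideal_spone. Qed.

Lemma weight_ideal_tri (G : set L) a : lspan (tri_prod G) a -> weight_ideal G a.
Proof.
elim=> {a} [_ [s [t [i [x [h [j [y [xX _ _ [Gs ->]]]]]]]]]||a b _ ha _ hb|c a _ ha].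
- by rewrite -amulA; exact: weight_ideal_X Gs xX.
- exact: gs0.
- exact: gsD.
exact: gsZ.
Qed.

(** The ideal of a lower set of weights is spanned by a part of the basis, so that
  coordinates can detect membership in it. *)
Lemma tri_weight_ideal (G : set L) a :
  (forall l m, (m <= l)%O -> G l -> G m) -> weight_ideal G a -> lspan (tri_prod G) a.
Proof.
move=> Glow Ga.
have : lspan (fun v => exists a s b, G (wt s) /\ v = a ** @spone _ _ _ _ w s ** b) a.
  elim: Ga => {a} [_ [m mG ->]||a b _ ha _ hb|c a _ ha|a b _ hb|a b _ hb].
  - have [r [_ rP ->]] := esum_seq m; rewrite big_seq.
    apply: big_ind => [|u v|s /rP sm]; [exact: LS_0|exact: LS_D|].
    apply: LS_in; exists (spone s), s, (spone s).
    by rewrite sm !spone_idem.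
  - exact: LS_0.
  - exact: LS_D.
  - exact: LS_Z.
  - apply: (lspan_map (f := mull a)) hb => _ [a' [s [b' [Gs ->]]]].
    by apply: LS_in; exists (a ** a'), s, b'; rewrite mullE !amulA.
  apply: (lspan_map (f := mulr a)) hb => _ [a' [s [b' [Gs ->]]]].
  by apply: LS_in; exists a', s, (b' ** a); rewrite mulrE !amulA.
apply: lspan_sub => _ [a' [s [b' [Gs ->]]]].
by apply: tri_prodS (special_cell s a' b') => m /= ms; exact: Glow ms Gs.
Qed.

Section Stratum.
Variable mu : L.

Definition lt_ideal := weight_ideal [set m | (m < mu)%O].
(** The ideal of which [A_ge w mu] is the quotient. *)
Definition nge_ideal : gideal A := gen_ideal (@not_ge_homog _ _ _ _ w mu).
Local Notation e := (esum w mu).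

Lemma lt_nge a : lt_ideal a -> nge_ideal a.
Proof. by apply: weight_ideal_sub => m /= mlt; rewrite lt_geF. Qed.

Lemma nge_tri a : nge_ideal a -> lspan (tri_prod [set m | ~~ (mu <= m)%O]) a.
Proof.
apply: tri_weight_ideal => l m /= ml; apply: contra => mum; exact: le_trans mum ml.
Qed.

(** Up to smaller weights, [e_mu A] is spanned by the products [h y] and, in the
  next lemma, [A e_mu] by the products [x h]. *)
Lemma esum_left_ind (Q : A -> Prop) :
  (forall a b, Q a -> Q b -> Q (a + b)) -> (forall (c : k) a, Q a -> Q (c *: a)) ->
  (forall s t h j y, wt s = mu -> H s t h -> Y t j y -> Q (h ** y)) ->
  (forall a, lt_ideal a -> Q a) -> forall a, e ** a = a -> Q a.
Proof.
move=> QD QZ Qy QJ a <-; have Q0 : Q 0 by apply/QJ/gs0.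
have [r [_ rP ->]] := esum_seq mu; rewrite (gb_suml mulb) big_seq.
apply: big_ind => // s /rP sm.
have : spone s ** (spone s ** a) = spone s ** a by rewrite amulA spone_idem.
move: (spone s ** a); apply: special_left_ind => //.
  by move=> t h j y; exact: Qy.
move=> s' t x h j y xX lt _ _; apply: QJ; rewrite -amulA.
by apply: weight_ideal_X xX; rewrite /= -sm.
Qed.

Lemma esum_right_ind (Q : A -> Prop) :
  (forall a b, Q a -> Q b -> Q (a + b)) -> (forall (c : k) a, Q a -> Q (c *: a)) ->
  (forall i s t x h, wt s = mu -> wt t = mu -> X i s x -> H s t h -> Q (x ** h)) ->
  (forall a, lt_ideal a -> Q a) -> forall a, a ** e = a -> Q a.
Proof.
move=> QD QZ Qx QJ a <-; have Q0 : Q 0 by apply/QJ/gs0.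
have [r [_ rP ->]] := esum_seq mu; rewrite (gb_sumr mulb) big_seq.
apply: big_ind => // t /rP tm.
have : (a ** spone t) ** spone t = a ** spone t by rewrite -amulA spone_idem.
move: (a ** spone t); apply: special_right_ind => //.
  by move=> s i x h xX hH; apply: (Qx _ _ _ _ _ _ _ xX hH); rewrite ?(H_wt hH).
move=> s i t' x h y xX hH yY lt; apply: QJ; rewrite -(Y_l yY) amulA.
by apply: weight_ideal_spone; rewrite /= -tm.
Qed.

(** A basis element of [e_mu A] has weight at most [mu]; if moreover its weight is
  not above [mu], then it is strictly below. *)
Lemma nge_mull a : nge_ideal a -> lt_ideal (e ** a).
Proof.
move/nge_tri; elim=> {a} [_ [s [t [i [x [h [j [y [xX _ _ [Gs ->]]]]]]]]]
  ||a b _ ha _ hb|c a _ ha].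
- have [r [_ rP ->]] := esum_seq mu; rewrite (gb_suml mulb) big_seq.
  apply: gs_sum => s' /rP s'm; rewrite !amulA.
  case: (pselect (spi s' = i)) => [si|ne]; last first.
    by rewrite (X_ne xX ne) !(gb0l mulb); exact: gs0.
  rewrite -si in xX; rewrite [spone s' ** x](X_l xX) -amulA.
  case: (X_special xX) => [s's|lt].
    by move: Gs; rewrite /= -s's s'm lexx.
  by apply: weight_ideal_X xX; rewrite /= -s'm.
- by rewrite (gb0r mulb); exact: gs0.
- by rewrite (gbDr mulb); exact: gsD.
by rewrite (gbZr mulb); exact: gsZ.
Qed.

Lemma nge_mulr a : nge_ideal a -> lt_ideal (a ** e).
Proof.
move/nge_tri; elim=> {a} [_ [s [t [i [x [h [j [y [xX hH yY [Gs ->]]]]]]]]]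
  ||a b _ ha _ hb|c a _ ha].
- have [r [_ rP ->]] := esum_seq mu; rewrite (gb_sumr mulb) big_seq.
  apply: gs_sum => s' /rP s'm; rewrite -!amulA.
  case: (pselect (j = spi s')) => [si|ne]; last first.
    by rewrite (Y_ne yY ne) !(gb0r mulb); exact: gs0.
  rewrite si in yY; rewrite [y ** _](Y_r yY) -(Y_l yY) !amulA.
  case: (Y_special yY) => [s's|lt].
    by move: Gs; rewrite /= (H_wt hH) s's s'm lexx.
  by apply: weight_ideal_spone; rewrite /= -s'm.
- by rewrite (gb0l mulb); exact: gs0.
- by rewrite (gbDl mulb); exact: gsD.
by rewrite (gbZl mulb); exact: gsZ.
Qed.

Lemma Xcoord_exists (s : spec w) (x : A) : exists f : {linear A -> A},
  forall i s' t j x' h y, X i s' x' -> H s' t h -> Y t j y ->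
    f (x' ** h ** y) = if x' == x then spone s ** h ** y else 0.
Proof.
have [f fE] := basis_ext (gt_basis T)
  (fun p => if p.1.1 == x then spone s ** p.1.2 ** p.2 else 0).
exists f => i s' t j x' h y xX hH yY; apply: (fE (x', h, y)).
by exists s', t; split; [exists i | | exists j].
Qed.

(** The coordinate along [x] of [A e_mu] as a right module over [A_mu]. The factor
  [spone s] in its formula discards the triples whose first factor equals [x]
  without having right idempotent [1_s]. *)
Definition Xcoord s x : {linear A -> A} := projT1 (cid (Xcoord_exists s x)).

Lemma XcoordE s x i s' t j x' h y : X i s' x' -> H s' t h -> Y t j y ->
  Xcoord s x (x' ** h ** y) = if x' == x then spone s ** h ** y else 0.
Proof. by rewrite /Xcoord; case: cid => f /= fE; exact: fE. Qed.

Lemma Xcoord_nge (s : spec w) x a : wt s = mu -> nge_ideal a -> Xcoord s x a = 0.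
Proof.
move=> sm /nge_tri; elim=> {a} [_ [s' [t [i [x' [h [j [y [xX hH yY [Gs ->]]]]]]]]]
  ||a b _ ha _ hb|c a _ ha].
- rewrite (XcoordE _ _ xX hH yY); case: ifP => // _.
  rewrite -(H_l hH) !amulA spone_orth ?(gb0l mulb) // => ss'.
  by move: Gs; rewrite /= -ss' sm lexx.
- exact: linear0.
- by rewrite linearD ha hb addr0.
by rewrite linearZ /= ha scaler0.
Qed.

Lemma Xcoord_mul (s s' : spec w) i x x' b : wt s = mu -> wt s' = mu -> X i s' x' ->
  spone s' ** b = b ->
  nge_ideal (Xcoord s x (x' ** b) - if (s', x') == (s, x) then b else 0).
Proof.
move=> sm s'm xX; move: b; apply: special_left_ind.
- by rewrite (gb0r mulb) linear0 if_same subrr; exact: gs0.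
- move=> a b ha hb; rewrite (gbDr mulb) linearD; case: ifP ha hb => _.
    by rewrite opprD addrACA; exact: gsD.
  by rewrite !subr0; exact: gsD.
- move=> c a ha; rewrite (gbZr mulb) linearZ /=; case: ifP ha => _.
    by rewrite -scalerBr; exact: gsZ.
  by rewrite !subr0; exact: gsZ.
- move=> t h j y hH yY; rewrite amulA (XcoordE _ _ xX hH yY) xpair_eqE.
  case: (x' == x); rewrite ?andbF ?andbT ?subr0; last exact: gs0.
  case: eqP => [<-|ss']; first by rewrite (H_l hH) subrr; exact: gs0.
  rewrite -(H_l hH) !amulA spone_orth ?(gb0l mulb) ?subr0; last exact/nesym.
  exact: gs0.
move=> s2 t x2 h j y xX2 lt hH yY.
have J2 : nge_ideal (x2 ** h ** y).
  rewrite -amulA; apply: weight_ideal_X xX2; rewrite /= lt_geF //; by rewrite -s'm.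
rewrite (Xcoord_nge _ sm) ?sub0r; last exact: gid_mull.
by apply: gsN; case: ifP => // _; exact: gs0.
Qed.

Lemma Ycoord_exists (t : spec w) (y : A) : exists f : {linear A -> A},
  forall i s t' j x h y', X i s x -> H s t' h -> Y t' j y' ->
    f (x ** h ** y') = if y' == y then x ** h ** spone t else 0.
Proof.
have [f fE] := basis_ext (gt_basis T)
  (fun p => if p.2 == y then p.1.1 ** p.1.2 ** spone t else 0).
exists f => i s' t' j x' h y' xX hH yY; apply: (fE (x', h, y')).
by exists s', t'; split; [exists i | | exists j].
Qed.

(** The coordinate along [y] of [e_mu A] as a left module over [A_mu]. *)
Definition Ycoord t y : {linear A -> A} := projT1 (cid (Ycoord_exists t y)).

Lemma YcoordE t y i s t' j x h y' : X i s x -> H s t' h -> Y t' j y' ->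
  Ycoord t y (x ** h ** y') = if y' == y then x ** h ** spone t else 0.
Proof. by rewrite /Ycoord; case: cid => f /= fE; exact: fE. Qed.

Lemma Ycoord_hy t y (s t' : spec w) j h y' : H s t' h -> Y t' j y' ->
  Ycoord t y (h ** y') = if (t', y') == (t, y) then h else 0.
Proof.
move=> hH yY; have xX : X (spi s) s (spone s) by rewrite gtX_one.
have := YcoordE t y xX hH yY; rewrite (H_l hH) => ->; rewrite xpair_eqE.
case: eqP => _; rewrite ?andbF ?andbT //; case: eqP => [<-|tt].
  exact: H_r hH.
by rewrite -(H_r hH) -amulA spone_orth // (gb0r mulb).
Qed.

Lemma Ycoord_nge (t : spec w) y a : wt t = mu -> nge_ideal a -> Ycoord t y a = 0.
Proof.
move=> tm /nge_tri; elim=> {a} [_ [s' [t' [i [x' [h [j [y' [xX hH yY [Gs ->]]]]]]]]]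
  ||a b _ ha _ hb|c a _ ha].
- rewrite (YcoordE _ _ xX hH yY); case: ifP => // _.
  rewrite -(H_r hH) -!amulA spone_orth ?(gb0r mulb) // => tt'.
  by move: Gs; rewrite /= (H_wt hH) tt' tm lexx.
- exact: linear0.
- by rewrite linearD ha hb addr0.
by rewrite linearZ /= ha scaler0.
Qed.

Lemma Ycoord_mul (t t' : spec w) j y y' b : wt t = mu -> wt t' = mu -> Y t' j y' ->
  b ** spone t' = b ->
  nge_ideal (Ycoord t y (b ** y') - if (t', y') == (t, y) then b else 0).
Proof.
move=> tm t'm yY; move: b; apply: special_right_ind.
- by rewrite (gb0l mulb) linear0 if_same subrr; exact: gs0.
- move=> a b ha hb; rewrite (gbDl mulb) linearD; case: ifP ha hb => _.
    by rewrite opprD addrACA; exact: gsD.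
  by rewrite !subr0; exact: gsD.
- move=> c a ha; rewrite (gbZl mulb) linearZ /=; case: ifP ha => _.
    by rewrite -scalerBr; exact: gsZ.
  by rewrite !subr0; exact: gsZ.
- move=> s i x h xX hH; rewrite (YcoordE _ _ xX hH yY) xpair_eqE.
  case: (y' == y); rewrite ?andbF ?andbT ?subr0; last exact: gs0.
  rewrite -[x ** h ** _]amulA.
  case: eqP => [<-|tt']; first by rewrite (H_r hH) subrr; exact: gs0.
  rewrite -(H_r hH) -!amulA spone_orth ?(gb0r mulb) ?subr0 //.
  exact: gs0.
move=> s i t2 x h y2 xX hH yY2 lt.
have J2 : nge_ideal (x ** h ** y2).
  by rewrite -(Y_l yY2) amulA; apply: weight_ideal_spone; rewrite /= lt_geF // -t'm.
rewrite (Ycoord_nge _ tm) ?sub0r; last exact: gid_mulr.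
by apply: gsN; case: ifP => // _; exact: gs0.
Qed.

(** Linearity over [A_mu] holds because [a h] is again in the span of the [x h']
  up to smaller weights, whatever [a] is. *)
Lemma Ycoord_lin (t : spec w) y a b : wt t = mu -> e ** b = b ->
  nge_ideal (Ycoord t y (a ** b) - a ** Ycoord t y b).
Proof.
move=> tm; move: b; apply: esum_left_ind.
- by move=> b c hb hc; rewrite (gbDr mulb) !linearD (gbDr mulb) opprD addrACA; exact: gsD.
- move=> c b hb; rewrite (gbZr mulb) !linearZ /= (gbZr mulb) -scalerBr.
  exact: (@gsZ _ _ nge_ideal).
- move=> s t' h j y' sm hH yY; rewrite (Ycoord_hy _ _ hH yY) amulA.
  have := @Ycoord_mul t t' j y y' (a ** h) tm.
  rewrite -(H_wt hH) => /(_ sm yY); rewrite -amulA (H_r hH) => /(_ erefl).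
  by case: ifP; rewrite ?(gb0r mulb).
move=> j /lt_nge Jj; rewrite !(Ycoord_nge _ tm) //; last exact: gid_mull.
by rewrite (gb0r mulb) subrr; exact: gs0.
Qed.

Lemma Ycoord_deg (t : spec w) y d e' a : gdeg d y -> gdeg e' a ->
  gdeg (e' - d) (Ycoord t y a).
Proof.
move=> yd; suff comm v : gcomp (e' - d) (Ycoord t y v) = Ycoord t y (gcomp e' v).
  by rewrite /gdeg comm => ->.
elim/(basis_ind (gt_basis T)): v
  => [|u v Qa Qb|c u Qa|[[x h] y'] [s' [t' /= [[i xX] hH [j yY]]]]].
- by rewrite !linear0.
- by rewrite !linearD /= Qa Qb.
- by rewrite !linearZ /= Qa.
have [[p xp] _] := gtX_in xX; have [[q hq] _] := gtH_in hH.
have [[r y'r] _] := gtY_in yY; rewrite /prod3 /= (YcoordE _ _ xX hH yY).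
have xhpq := gb_deg mulb xp hq.
rewrite (gdeg_comp _ (gb_deg mulb xhpq y'r)).
case: (eqVneq y' y) => [yy|ne]; last first.
  by rewrite linear0; case: ifP; rewrite ?linear0 // (YcoordE _ _ xX hH yY) (negPf ne).
have xhpqt := gb_deg mulb xhpq (one_deg0 lu (spi t)); rewrite addr0 in xhpqt.
(* for y = 0 both sides vanish; otherwise d is the only degree of y *)
rewrite (gdeg_comp _ xhpqt); case: (pselect (y = 0)) => [y0|yn0].
  have -> : x ** h ** spone t = 0.
    have := YcoordE t y xX hH yY; rewrite yy eqxx => <-.
    by rewrite y0 (gb0r mulb) linear0.
  by rewrite if_same yy y0 (gb0r mulb) if_same linear0.
have dr : d = r.
  apply/eqP; apply: contra_notT yn0 => dr.
  have := gdeg_comp r yd; rewrite -yy (y'r : gcomp r y' = y') eq_sym.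
  by case: eqP dr => // -> /eqP.
rewrite dr subr_eq; case: eqP => _; last by rewrite linear0.
by rewrite (YcoordE _ _ xX hH yY) yy eqxx.
Qed.

Definition Yspecial (q : spec w * A) : Prop := wt q.1 = mu /\ exists j, Y q.1 j q.2.

Lemma Y_esum q : Yspecial q -> e ** q.2 = q.2.
Proof.
by case: q => t y [/= <- [j yY]]; rewrite -(Y_l yY) amulA esum_sponel.
Qed.

Lemma Ycoord_expand b : e ** b = b -> exists r : seq (spec w * A),
  [/\ uniq r, forall q, q \in r -> Yspecial q,
      forall q, wt q.1 = mu -> q \notin r -> Ycoord q.1 q.2 b = 0 &
      nge_ideal (b - \sum_(q <- r) Ycoord q.1 q.2 b ** q.2)].
Proof.
pose S (r : seq (spec w * A)) (b : A) := [/\ uniq r, forall q, q \in r -> Yspecial q,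
      forall q, wt q.1 = mu -> q \notin r -> Ycoord q.1 q.2 b = 0 &
      nge_ideal (b - \sum_(q <- r) Ycoord q.1 q.2 b ** q.2)].
have widen r r' a : S r a -> uniq r' -> (forall q, q \in r' -> Yspecial q) ->
    {subset r <= r'} -> S r' a.
  move=> [ur rY r0 rJ] ur' r'Y rr'; split=> // [q qm qr'|].
    by apply: r0 => //; apply: contra qr'; exact: rr'.
  rewrite (_ : \sum_(q <- r') _ = \sum_(q <- r) Ycoord q.1 q.2 a ** q.2) //.
  rewrite (bigID (mem r)) /= [X in _ + X]big1_seq ?addr0 => [|q /andP[qr /r'Y[qm _]]].
    rewrite -big_filter; apply: perm_big; apply: uniq_perm => //.
      exact: filter_uniq.
    by move=> q; rewrite mem_filter; apply/andP/idP => [[]//|qr]; split=> //; exact: rr'.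
  by rewrite r0 // (gb0l mulb).
move: b; apply: (esum_left_ind (Q := fun b => exists r, S r b)).
- move=> a b [ra ha] [rb hb]; pose r := undup (ra ++ rb).
  have rY q : q \in r -> Yspecial q.
    rewrite mem_undup mem_cat => /orP[].
      by case: ha => _ h _ _; exact: h.
    by case: hb => _ h _ _; exact: h.
  have [_ _ a0 aJ] : S r a.
    apply: widen ha _ _ _ => //; rewrite ?undup_uniq // => q qa.
    by rewrite mem_undup mem_cat qa.
  have [_ _ b0 bJ] : S r b.
    apply: widen hb _ _ _ => //; rewrite ?undup_uniq // => q qa.
    by rewrite mem_undup mem_cat qa orbT.
  exists r; split=> //; first exact: undup_uniq.
    by move=> q qm qr; rewrite linearD a0 ?b0 ?addr0.
  under eq_bigr do rewrite linearD (gbDl mulb).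
  by rewrite big_split /= opprD addrACA; exact: (@gsD _ _ nge_ideal).
- move=> c a [r [ur rY r0 rJ]]; exists r; split=> // [q qm qr|].
    by rewrite linearZ /= r0 // scaler0.
  under eq_bigr do rewrite linearZ /= (gbZl mulb).
  by rewrite -scaler_sumr -scalerBr; exact: (@gsZ _ _ nge_ideal).
- move=> s t h j y sm hH yY; exists [:: (t, y)]; split=> //.
  + move=> q; rewrite inE => /eqP->; split=> /=; first by rewrite -(H_wt hH).
    by exists j.
  + move=> [t' y'] /= tm; rewrite inE (Ycoord_hy _ _ hH yY).
    by rewrite eq_sym => /negPf ->.
  by rewrite big_seq1 (Ycoord_hy _ _ hH yY) eqxx subrr; exact: gs0.
move=> a /lt_nge Ja; exists [::]; split=> //.
  by move=> q qm _; exact: Ycoord_nge.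
by rewrite big_nil subr0.
Qed.

End Stratum.
End TriangularBasis.

(** * Isomorphisms of graded modules *)

Section Isomorphisms.
Variables (k : closedFieldType) (A : lualg k).

Lemma deg0_comp (V W : gvect k) (f : {linear V -> W}) d v :
  (forall n u, gdeg n u -> gdeg n (f u)) -> f (gcomp d v) = gcomp d (f v).
Proof.
move=> fh; have fd n u : gdeg n (f (gcomp n u)) by exact/fh/gcomp_deg.
have [s [us vE]] := gcomp_fin v.
rewrite [in RHS]vE !linear_sum /=; have [ds|ds] := boolP (d \in s).
  rewrite (bigD1_seq d) //= (fd d) big1 ?addr0 // => n /negPf nd.
  by rewrite (gdeg_comp _ (fd n v)) eq_sym nd.
rewrite (gcomp_out vE ds) linear0 big_seq big1 // => n ns.
by rewrite (gdeg_comp _ (fd n v)); case: eqP ds => // ->; rewrite ns.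
Qed.

Lemma ghom0_comp (V W : gmod A) (f : {linear V -> W}) d v :
  ghom 0 f -> f (gcomp d v) = gcomp d (f v).
Proof. by move=> fh; apply: deg0_comp => n u /(gh_deg fh); rewrite addr0. Qed.

Lemma giso_bij (V W : gmod A) (f : {linear V -> W}) :
  ghom 0 f -> injective f -> Defs.surj f -> giso V W.
Proof.
move=> fh finj fsurj; exists f; split=> //.
pose g w := projT1 (cid (fsurj w)).
have gK : cancel g f by move=> w; rewrite /g; case: cid.
by exists g => // v; apply: finj; rewrite gK.
Qed.

Lemma giso_sym (V W : gmod A) : giso V W -> giso W V.
Proof.
move=> [f [fh [g fK gK]]]; have g_lin : linear g.
  by move=> c x y; rewrite -[RHS]fK linearP !gK.
exists (lin_of g_lin); split; last by exists f.
split=> [a w|n w wn] /=; first by rewrite -[RHS]fK (gh_act fh) gK.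
by rewrite /gdeg addr0 -[LHS]fK (ghom0_comp _ _ fh) gK wn.
Qed.

End Isomorphisms.

(** * The module cut out by a weight *)

Section IdealModule.
Variables (k : closedFieldType) (A : lualg k).

Definition actl (V : gmod A) (a : A) : {linear V -> V} :=
  lin_of (fun c x y =>
    etrans (gbDr (act_bilin V) a _ _) (congr1 (+%R^~ _) (gbZr (act_bilin V) c a x))).

Lemma actlE (V : gmod A) (a : A) (v : V) : actl V a v = act a v. Proof. by []. Qed.

Definition actr (V : gmod A) (v : V) : {linear A -> V} :=
  lin_of (f := fun a : A => act a v) (fun c a b =>
    etrans (gbDl (act_bilin V) _ _ v) (congr1 (+%R^~ _) (gbZl (act_bilin V) c a v))).

Lemma actrE (V : gmod A) (a : A) (v : V) : actr v a = act a v. Proof. by []. Qed.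

Variables (J : gideal A) (V : gmod A).

Definition ideal_mod_set : V -> Prop :=
  lspan (fun v => exists a u, J a /\ v = act a u).

Lemma ideal_mod_comp d v : ideal_mod_set v -> ideal_mod_set (gcomp d v).
Proof.
apply: (lspan_map (f := gcomp d)) => _ [a [u [Ja ->]]].
rewrite (gcomp_bilin (act_bilin V)); apply: big_ind => [|x y|p _].
- exact: LS_0.
- exact: LS_D.
by apply: LS_in; exists (gcomp p a), (gcomp (d - p) u); split=> //; exact: gs_comp.
Qed.

Lemma ideal_mod_act a v : ideal_mod_set v -> ideal_mod_set (act a v).
Proof.
apply: (lspan_map (f := actl V a)) => _ [b [u [Jb ->]]].
apply: LS_in; exists (a ** b), u; split; first exact: gid_mull.
by rewrite actlE actA.
Qed.

Definition ideal_mod : gsubmod V :=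
  @GSubmod _ _ V (@GSubsp _ V ideal_mod_set (@LS_0 _ _ _) (@LS_D _ _ _)
    (@LS_Z _ _ _) ideal_mod_comp) ideal_mod_act.

Lemma ideal_mod_in a u : J a -> ideal_mod (act a u).
Proof. by move=> Ja; apply: LS_in; exists a, u. Qed.

Lemma ideal_mod_ind (Q : V -> Prop) :
  Q 0 -> (forall u v, Q u -> Q v -> Q (u + v)) ->
  (forall a u, J a -> Q (act a u)) -> forall v, ideal_mod v -> Q v.
Proof.
move=> Q0 QD Qa v; suff h : forall c : k, ideal_mod v -> Q (c *: v).
  by move=> /(h 1); rewrite scale1r.
move=> + vE; elim: vE => {v} [_ [a [u [Ja ->]]]||u v _ hu _ hv|c v _ hv] c'.
- by rewrite -(gbZl (act_bilin V)); apply/Qa/gsZ.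
- by rewrite scaler0.
- by rewrite scalerDr; exact: QD.
by rewrite scalerA.
Qed.

Lemma ideal_mod_span (N : gsubmod V) :
  (forall a u, J a -> N (act a u)) -> forall v, ideal_mod v -> N v.
Proof. by move=> h; apply: ideal_mod_ind => //; [exact: gs0|move=> u v; exact: gsD]. Qed.

End IdealModule.

Lemma ideal_modS k (A : lualg k) (V : gmod A) (J K : gideal A) :
  (forall a, J a -> K a) -> forall v : V, ideal_mod J V v -> ideal_mod K V v.
Proof. by move=> JK; apply: ideal_mod_span => a u /JK; exact: ideal_mod_in. Qed.

Section StratumModule.
Variables (k : closedFieldType) (A : lualg k).
Variables (disp : Order.disp_t) (L : porderType disp) (w : weights A L) (mu : L).

Let mulb := amul_bilin A.
Local Notation J := (nge_ideal w mu).
Local Notation e := (esum w mu).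

Lemma esum0 : gdeg 0 e.
Proof. exact: idem_deg0 (esum_homog w mu) (esum_idem w mu). Qed.

Lemma qpi_mul (I : gideal A) a b : qpi I (a ** b) = (qpi I a : lualg_quo I) ** qpi I b.
Proof. by apply/esym; exact: quo_mulE. Qed.

Lemma loc_subproof (a : A) : corner_set (ebar w mu) (qpi J (e ** a ** e)).
Proof. by exists (qpi J a); rewrite !qpi_mul. Qed.

(** The class of [e_mu a e_mu] in [A_mu]; every element has this form. *)
Definition loc (a : A) : A_loc w mu := sub_in (W := corner_sub (ebar w mu)) (loc_subproof a).

Lemma val_loc a : val (loc a) = qpi J (e ** a ** e).
Proof. by []. Qed.

Lemma loc_eq a b : loc a = loc b <-> J (e ** a ** e - e ** b ** e).
Proof. by rewrite -(qpi_eq J); split=> [/(congr1 val)|h]; [|apply: val_inj]. Qed.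

Lemma loc_linear : linear loc.
Proof.
move=> c a b; apply: val_inj; rewrite /= -(linearP (qpi J)) /=.
by rewrite (gbDr mulb) (gbDl mulb) (gbZr mulb) (gbZl mulb).
Qed.

HB.instance Definition _ := GRing.isLinear.Build k A (A_loc w mu) _ loc loc_linear.

Lemma loc_surj x : exists a, x = loc a.
Proof.
have [y xE] := sub_carP x; have [a ya] := qpi_surj (W := J) y; exists a.
by apply: val_inj; rewrite val_loc xE ya !qpi_mul.
Qed.

Lemma loc_nge a : J a -> loc a = 0.
Proof.
move=> Ja; rewrite -(linear0 loc); apply/loc_eq.
by rewrite (gb0r mulb) (gb0l mulb) subr0; apply/gid_mulr/gid_mull.
Qed.

Lemma loc_nge_eq a b : J (a - b) -> loc a = loc b.
Proof. by move/loc_nge/eqP; rewrite linearB subr_eq0 => /eqP. Qed.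

Lemma loc_mul a b : loc a ** loc b = loc (a ** e ** b).
Proof.
apply: val_inj; rewrite val_loc; apply: etrans (esym (qpi_mul J _ _)) _; congr (qpi J _).
by rewrite !amulA -[e ** a ** e ** e]amulA esum_idem.
Qed.

Lemma loc_el a : loc (e ** a) = loc a.
Proof. by apply: val_inj; rewrite !val_loc amulA esum_idem. Qed.

Lemma loc_er a : loc (a ** e) = loc a.
Proof. by apply: val_inj; rewrite !val_loc !amulA -[_ ** e ** e]amulA esum_idem. Qed.

Lemma loc_one : lu_one (A_loc w mu) tt = loc e.
Proof. by apply: val_inj; rewrite val_loc !esum_idem. Qed.

Lemma loc_deg d a : gdeg d a -> gdeg d (loc a).
Proof.
move=> ad; apply/gdeg_gsub; rewrite val_loc; apply: gdeg_qpi.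
by have := gb_deg mulb (gb_deg mulb esum0 ad) esum0; rewrite add0r addr0.
Qed.

Variable V : gmod A.
Let actb := act_bilin V.

(** [e_mu (V / J V)] is realized as the quotient of [V] by the vectors whose image
  under [e_mu] lies in [J V], so that [cl v] is the class of [e_mu v]. *)
Definition strat_set (v : V) : Prop := ideal_mod J V (act e v).

Lemma strat0 : strat_set 0.
Proof. by rewrite /strat_set (gb0r actb); exact: gs0. Qed.

Lemma stratD u v : strat_set u -> strat_set v -> strat_set (u + v).
Proof. by rewrite /strat_set (gbDr actb); exact: gsD. Qed.

Lemma stratZ (c : k) v : strat_set v -> strat_set (c *: v).
Proof. by rewrite /strat_set (gbZr actb); exact: gsZ. Qed.

Lemma strat_comp d v : strat_set v -> strat_set (gcomp d v).
Proof.
move/(gs_comp d); rewrite (gcomp_degl actb _ _ esum0) subr0; exact.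
Qed.

Definition strat_sub : gsubsp V := GSubsp strat0 stratD stratZ strat_comp.

Definition cl : {linear V -> gquo strat_sub} := qpi strat_sub.

Lemma cl_eq0 v : cl v = 0 <-> ideal_mod J V (act e v).
Proof. exact: (qpi_ker strat_sub). Qed.

Lemma cl_eq u v : cl u = cl v <-> ideal_mod J V (act e (u - v)).
Proof. exact: (qpi_eq strat_sub). Qed.

Lemma cl_e v : cl (act e v) = cl v.
Proof.
apply/cl_eq; rewrite (gbBr actb) -actA esum_idem subrr; exact: gs0.
Qed.

Lemma cl_ideal v : ideal_mod J V v -> cl v = 0.
Proof. by move=> Jv; apply/cl_eq0/gsm_act. Qed.

Definition strat_act (x : A_loc w mu) (y : gquo strat_sub) : gquo strat_sub :=
  cl (act (repr (val x)) (act e (repr y))).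

Lemma strat_actE a v : strat_act (loc a) (cl v) = cl (act a (act e v)).
Proof.
rewrite /strat_act; set b := repr (val _); set u := repr _.
have Jb : J (b - e ** a ** e) by apply/qpi_eq; rewrite qpi_repr.
have Ju : ideal_mod J V (act e (u - v)) by apply/cl_eq; exact: (qpi_repr (W := strat_sub)).
rewrite -[RHS]cl_e; apply/cl_eq; apply: gsm_act.
have -> : act b (act e u) - act e (act a (act e v)) =
    act (b - e ** a ** e) (act e u) + act (e ** a) (act e (u - v)).
  rewrite (gbBl actb) !(gbBr actb) -!actA.
  by rewrite -[_ ** e ** e]amulA esum_idem addrA subrK.
by apply: gsD; [exact: ideal_mod_in|exact: gsm_act].
Qed.

Lemma strat_act_bilin : gbilinear strat_act.
Proof.
split=> [x y z|x y z|c x y|c x y|d f x y xd yf].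
- have [a ->] := loc_surj x; have [b ->] := loc_surj y.
  have [v ->] := qpi_surj z.
  by rewrite -linearD !strat_actE (gbDl actb) linearD.
- have [a ->] := loc_surj x; have [u ->] := qpi_surj y; have [v ->] := qpi_surj z.
  by rewrite -(raddfD cl) !strat_actE !(gbDr actb) (raddfD cl).
- have [a ->] := loc_surj x; have [v ->] := qpi_surj y.
  by rewrite -linearZ !strat_actE (gbZl actb) (linearZZ cl).
- have [a ->] := loc_surj x; have [v ->] := qpi_surj y.
  by rewrite -(linearZZ cl) !strat_actE !(gbZr actb) (linearZZ cl).
have [a xE] := loc_surj x; have [v [ve ->]] := gdeg_qpi_lift yf.
have -> : x = loc (gcomp d a).
  rewrite -[LHS](xd : gcomp d x = x) xE; apply: val_inj; rewrite val_loc.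
  have -> : e ** gcomp d a ** e = gcomp d (e ** a ** e).
    by rewrite (gcomp_degr mulb _ _ esum0) subr0 (gcomp_degl mulb _ _ esum0) subr0.
  exact: (quo_compE J).
rewrite strat_actE; apply: gdeg_qpi.
apply: (gb_deg actb); first exact: gcomp_deg.
by have := gb_deg actb esum0 ve; rewrite add0r.
Qed.

Lemma strat_actA x y z : strat_act (x ** y) z = strat_act x (strat_act y z).
Proof.
have [a ->] := loc_surj x; have [b ->] := loc_surj y; have [v ->] := qpi_surj z.
by rewrite loc_mul (strat_actE b v) (strat_actE a) strat_actE -!actA.
Qed.

Lemma strat_act_unital z : exists s : seq (lu_idx (A_loc w mu)), uniq s /\
  z = \sum_(i <- s) strat_act (lu_one _ i) z.
Proof.
exists [:: tt]; split=> //; have [v ->] := qpi_surj z.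
by rewrite big_seq1 loc_one strat_actE -actA esum_idem cl_e.
Qed.

Definition strat_mod : gmod (A_loc w mu) :=
  GMod strat_act_bilin strat_actA strat_act_unital.

Definition scl : {linear V -> strat_mod} := cl.

Lemma scl_surj (z : strat_mod) : exists v, z = scl v.
Proof. exact: (qpi_surj (W := strat_sub)). Qed.

Lemma scl_act a v : act (loc a) (scl v) = scl (act a (act e v)).
Proof. exact: strat_actE. Qed.

Lemma scl_deg d v : gdeg d v -> gdeg d (scl v).
Proof. exact: gdeg_qpi. Qed.

Lemma scl_lift d z : gdeg d z -> exists v, [/\ gdeg d v, act e v = v & z = scl v].
Proof.
move=> zd; have [v [vd ->]] := gdeg_qpi_lift zd; exists (act e v); split.
- by have := gb_deg actb esum0 vd; rewrite add0r.
- by rewrite -actA esum_idem.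
by rewrite /scl cl_e.
Qed.

End StratumModule.

(** * Dual bases *)

(** The finitely supported expansion [v = sum_y f_y(v) g_y] with [A]-linear [f_y]
  characterizes projective modules. It passes from a module to its strata by
  explicit formulas, whereas the lifting property does not. *)
Record dual_basis k (A : lualg k) (P : gmod A) := DualBasis {
  db_idx : choiceType;
  db_deg : db_idx -> int;
  db_gen : db_idx -> P;
  db_fun : db_idx -> {linear P -> A};
  db_gen_deg : forall y, gdeg (db_deg y) (db_gen y);
  db_fun_deg : forall y d v, gdeg d v -> gdeg (d - db_deg y) (db_fun y v);
  db_act : forall y a v, db_fun y (act a v) = a ** db_fun y v;
  db_fin : forall v, exists s : seq db_idx, [/\ uniq s,
    forall y, y \notin s -> db_fun y v = 0 &
    v = \sum_(y <- s) act (db_fun y v) (db_gen y)] }.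

Section DualBasis.
Variables (k : closedFieldType) (A : lualg k) (P : gmod A) (D : dual_basis P).

Local Notation f := (@db_fun _ _ _ D).
Local Notation g := (@db_gen _ _ _ D).

(** The maps [phi_y] can be summed along [f_y] although the index set is infinite,
  because the coordinates of each vector have finite support. *)
Lemma dual_sum (U : lmodType k) (phi : db_idx D -> {linear A -> U}) :
  exists Psi : {linear P -> U}, forall v s, uniq s ->
    (forall y, y \notin s -> f y v = 0) -> Psi v = \sum_(y <- s) phi y (f y v).
Proof.
pose supp v := projT1 (cid (db_fin D v)).
have us v : uniq (supp v) by rewrite /supp; case: cid => s [].
have s0 v y : y \notin supp v -> f y v = 0.
  by rewrite /supp; case: cid => s [/= _ + _]; apply.
pose G v := \sum_(y <- supp v) phi y (f y v).
have GE v s : uniq s -> (forall y, y \notin s -> f y v = 0) ->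
    G v = \sum_(y <- s) phi y (f y v).
  move=> us' s'0; pose r := undup (supp v ++ s).
  transitivity (\sum_(y <- r) phi y (f y v)); last first.
    apply: big_uniq_sub => // [|y ys|y /s'0 ->]; rewrite ?undup_uniq ?linear0 //.
    by rewrite mem_undup mem_cat ys orbT.
  apply/esym/big_uniq_sub => // [|y ys|y /s0 ->]; rewrite ?undup_uniq ?linear0 //.
  by rewrite mem_undup mem_cat ys.
have G_lin : linear G.
  move=> c u v; pose r := undup (supp u ++ supp v).
  have ru y : y \notin r -> f y u = 0.
    by rewrite mem_undup mem_cat negb_or => /andP[/s0].
  have rv y : y \notin r -> f y v = 0.
    by rewrite mem_undup mem_cat negb_or => /andP[_ /s0].
  rewrite (GE (c *: u + v) r) ?(GE u r) ?(GE v r) ?undup_uniq //; last first.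
    by move=> y yr; rewrite linearP ru ?rv // scaler0 addr0.
  rewrite scaler_sumr -big_split; apply: eq_bigr => y _.
  by rewrite !linearP.
by exists (lin_of G_lin).
Qed.

(** A map out of [P] is lifted by choosing lifts of the images of the [g_y]. *)
Lemma dual_basis_projective : projective P.
Proof.
move=> V W h q hh hsurj hq.
have lift y : exists v, gdeg (db_deg y) v /\ h v = q (g y).
  have [v vE] := hsurj (q (g y)); exists (gcomp (db_deg y) v).
  split; first exact: gcomp_deg.
  have qg : gdeg (db_deg y) (q (g y)).
    by have := gh_deg hq (db_gen_deg y); rewrite addr0.
  by rewrite (ghom0_comp _ _ hh) vE.
pose l y := projT1 (cid (lift y)).
have ld y : gdeg (db_deg y) (l y) by rewrite /l; case: cid => v [].
have lE y : h (l y) = q (g y) by rewrite /l; case: cid => v [].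
have [Psi PsiE] := dual_sum (fun y => actr (l y)).
exists Psi; split; first split.
- move=> a v; have [s [us s0 _]] := db_fin D v.
  rewrite (PsiE v s) // (PsiE (act a v) s) // => [|y /s0]; last first.
    by rewrite db_act => ->; rewrite (gb0r (amul_bilin A)).
  rewrite (gb_sumr (act_bilin V)); apply: eq_bigr => y _.
  by rewrite !actrE db_act actA.
- move=> d v vd; have [s [us s0 _]] := db_fin D v.
  rewrite (PsiE v s) // addr0; apply: gdeg_sum => y _; rewrite actrE.
  have := gb_deg (act_bilin V) (db_fun_deg y vd) (ld y).
  by rewrite subrK.
move=> v; have [s [us s0 vE]] := db_fin D v.
rewrite (PsiE v s) // linear_sum [in RHS]vE linear_sum; apply: eq_bigr => y _.
by rewrite actrE (gh_act hh) lE (gh_act hq).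
Qed.

Lemma dual_basis_ideal (J : gideal A) v : ideal_mod J P v <-> forall y, J (f y v).
Proof.
split=> [Jv y|Jv].
  move: v Jv; apply: ideal_mod_ind => [|u v hu hv|a u Ja].
  - by rewrite linear0; exact: gs0.
  - by rewrite linearD; exact: gsD.
  by rewrite db_act; exact: gid_mulr.
have [s [_ _ ->]] := db_fin D v.
by apply: gs_sum => y _; apply: ideal_mod_in.
Qed.

Variables (disp : Order.disp_t) (L : porderType disp) (w : weights A L).
Variables (T : gtbasis w) (mu : L).

Let mulb := amul_bilin A.
Let actb := act_bilin P.
Local Notation J := (nge_ideal w mu).
Local Notation e := (esum w mu).
Local Notation W := (strat_mod w mu P).
Local Notation cls := (scl w mu P).

(** The products [x p], with [x] in the set X and [p] in [1_s P], are independent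
  modulo [J P]: apply [Xcoord] to each of the coordinates [f_y] of [P]. This is
  what makes the standardization of the stratum embed into [P / J P]. *)
Lemma strat_coord (s : spec w) x : wt s = mu -> exists xi : {linear P -> W},
  (forall v, ideal_mod J P v -> xi v = 0) /\
  (forall i s' x' v, gtX T i s' x' -> wt s' = mu -> act (spone s') v = v ->
    xi (act x' v) = if (s', x') == (s, x) then cls v else 0).
Proof.
move=> sm.
have [xi xiE] := dual_sum (fun y => cls \o actr (g y) \o Xcoord T s x).
exists xi; split=> [v Jv|i s' x' v xX s'm v1].
  have [r [ur r0 _]] := db_fin D v; rewrite (xiE v r) // big1 // => y _ /=.
  have -> : Xcoord T s x (f y v) = 0.
    by apply: (Xcoord_nge _ _ sm); move/dual_basis_ideal: Jv; apply.
  by rewrite (gb0l actb); exact: (linear0 cls).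
have [r [ur r0 vE]] := db_fin D v.
rewrite (xiE _ r) // => [|y /r0]; last by rewrite db_act => ->; rewrite (gb0r mulb).
have term y : (cls \o actr (g y) \o Xcoord T s x) (f y (act x' v)) =
    if (s', x') == (s, x) then cls (act (f y v) (g y)) else 0.
  have fv1 : spone s' ** f y v = f y v by rewrite -db_act v1.
  have := Xcoord_mul x sm s'm xX fv1; rewrite db_act.
  rewrite -[LHS]/(cls (act (Xcoord T s x (x' ** f y v)) (g y))).
  set a := Xcoord _ _ _ _; set b := if _ then f y v else 0 => Jab.
  have -> : cls (act a (g y)) = cls (act b (g y)).
    apply/eqP; rewrite -subr_eq0 -linearB -(gbBl actb); apply/eqP/cl_ideal.
    exact: ideal_mod_in.
  by rewrite /b; case: ifP => // _; rewrite (gb0l actb) linear0.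
rewrite (eq_bigr _ (fun y _ => term y)); case: ifP => _; last by rewrite big1.
by rewrite -linear_sum -vE.
Qed.

Let hdeg (a : A) : int :=
  if pselect (homogeneous a) is left h then projT1 (cid h) else 0.

Let hdegP a : homogeneous a -> gdeg (hdeg a) a.
Proof. by rewrite /hdeg; case: pselect => // h _; case: cid. Qed.

Let Yspec (q : spec w * A) : bool := `[< Yspecial T mu q >].

Let sf0 (y : db_idx D) (q : spec w * A) : {linear P -> A_loc w mu} :=
  @loc _ _ _ _ w mu \o Ycoord T q.1 q.2 \o f y \o actl P e.

Let sf0_kill y q v : Yspec q -> strat_sub w mu P v -> sf0 y q v = 0.
Proof.
move=> /asboolP[qm _] /dual_basis_ideal Jv /=.
by rewrite (Ycoord_nge _ _ qm) ?linear0 //; exact: Jv.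
Qed.

(* The index set is the full product, with zero data outside of the set Y. *)
Let sf (p : db_idx D * (spec w * A)) : {linear W -> A_loc w mu} :=
  if pselect (Yspec p.2) is left h
  then qlift (W := strat_sub w mu P) (fun v => sf0_kill p.1 h (v := v)) else \0.

Let sfE y q v : Yspec q -> sf (y, q) (cls v) =
  loc w mu (Ycoord T q.1 q.2 (f y (act e v))).
Proof. by rewrite /sf; case: pselect => // h _; exact: qliftE. Qed.

Let sf_out y q z : ~~ Yspec q -> sf (y, q) z = 0.
Proof. by rewrite /sf; case: pselect => // h /negP. Qed.

Let sg (p : db_idx D * (spec w * A)) : W :=
  if Yspec p.2 then cls (act p.2.2 (g p.1)) else 0.

Let sdeg (p : db_idx D * (spec w * A)) : int := hdeg p.2.2 + db_deg p.1.

Let sgen_deg p : gdeg (sdeg p) (sg p).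
Proof.
rewrite /sg; case: ifP => [/asboolP[_ [j yY]]|_]; last exact: gdeg0.
apply/scl_deg/(gb_deg actb); last exact: db_gen_deg.
by apply: hdegP; case: (gtY_in yY).
Qed.

Let sfun_deg p d z : gdeg d z -> gdeg (d - sdeg p) (sf p z).
Proof.
case: p => y q zd; have [h|h] := boolP (Yspec q); last by rewrite sf_out //; exact: gdeg0.
have [v [vd ev ->]] := scl_lift zd; rewrite sfE // ev; apply: loc_deg.
rewrite /sdeg opprD addrA addrAC; apply: Ycoord_deg; last exact: db_fun_deg.
by move/asboolP: h => [_ [j /gtY_in[]]] /hdegP.
Qed.

Let sact p x z : sf p (act x z) = x ** sf p z.
Proof.
case: p => y q; have [h|h] := boolP (Yspec q); last first.
  by rewrite !sf_out // (gb0r (amul_bilin (A_loc w mu))).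
have [a ->] := loc_surj x; have [v ->] := scl_surj z.
rewrite scl_act !sfE //.
have -> : act e (act a (act e v)) = act (e ** a ** e) (act e v).
  by rewrite -!actA -[_ ** e ** e]amulA esum_idem.
rewrite db_act; have [qm _] := asboolP _ h.
have eb : e ** f y (act e v) = f y (act e v).
  by rewrite -db_act -actA esum_idem.
rewrite (loc_nge_eq (Ycoord_lin T q.2 (e ** a ** e) qm eb)) loc_mul.
by rewrite -!amulA loc_el !amulA.
Qed.

Let sfin z : exists s, [/\ uniq s, forall p, p \notin s -> sf p z = 0 &
  z = \sum_(p <- s) act (sf p z) (sg p)].
Proof.
have [v0 zE] := scl_surj z; pose v := act e v0.
have ev : act e v = v by rewrite -actA esum_idem.
have {}zE : z = cls v by rewrite zE -cl_e.
have [s [us s0 vE]] := db_fin D v.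
have ef y : e ** f y v = f y v by rewrite -db_act ev.
pose R y := projT1 (cid (Ycoord_expand T (ef y))).
have RU y : uniq (R y) by rewrite /R; case: cid => r [].
have RY y q : q \in R y -> Yspec q.
  by rewrite /R; case: cid => r [/= _ h _ _] /h /asboolP.
have R0 y q : Yspec q -> q \notin R y -> Ycoord T q.1 q.2 (f y v) = 0.
  by move=> /asboolP[qm _]; rewrite /R; case: cid => r [/= _ _ h _]; exact: h.
have RJ y : J (f y v - \sum_(q <- R y) Ycoord T q.1 q.2 (f y v) ** q.2).
  by rewrite /R; case: cid => r [].
exists [seq (y, q) | y <- s, q <- R y]; split.
- by apply: allpairs_uniq_dep => // -[y q] [y' q'] _ _ /= [-> ->].
- move=> [y q] yq; have [h|h] := boolP (Yspec q); last exact: sf_out.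
  rewrite zE sfE // ev; have [ys|ys] := boolP (y \in s); last first.
    by rewrite s0 // linear0 linear0.
  rewrite R0 ?linear0 //; apply: contra yq => qR.
  by apply/allpairsPdep; exists y, q.
rewrite big_allpairs_dep /=.
have term y : y \in s -> \sum_(q <- R y) act (sf (y, q) z) (sg (y, q)) =
    cls (act (\sum_(q <- R y) Ycoord T q.1 q.2 (f y v) ** q.2) (g y)).
  move=> _; rewrite (gb_suml actb) linear_sum big_seq [RHS]big_seq.
  apply: eq_bigr => q /RY h; rewrite zE sfE // ev /sg h scl_act -[act e _]actA.
  by rewrite (Y_esum (asboolP _ h)) actA.
rewrite big_seq (eq_bigr _ (fun y ys => term y ys)) -big_seq -linear_sum zE.
apply/eqP; rewrite -subr_eq0 -linearB; apply/eqP/cl_ideal.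
rewrite {1}vE -sumrB; apply: gs_sum => y _.
by rewrite -(gbBl actb); exact: ideal_mod_in.
Qed.

(** Each coordinate [f_y] of [P], restricted to [e_mu P], splits further into the
  coordinates [Ycoord] along the decomposition of [e_mu A] into the [A_mu y]. *)
Definition strat_dual_basis : dual_basis W :=
  DualBasis sgen_deg sfun_deg sact sfin.

End DualBasis.

(** * Standardization *)

Section Standardization.
Variables (k : closedFieldType) (A : lualg k).
Variables (disp : Order.disp_t) (L : porderType disp) (w : weights A L) (mu : L).

Let mulb := amul_bilin A.
Local Notation J := (nge_ideal w mu).
Local Notation e := (esum w mu).
Local Notation M := (leftid_bimod (ebar w mu)).

Lemma lid_subproof (a : A) : leftid_set (ebar w mu) (qpi J (a ** e)).
Proof. by exists (qpi J a); rewrite qpi_mul. Qed.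

(** The class of [a e_mu] in the bimodule that defines [standardize]. *)
Definition lid (a : A) : M := sub_in (W := leftid_sub (ebar w mu)) (lid_subproof a).

Lemma lid_eq a b : lid a = lid b <-> J (a ** e - b ** e).
Proof. by rewrite -(qpi_eq J); split=> [/(congr1 val)|h]; [|apply: val_inj]. Qed.

Lemma lid_linear : linear lid.
Proof.
move=> c a b; apply: val_inj; rewrite /= -(linearP (qpi J)) /=.
by rewrite (gbDl mulb) (gbZl mulb).
Qed.

HB.instance Definition _ := GRing.isLinear.Build k A M _ lid lid_linear.

Lemma lid_surj x : exists a, x = lid a.
Proof.
have [y xE] := sub_carP x; have [a ya] := qpi_surj (W := J) y; exists a.
by apply: val_inj; rewrite xE ya -qpi_mul.
Qed.

Lemma lid_nge a : J a -> lid a = 0.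
Proof.
move=> Ja; rewrite -(linear0 lid); apply/lid_eq.
by rewrite (gb0l mulb) subr0; exact: gid_mulr.
Qed.

Lemma lid_e a : lid (a ** e) = lid a.
Proof. by apply/lid_eq; rewrite -amulA esum_idem subrr; exact: gs0. Qed.

Lemma lid_deg d a : gdeg d a -> gdeg d (lid a).
Proof.
move=> ad; apply/gdeg_gsub; apply: gdeg_qpi.
by have := gb_deg mulb ad (esum0 w mu); rewrite addr0.
Qed.

Lemma lid_comp d a : gcomp d (lid a) = lid (gcomp d a).
Proof.
apply: val_inj; rewrite /= -[X in _ = qpi_fun _ X]/(gcomp d a ** e).
have -> : gcomp d a ** e = gcomp d (a ** e).
  by rewrite (gcomp_degr mulb _ _ (esum0 w mu)) subr0.
exact: (quo_compE J).
Qed.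

Lemma lid_lift d m : gdeg d m -> exists a, gdeg d a /\ m = lid a.
Proof.
move=> md; have [a mE] := lid_surj m; exists (gcomp d a).
by split; [exact: gcomp_deg | rewrite -lid_comp -mE].
Qed.

Lemma lid_ract a b : ract (lid a) (loc w mu b) = lid (a ** e ** b).
Proof.
apply: val_inj; apply: etrans (esym (qpi_mul J _ _)) _; congr (qpi J _).
by rewrite !amulA -[a ** e ** e]amulA esum_idem.
Qed.

Lemma lid_lact c a : lact (qpi J c : A_ge w mu) (lid a) = lid (c ** a).
Proof.
apply: val_inj; apply: etrans (esym (qpi_mul J _ _)) _; congr (qpi J _).
by rewrite amulA.
Qed.

Variable W : gmod (A_loc w mu).
Local Notation tens := (@tens k (A_ge w mu) (A_loc w mu) M W).

Lemma std_act c a z : act (c : A) (tens (lid a) z : standardize W) = tens (lid (c ** a)) z.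
Proof. by apply: etrans (tactE _ _ _) _; rewrite lid_lact. Qed.

Lemma std_loc a b z : tens (lid (a ** e ** b)) z = tens (lid a) (act (loc w mu b) z).
Proof. by rewrite -lid_ract tens_bal. Qed.

Section NormalForm.
Variable T : gtbasis w.

Definition Xspecial (q : spec w * A) : Prop := wt q.1 = mu /\ exists i, gtX T i q.1 q.2.

(** [A_(>= mu) e_mu] is spanned over [A_mu] by the elements of X, which reduces a
  tensor to a combination over distinct [x]. *)
Lemma std_normal (t : standardize W) : exists (r : seq (spec w * A))
    (z : spec w * A -> W), [/\ uniq r, forall q, q \in r -> Xspecial q,
    forall q, act (loc w mu (spone q.1)) (z q) = z q &
    t = \sum_(q <- r) tens (lid q.2) (z q)].
Proof.
pose S (t : standardize W) := exists l : seq ((spec w * A) * W),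
  [/\ forall p, p \in l -> Xspecial p.1,
      forall p, p \in l -> act (loc w mu (spone p.1.1)) p.2 = p.2 &
      t = \sum_(p <- l) tens (lid p.1.2) p.2].
have S0 : S 0 by exists [::]; rewrite big_nil.
have SD u v : S u -> S v -> S (u + v).
  move=> [l [l1 l2 ->]] [l' [l1' l2' ->]]; exists (l ++ l').
  split=> [p|p|]; rewrite ?mem_cat ?big_cat //.
    by move=> /orP[/l1|/l1'].
  by move=> /orP[/l2|/l2'].
have {S0 SD} [l [lX l1 tE]] : S t.
  have [x ->] := tens_gen t; apply: big_ind => // -[m z] _ /=.
  have [a ->] := lid_surj m; rewrite -lid_e.
  have : (a ** e) ** e = a ** e by rewrite -amulA esum_idem.
  move: (a ** e) z => b + be; move: b be.
  apply: (esum_right_ind (T := T) (Q := fun b => forall z, S (tens (lid b) z))).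
  - by move=> b c hb hc z; rewrite linearD tensDl; exact: SD.
  - by move=> c b hb z; rewrite linearZ /= tensZl -tensZr.
  - move=> i s s' x' h sm s'm xX hH z; exists [:: ((s, x'), act (loc w mu h) z)].
    have eh : e ** h = h by rewrite -(H_l hH) amulA -sm (esum_sponel T).
    split.
    + by move=> p; rewrite inE => /eqP->; split=> //; exists i.
    + move=> p; rewrite inE => /eqP-> /=; rewrite -actA loc_mul -amulA eh.
      by rewrite (H_l hH).
    by rewrite big_seq1 /= -std_loc -amulA eh.
  move=> b /lt_nge /lid_nge -> z; rewrite tens0l; exact: S0.
pose z q := \sum_(p <- l | p.1 == q) p.2.
exists (undup [seq p.1 | p <- l]), z; split; first exact: undup_uniq.
- by move=> q; rewrite mem_undup => /mapP[p /lX pX ->].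
- move=> q; rewrite /z (gb_sumr (act_bilin W)) big_seq_cond [RHS]big_seq_cond.
  by apply: eq_bigr => p /andP[/l1 + /eqP <-].
rewrite tE (big_group (f := fun q z => tens (lid q.2) z)) //.
  by move=> q; exact: tens0r.
by move=> q u v; exact: tensDr.
Qed.

(** How standardized modules are recognized inside a given module [V]: the
  relation [rho] says that an element of [V] lifts an element of [W], and the
  section [N2 / N1] is generated by the lifts, subject to no relation between
  the multiples [x p] of lifts [p] other than those in [W]. *)
Section Recognition.
Variables (V : gmod A) (N1 N2 : gsubmod V) (rho : V -> W -> Prop).
Hypotheses
  (rho_lin : forall (c : k) p p' z z', rho p z -> rho p' z' ->
     rho (c *: p + p') (c *: z + z'))
  (rho_loc : forall a p z, rho p z -> rho (act e (act a p)) (act (loc w mu a) z))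
  (rho_e : forall p z, rho p z -> act e p = p)
  (rho_deg : forall d z, gdeg d z -> exists p, gdeg d p /\ rho p z)
  (rho_in : forall p z, rho p z -> N2 p)
  (rho_0 : forall p, rho p 0 -> N1 p)
  (rho_kill : forall a p z, rho p z -> J a -> N1 (act a p))
  (rho_gen : forall N : gsubmod V, (forall v, N1 v -> N v) ->
     (forall p z, rho p z -> N p) -> forall v, N2 v -> N v)
  (rho_free : forall (r : seq (spec w * A)) (p : spec w * A -> V) z, uniq r ->
     (forall q, q \in r -> Xspecial q) ->
     (forall q, act (spone q.1) (p q) = p q) ->
     (forall q, q \in r -> rho (p q) (z q)) ->
     N1 (\sum_(q <- r) act q.2 (p q)) -> forall q, q \in r -> z q = 0).

Let actb := act_bilin V.

Let rho00 : rho 0 0.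
Proof.
have [p [_ pr]] := rho_deg (gdeg0 W 0).
by have := rho_lin (-1) pr pr; rewrite !scaleN1r !addNr.
Qed.

Let rhoB p p' z z' : rho p z -> rho p' z' -> rho (p - p') (z - z').
Proof.
by move=> pz pz'; have := rho_lin (-1) pz' pz; rewrite !scaleN1r ![- _ + _]addrC.
Qed.

Let lift_ex z : exists p, rho p z.
Proof.
rewrite [z]gsuppE; elim: (gsupp z) => [|d s [p IH]]; first by exists 0; rewrite big_nil.
have [p' [_ pr]] := rho_deg (gcomp_deg d z); exists (1 *: p' + p).
rewrite big_cons -[X in rho _ (X + _)]scale1r; exact: rho_lin.
Qed.

Let lift z := projT1 (cid (lift_ex z)).
Let liftP z : rho (lift z) z. Proof. exact: projT2 (cid (lift_ex z)). Qed.

Let lr m := projT1 (cid (lid_surj m)).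
Let lrP m : lid (lr m) = m. Proof. exact/esym/(projT2 (cid (lid_surj m))). Qed.

Let prod (m : M) (z : W) : gmod_sub N2 :=
  sub_in (W := N2) (gsm_act (lr m) (rho_in (liftP z))).

Let prodE a z p : rho p z -> N1 (val (prod (lid a) z) - act a p).
Proof.
move=> pz; rewrite /prod /=; set b := lr _; set q := lift z.
have -> : act b q - act a p = act (b ** e - a ** e) q + act a (q - p).
  by rewrite (gbBl actb) !actA (rho_e (liftP z)) (gbBr actb) addrA subrK.
apply: gsD; last by apply/gsm_act/rho_0; rewrite -(subrr z); exact: rhoB (liftP z) pz.
by apply: rho_kill (liftP z) _; apply/lid_eq; rewrite lrP.
Qed.

Let G := gsection N1 N2.
Let sec (y : gmod_sub N2) : G := qpi (restr_submod N1 N2) y.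

Let sec_eq x y : N1 (val x - val y) -> sec x = sec y.
Proof. by move=> h; apply/qpi_eq. Qed.

Let fmap m z : G := sec (prod m z).

Let fmapE a z p (y : gmod_sub N2) : rho p z -> val y = act a p -> fmap (lid a) z = sec y.
Proof. by move=> pz yE; apply: sec_eq; rewrite yE; exact: prodE. Qed.

Let in_prod a z p (pz : rho p z) : gmod_sub N2 :=
  sub_in (W := N2) (gsm_act a (rho_in pz)).

Let fmapE' a z p (pz : rho p z) : fmap (lid a) z = sec (in_prod a pz).
Proof. by apply: (fmapE (y := in_prod a pz) pz). Qed.

Let secD x y : sec x + sec y = sec (x + y).
Proof. by rewrite /sec linearD. Qed.

Let secZ c x : c *: sec x = sec (c *: x).
Proof. by rewrite /sec linearZ. Qed.

Let fmap_bal : balanced fmap.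
Proof.
split=> [m m' z|m z z'|c m z|c m z|m x z].
- have [a ->] := lid_surj m; have [b ->] := lid_surj m'.
  rewrite -linearD !(fmapE' _ (liftP z)) secD; apply: sec_eq => /=.
  by rewrite (gbDl actb) subrr; exact: gs0.
- have [a ->] := lid_surj m; have zz := rho_lin 1 (liftP z) (liftP z').
  rewrite !scale1r in zz.
  rewrite (fmapE' _ zz) (fmapE' _ (liftP z)) (fmapE' _ (liftP z')) secD.
  by apply: sec_eq => /=; rewrite (gbDr actb) subrr; exact: gs0.
- have [a ->] := lid_surj m; rewrite -linearZ !(fmapE' _ (liftP z)) secZ.
  by apply: sec_eq => /=; rewrite (gbZl actb) subrr; exact: gs0.
- have [a ->] := lid_surj m; have zz := rho_lin c (liftP z) rho00.
  rewrite !addr0 in zz; rewrite (fmapE' _ zz) (fmapE' _ (liftP z)) secZ.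
  by apply: sec_eq => /=; rewrite (gbZr actb) subrr; exact: gs0.
have [a ->] := lid_surj m; have [b ->] := loc_surj x.
rewrite lid_ract (fmapE' _ (liftP z)) (fmapE' _ (rho_loc b (liftP z))).
by apply: sec_eq; rewrite /= -!actA subrr; exact: gs0.
Qed.

Let Phi : {linear standardize W -> G} := tlift fmap_bal.

Let PhiE m z : Phi (tens m z) = fmap m z.
Proof. exact: tliftE. Qed.

Let Phi_hom : ghom 0 Phi.
Proof.
split=> [c t|n t tn].
- move: t; apply: (tens_ext (f := Phi \o actl (standardize W) c) (g := actl G c \o Phi)).
  move=> m z; have [a ->] := lid_surj m.
  rewrite -[LHS]/(Phi (act c (tens (lid a) z : standardize W))) std_act PhiE.
  rewrite -[RHS]/(act c (Phi (tens (lid a) z))) PhiE !(fmapE' _ (liftP z)).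
  apply/esym; apply: etrans (quo_actE (restr_submod N1 N2) _ _) _.
  by apply: sec_eq; rewrite /= actA subrr; exact: gs0.
have [x [xh ->]] := gdeg_tens_gen tn; rewrite addr0 linear_sum big_seq.
apply: gdeg_sum => -[[p q] [m z]] /xh /= [mp zq <-].
rewrite -[X in gdeg _ X]/(Phi (tens m z)) PhiE.
have [a [ap ->]] := lid_lift mp; have [v [vq vz]] := rho_deg zq.
rewrite (fmapE' _ vz); apply: gdeg_qpi; apply/gdeg_gsub.
exact: (gb_deg actb).
Qed.

(* In normal form, a tensor in the kernel gives a relation between the x p. *)
Let Phi_inj : injective Phi.
Proof.
move=> t t' /eqP; rewrite -subr_eq0 -linearB => /eqP tt; apply/eqP.
rewrite -subr_eq0; apply/eqP; move: (t - t') tt => {t t'} t.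
have [r [z [ur rX z1 ->]]] := std_normal t; rewrite linear_sum.
pose p q := act e (act (spone q.1) (lift (z q))).
have pz q : rho (p q) (z q) by rewrite -[z q]z1; exact: rho_loc.
have p1 q : q \in r -> act (spone q.1) (p q) = p q.
  move=> /rX[sm _]; rewrite /p -!actA -sm (esum_sponer T) spone_idem.
  by rewrite (esum_sponel T).
pose p' q := if q \in r then p q else 0.
have p'z q : q \in r -> rho (p' q) (z q) by rewrite /p' => ->.
have p'1 q : act (spone q.1) (p' q) = p' q.
  by rewrite /p'; case: ifP => [/p1//|_]; exact: (gb0r actb).
under eq_bigr do rewrite PhiE (fmapE' _ (pz _)).
rewrite /sec -linear_sum => /qpi_ker; rewrite /= /restr_set raddf_sum /= => Nsum.
rewrite big_seq big1 // => q qr.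
rewrite (rho_free ur rX p'1 p'z _ qr) ?tens0r //.
rewrite big_seq; under eq_bigr => q' q'r do rewrite /p' q'r.
by rewrite -big_seq.
Qed.

Let im_set (v : V) : Prop :=
  exists t (y : gmod_sub N2), N1 (val y - v) /\ Phi t = sec y.

Let im0 : im_set 0.
Proof. by exists 0, 0; rewrite subr0 /sec !linear0; split=> //; exact: (@gs0 _ _ N1). Qed.

Let imD u v : im_set u -> im_set v -> im_set (u + v).
Proof.
move=> [t [y [yu tE]]] [t' [y' [yu' tE']]]; exists (t + t'), (y + y').
rewrite linearD tE tE' secD; split=> //.
by rewrite raddfD opprD addrACA; exact: gsD.
Qed.

Let imZ (c : k) v : im_set v -> im_set (c *: v).
Proof.
move=> [t [y [yu tE]]]; exists (c *: t), (c *: y).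
rewrite (linearZZ Phi) tE secZ; split=> //.
by rewrite -[val _]/(c *: val y) -scalerBr; exact: gsZ.
Qed.

Let im_comp d v : im_set v -> im_set (gcomp d v).
Proof.
move=> [t [y [yu tE]]]; exists (gcomp d t), (gcomp d y).
rewrite (ghom0_comp _ _ Phi_hom) tE; split.
  by rewrite /= -linearB; exact: gs_comp.
exact: (quo_compE (restr_submod N1 N2)).
Qed.

Let im_act a v : im_set v -> im_set (act a v).
Proof.
move=> [t [y [yu tE]]]; exists (act a t), (act a y); split.
  by rewrite /= -(gbBr actb); exact: gsm_act.
by rewrite (gh_act Phi_hom) tE; exact: (quo_actE (restr_submod N1 N2)).
Qed.

Lemma std_recognition : giso (gsection N1 N2) (standardize W).
Proof.
apply/giso_sym/(giso_bij Phi_hom Phi_inj) => y.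
have [x ->] := qpi_surj (W := restr_submod N1 N2) y.
pose N : gsubmod V := @GSubmod _ _ V (GSubsp im0 imD imZ im_comp) im_act.
have [t [y' [yx tE]]] : N (val x).
  apply: rho_gen (sub_carP x) => [v v1|p z pz].
    exists 0, 0; rewrite /sec !linear0 -[_ - v]/(0 - v) sub0r.
    by split=> //; exact: (@gsN _ _ N1).
  exists (tens (lid e) z), (in_prod e pz).
  rewrite PhiE (fmapE' _ pz) /= (rho_e pz) subrr; split=> //; exact: gs0.
by exists t; rewrite tE; exact: sec_eq.
Qed.

End Recognition.
End NormalForm.
End Standardization.

Lemma giso_section k (A : lualg k) (V : gmod A) (N1 N2 : gsubmod V) (U : gmod A)
    (f : {linear gmod_sub N2 -> U}) :
  ghom 0 f -> Defs.surj f -> (forall y, f y = 0 <-> N1 (val y)) ->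
  giso (gsection N1 N2) U.
Proof.
move=> fh fs fk; have f0 y : restr_submod N1 N2 y -> f y = 0 by move/(fk y).
pose F : {linear gsection N1 N2 -> U} := qlift (W := restr_submod N1 N2) f0.
have FE y : F (qpi (restr_submod N1 N2) y) = f y by exact: qliftE.
apply: (giso_bij (f := F)).
- split=> [a x|n x xn].
    have [y ->] := qpi_surj (W := restr_submod N1 N2) x.
    rewrite FE -(gh_act fh) -FE; congr (F _).
    exact: (quo_actE (restr_submod N1 N2)).
  have [y [yn ->]] := gdeg_qpi_lift xn; rewrite FE; exact: (gh_deg fh).
- move=> x x' /eqP; rewrite -subr_eq0 -linearB => /eqP xx; apply/eqP.
  rewrite -subr_eq0; apply/eqP; move: (x - x') xx => {x x'} x.
  have [y ->] := qpi_surj (W := restr_submod N1 N2) x.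
  by rewrite FE => /fk h; apply/qpi_ker.
by move=> u; have [y yu] := fs u; exists (qpi (restr_submod N1 N2) y); rewrite FE.
Qed.

(** * Sections of a projective module *)

Section StratumSection.
Variables (k : closedFieldType) (A : lualg k) (P : gmod A) (D : dual_basis P).
Variables (disp : Order.disp_t) (L : porderType disp) (w : weights A L).
Variables (T : gtbasis w) (mu : L).

Let mulb := amul_bilin A.
Let actb := act_bilin P.
Local Notation J := (nge_ideal w mu).
Local Notation e := (esum w mu).
Local Notation W := (strat_mod w mu P).
Local Notation cls := (scl w mu P).

Lemma cls_act a p : act e p = p -> cls (act a p) = act (loc w mu a) (cls p).
Proof. by move=> ep; rewrite scl_act ep. Qed.

Lemma nge_lt_mod p : ideal_mod J P p -> ideal_mod (lt_ideal w mu) P (act e p).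
Proof.
move: p; apply: ideal_mod_ind => [|u v hu hv|a u Ja].
- by rewrite (gb0r actb); exact: gs0.
- by rewrite (gbDr actb); exact: gsD.
by rewrite -actA; apply/ideal_mod_in/(nge_mull T).
Qed.

(** Exactness of standardization, seen inside [P]: a subquotient [W2 / W1] of the
  stratum module, given as a quotient [U] of [W2], standardizes to the subquotient
  of [P] that it generates. There are no unwanted relations because the
  coordinates [strat_coord] send [N1] to [W1]. *)
Lemma strat_subquotient (W1 W2 : gsubmod W) (U : gmod (A_loc w mu))
    (f : {linear gmod_sub W2 -> U}) (N1 N2 : gsubmod P) :
  ghom 0 f -> Defs.surj f -> (forall y, f y = 0 <-> W1 (val y)) ->
  (forall a p, lt_ideal w mu a -> N1 (act a p)) ->
  (forall p, act e p = p -> W1 (cls p) -> N1 p) ->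
  (forall p, act e p = p -> W2 (cls p) -> N2 p) ->
  (forall N : gsubmod P, (forall v, N1 v -> N v) ->
     (forall p, act e p = p -> W2 (cls p) -> N p) -> forall v, N2 v -> N v) ->
  (forall Q : P -> Prop, (forall u v, Q u -> Q v -> Q (u + v)) ->
     (forall v, ideal_mod J P v -> Q v) ->
     (forall a p, act e p = p -> W1 (cls p) -> Q (act a p)) ->
     forall v, N1 v -> Q v) ->
  giso (gsection N1 N2) (standardize U).
Proof.
move=> fh fs fk Nlt N1W N2W N2gen N1gen.
pose rho p u := act e p = p /\ exists y : gmod_sub W2, val y = cls p /\ u = f y.
apply: (std_recognition (T := T) (rho := rho)).
- move=> c p p' u u' [ep [y [yp ->]]] [ep' [y' [yp' ->]]]; split.
    by rewrite (gbDr actb) (gbZr actb) ep ep'.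
  exists (c *: y + y'); split; last by rewrite linearP.
  by rewrite (linearP cls) -yp -yp'.
- move=> a p u [ep [y [yp ->]]]; split; first by rewrite -[act e (act e _)]actA esum_idem.
  exists (act (loc w mu a) y); split; last by rewrite (gh_act fh).
  have -> : val (act (loc w mu a) y) = act (loc w mu a) (val y) by [].
  rewrite yp -(cls_act _ ep).
  exact/esym/cl_e.
- by move=> p u [].
- move=> d u ud; have [y0 y0u] := fs u; pose y := gcomp d y0.
  have yu : f y = u by rewrite (ghom0_comp _ _ fh) y0u.
  have : gdeg d (val y) by apply/gdeg_gsub; exact: gcomp_deg.
  by case/scl_lift => p [pd ep yp]; exists p; split=> //; split=> //; exists y.
- move=> p u [ep [y [yp _]]]; apply: N2W => //; rewrite -yp; exact: sub_carP.
- by move=> p [ep [y [yp /esym/fk]]]; rewrite yp; exact: N1W.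
- move=> a p u [ep _] Ja; rewrite -ep -actA.
  exact/Nlt/(nge_mulr T).
- move=> N N1N Nrho; apply: N2gen => // p ep pW2.
  by apply: (Nrho p (f (sub_in pW2))); split=> //; exists (sub_in pW2).
move=> r p u ur rX p1 rpu Nsum [s x] qr.
have [/= sm [i xX]] := rX _ qr.
have [xi [xiJ xiE]] := strat_coord D T x sm.
have W1xi v : N1 v -> W1 (xi v).
  move: v; apply: N1gen => [v v' hv hv'|v /xiJ ->|a v ev vW1].
  - by rewrite linearD; exact: gsD.
  - exact: gs0.
  rewrite -ev -actA; have : (a ** e) ** e = a ** e by rewrite -amulA esum_idem.
  move: (a ** e); apply: (esum_right_ind (T := T)).
  - by move=> b c hb hc; rewrite (gbDl actb) linearD; exact: gsD.
  - by move=> c b hb; rewrite (gbZl actb) linearZ; exact: gsZ.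
  - move=> i' s' t' x' h s'm t'm xX' hH; rewrite actA (xiE _ _ _ _ xX' s'm).
      case: ifP => _; last exact: gs0.
      by rewrite cls_act //; exact: gsm_act.
    by rewrite -actA (H_l hH).
  by move=> b /lt_nge Jb; rewrite xiJ; [exact: gs0|exact: ideal_mod_in].
have /W1xi := Nsum; rewrite linear_sum (bigD1_seq (s, x)) //=.
have p1s : act (spone s) (p (s, x)) = p (s, x) := p1 (s, x).
rewrite (xiE _ _ _ _ xX sm p1s) eqxx big1_seq ?addr0 => [|[s' x'] /andP[ne qr']].
  by have [_ [y [yp ->]]] := rpu _ qr => W1p; apply/fk; rewrite yp.
have [/= s'm [i' xX']] := rX _ qr'.
by rewrite (xiE _ _ _ _ xX' s'm (p1 (s', x'))) (negPf ne).
Qed.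

Lemma zero_subD (V : gvect k) (u v : V) : u = 0 -> v = 0 -> u + v = 0.
Proof. by move=> -> ->; rewrite addr0. Qed.

Lemma zero_subZ (V : gvect k) (c : k) (v : V) : v = 0 -> c *: v = 0.
Proof. by move=> ->; rewrite scaler0. Qed.

Lemma zero_sub_comp (V : gvect k) d (v : V) : v = 0 -> gcomp d v = 0.
Proof. by move=> ->; rewrite linear0. Qed.

Lemma zero_sub_act (V : gmod A) a (v : V) : v = 0 -> act a v = 0.
Proof. by move=> ->; rewrite (gb0r (act_bilin V)). Qed.

Definition zero_sub (V : gmod A) : gsubmod V :=
  @GSubmod _ _ V (@GSubsp _ V (fun v => v = 0) erefl (@zero_subD V) (@zero_subZ V)
    (@zero_sub_comp V)) (@zero_sub_act V).

Definition full_sub (V : gmod A) : gsubmod V :=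
  @GSubmod _ _ V (@GSubsp _ V (fun=> True) I (fun _ _ _ _ => I) (fun _ _ _ => I)
    (fun _ _ _ => I)) (fun _ _ _ => I).

End StratumSection.

(** The case of the whole stratum, [W1 = 0] and [W2 = W]. *)
Lemma strat_section k (A : lualg k) (P : gmod A) (D : dual_basis P)
    (disp : Order.disp_t) (L : porderType disp) (w : weights A L) (T : gtbasis w)
    (mu : L) (G G' : set L) (N1 N2 : gsubmod P) :
  (forall l m, (m <= l)%O -> G l -> G m) -> ~ G mu -> (forall m, (m < mu)%O -> G m) ->
  (forall m, G' m <-> G m \/ m = mu) ->
  (forall v, N1 v <-> ideal_mod (weight_ideal w G) P v) ->
  (forall v, N2 v <-> ideal_mod (weight_ideal w G') P v) ->
  giso (gsection N1 N2) (standardize (strat_mod w mu P)).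
Proof.
move=> Glow Gmu Glt G'E N1E N2E; pose W := strat_mod w mu P.
have actb := act_bilin P; pose e := esum w mu.
have val_lin : linear (fun y : gmod_sub (full_sub W) => val y : W) by [].
pose f : {linear gmod_sub (full_sub W) -> W} := lin_of val_lin.
have ltG a p : lt_ideal w mu a -> N1 (act a p).
  by move=> la; apply/N1E/ideal_mod_in/(weight_ideal_sub _ la) => m /=; exact: Glt.
apply: (strat_subquotient D T (W1 := zero_sub W) (W2 := full_sub W) (f := f)) => //.
- by split=> // n v /gdeg_gsub; rewrite addr0.
- by move=> z; exists (sub_in (W := full_sub W) (v := z) I).
- move=> p ep /cl_eq0 /(nge_lt_mod T); rewrite -!actA esum_idem ep => pJ.
  by apply/N1E; apply: ideal_modS pJ => a; apply: weight_ideal_sub => m /=; exact: Glt.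
- move=> p ep _; apply/N2E; rewrite -ep; apply/ideal_mod_in/IG_in.
  by exists mu => //; apply/G'E; right.
- move=> N GN eN v /N2E; apply: ideal_mod_span v => a u aG'; elim: aG' u
    => {a} [x [m /G'E[mG|->] ->]||a b _ ha _ hb|c a _ ha|a b _ hb|a b _ hb] u.
  + by apply/GN/N1E/ideal_mod_in/IG_in; exists m.
  + by apply: eN => //; rewrite -actA esum_idem.
  + by rewrite (gb0l actb); exact: gs0.
  + by rewrite (gbDl actb); exact: gsD.
  + by rewrite (gbZl actb); exact: gsZ.
  + by rewrite actA; exact: gsm_act.
  by rewrite actA; exact: hb.
move=> Q _ QJ _ v /N1E Gv; apply: QJ; apply: ideal_modS Gv => a.
apply: weight_ideal_sub => m mG /=; apply/negP => mum; exact/Gmu/(Glow _ _ mum mG).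
Qed.

Definition tame k (V : gvect k) (E : V -> Prop) : Prop :=
  (forall d, fin_dim (fun v => gdeg d v /\ E v)) /\
  exists N : int, forall d, (d < N)%R -> forall v, gdeg d v -> E v -> v = 0.

Lemma tame_strat k (A : lualg k) (P : gmod A) (disp : Order.disp_t)
    (L : porderType disp) (w : weights A L) (mu : L) :
  tame (fun p : P => act (esum w mu) p = p) ->
  tame (fun _ : strat_mod w mu P => True).
Proof.
move=> [Pf [N Pb]]; split=> [d|].
  have [n [b bE]] := Pf d; exists n, (fun i => scl w mu P (b i)).
  move=> _ [/scl_lift[p [pd ep ->]] _]; have [c ->] := bE _ (conj pd ep).
  by exists c; rewrite linear_sum; apply: eq_bigr => i _; rewrite linearZ.
exists N => d dN z /scl_lift[p [pd ep ->]] _.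
by rewrite (Pb _ dN _ pd ep) linear0.
Qed.

Lemma tame_lfd k (A : lualg k) (V : gmod A) : tame (fun _ : V => True) ->
  lfd_mod V /\ bb_mod V.
Proof.
move=> [Vf [N Vb]]; split=> [i d|i].
  have [n [b bE]] := Vf d; exists n, b => v [vd _]; exact: bE.
by exists N => d dN v [vd _]; exact: Vb dN v vd I.
Qed.

Section Refinement.
Variables (k : closedFieldType) (D : lualg k) (disp : Order.disp_t).
Variables (Bl : finPOrderType disp) (R : baqh D Bl).

Section OverBq.
Variable W : gmod D.

Lemma bq_mod_unital (v : W) : exists s : seq (bq_idx R), uniq s /\
  v = \sum_(i <- s) act (bq_one i : D) v.
Proof.
have [r [_ vE]] := act_unital v.
have [s [us su _]] := idsum_local (bq_unital R) (idsum (lu_one D) r).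
exists s; split=> //.
rewrite -(gb_suml (act_bilin W)) -/(idsum _ _).
rewrite -(gb_suml (act_bilin W)) -/(idsum _ _) in vE.
by rewrite {2}vE -actA su.
Qed.

(** The same module for the idempotents of the quasi-hereditary structure; this
  undoes [gmod_chg]. *)
Definition bq_mod : gmod (bq_alg R) :=
  @GMod k (bq_alg R) W (@act _ D W) (act_bilin W) (@actA _ _ W) bq_mod_unital.

(** The underlying graded subspace is kept, so that the modules [gmod_sub] over the
  two families of idempotents have the same carrier. *)
Definition bq_sub (N : gsubmod W) : gsubmod bq_mod :=
  @GSubmod _ _ bq_mod (gsm_sub N) (@gsm_act _ _ _ N).

Definition bq_dual_basis (B : dual_basis W) : dual_basis bq_mod :=
  @DualBasis k (bq_alg R) bq_mod (db_idx B) (@db_deg _ _ _ B) (@db_gen _ _ _ B)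
    (@db_fun _ _ _ B) (@db_gen_deg _ _ _ B) (@db_fun_deg _ _ _ B) (@db_act _ _ _ B)
    (@db_fin _ _ _ B).

Lemma giso_bq_section (N1 N2 : gsubmod W) (U : gmod (bq_alg R)) :
  giso (gsection (bq_sub N1) (bq_sub N2)) U -> giso (gsection N1 N2) (gmod_chg U).
Proof.
move=> [g [gh [h gK hK]]].
pose q := qpi (restr_submod (bq_sub N1) (bq_sub N2)).
apply: (@giso_section _ _ _ N1 N2 (gmod_chg U) (g \o q)).
- split=> [a y|n y yn].
    rewrite -[LHS]/(g (q (act (a : bq_alg R) (y : gmod_sub (bq_sub N2))))).
    rewrite -[RHS](gh_act gh); congr (g _).
    exact/esym/(quo_actE (restr_submod (bq_sub N1) (bq_sub N2))).
  by apply: (gh_deg gh); exact: (@gdeg_qpi _ _ (restr_submod (bq_sub N1) (bq_sub N2)) n y yn).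
- move=> u; have [y yE] := qpi_surj (W := restr_submod (bq_sub N1) (bq_sub N2)) (h u).
  by exists y; rewrite -[LHS]/(g (q y)) -[q y]yE hK.
move=> y; have := qpi_ker (restr_submod (bq_sub N1) (bq_sub N2)) y.
rewrite -[qpi _ y]/(q y) => qk; split=> [gq|/(proj2 qk) qy].
  by apply: (proj1 qk); rewrite -[LHS]gK -[g _]/((g \o q) y) gq -(linear0 g) gK.
by rewrite -[LHS]/(g (q y)) qy linear0.
Qed.

End OverBq.

(** Inside [A_mu] the argument for strata applies once more: the strata of [W] are
  projective modules over the Cartan algebras. *)
Lemma std_layer_section (W : gmod D) (B : dual_basis W) (c : Bl) (G G' : set Bl) :
  tame (fun _ : W => True) ->
  (forall l m, (m <= l)%O -> G l -> G m) -> ~ G c -> (forall m, (m < c)%O -> G m) ->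
  (forall m, G' m <-> G m \/ m = c) ->
  std_layer R c (gsection (ideal_mod (weight_ideal (bq_wts R) G : gideal D) W)
                          (ideal_mod (weight_ideal (bq_wts R) G' : gideal D) W)).
Proof.
move=> Wt Glow Gc Glt G'E; pose Q := strat_mod (bq_wts R) c (bq_mod W).
have Qt : tame (fun _ : Q => True).
  apply: tame_strat; have [Wf [N Wb]] := Wt; split=> [d|].
    by have [n [b bE]] := Wf d; exists n, b => v [vd _]; exact: bE.
  by exists N => d dN v vd _; exact: Wb dN v vd I.
have [Ql Qb] := tame_lfd Qt; exists Q; split=> //.
  exact: dual_basis_projective (strat_dual_basis (bq_dual_basis B) (bq_basis R) c).
apply: giso_bq_section.
exact: (strat_section (bq_dual_basis B) (bq_basis R) Glow Gc Glt G'E).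
Qed.

End Refinement.

(** * Ideals indexed by types *)

Lemma weight_ideal_full k (A : lualg k) disp (L : porderType disp) (w : weights A L)
  (T : gtbasis w) (a : A) : weight_ideal w [set: L] a.
Proof.
apply: (weight_ideal_tri (T := T)).
elim/(basis_ind (gt_basis T)): a => [|a b|c a|[[x h] y] [s [t /= [[i xX] hH [j yY]]]]].
- exact: LS_0.
- exact: LS_D.
- exact: LS_Z.
by apply: LS_in; exists s, t, i, x, h, j, y.
Qed.

Section BaqhIdempotents.
Variables (k : closedFieldType) (D : lualg k) (disp : Order.disp_t).
Variables (Bl : finPOrderType disp) (R : baqh D Bl).

Definition bq_idem (c : Bl) : D := bq_one (bq_in R c).

Lemma bq_esum c : esum (bq_wts R) c = bq_idem c.
Proof.
rewrite /esum (_ : [set s : spec (bq_wts R) | _] = [set (c : spec (bq_wts R))]).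
  by rewrite fsbig_set1.
by apply/seteqP; split=> s.
Qed.

Lemma bq_idem_idem c : bq_idem c ** bq_idem c = bq_idem c.
Proof. exact: (lu_idem (bq_unital R)). Qed.

Lemma bq_idem_deg c : gdeg 0 (bq_idem c).
Proof. exact: (one_deg0 (bq_unital R)). Qed.

End BaqhIdempotents.

Section RefinedIdeals.
Variables (k : closedFieldType) (A : lualg k) (disp dB : Order.disp_t).
Variables (L : porderType disp) (w : weights A L) (T : gtbasis w).
Variables (B : L -> finPOrderType dB) (R : forall l, baqh (A_loc w l) (B l)).

Let mulb := amul_bilin A.
Local Notation type := {l : L & B l}.
Local Notation e l := (esum w l).

Lemma refined_idem_exists (a : type) : exists x : A,
  [/\ gdeg 0 x, e (tag a) ** x = x, x ** e (tag a) = x &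
      loc w (tag a) x = bq_idem (R (tag a)) (tagged a)].
Proof.
case: a => l c /=; have [y yE] := loc_surj (bq_idem (R l) c).
pose x := gcomp 0 y; exists (e l ** x ** e l); split.
- have := gb_deg mulb (gb_deg mulb (esum0 w l) (gcomp_deg 0 y)) (esum0 w l).
  by rewrite !addr0.
- by rewrite !amulA esum_idem.
- by rewrite -!amulA esum_idem.
rewrite loc_er loc_el yE; apply: val_inj; rewrite !val_loc.
have -> : e l ** x ** e l = gcomp 0 (e l ** y ** e l).
  by rewrite (gcomp_degr mulb _ _ (esum0 w l)) subr0 (gcomp_degl mulb _ _ (esum0 w l)) subr0.
have := bq_idem_deg (R l) c; rewrite yE => /gdeg_gsub; rewrite val_loc => yd.
by rewrite -[RHS]yd; exact/esym/(quo_compE (nge_ideal w l)).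
Qed.

(** A lift to [A] of the special idempotent of type [a] in [A_loc w (tag a)]; it is
  idempotent only up to smaller weights. *)
Definition refined_idem (a : type) : A := projT1 (cid (refined_idem_exists a)).

Lemma refined_idemP (a : type) : [/\ gdeg 0 (refined_idem a),
  e (tag a) ** refined_idem a = refined_idem a,
  refined_idem a ** e (tag a) = refined_idem a &
  loc w (tag a) (refined_idem a) = bq_idem (R (tag a)) (tagged a)].
Proof. by rewrite /refined_idem; case: cid. Qed.

Definition refined_idems (Om : set type) : set A :=
  [set x | exists2 a, Om a & x = refined_idem a].

Lemma refined_idems_homog Om x : refined_idems Om x -> homogeneous x.
Proof. by move=> [a _ ->]; exists 0; case: (refined_idemP a). Qed.

Definition refined_ideal (Om : set type) : gideal A := gen_ideal (@refined_idems_homog Om).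

Lemma refined_ideal_in (Om : set type) a : Om a -> refined_ideal Om (refined_idem a).
Proof. by move=> Oa; apply: IG_in; exists a. Qed.

Lemma weight_ideal_lift (Om : set type) mu (G : set (B mu)) (d : A_loc w mu) :
  (forall c, G c -> Om (existT _ mu c)) -> weight_ideal (bq_wts (R mu)) G d ->
  exists a, refined_ideal Om a /\ d = loc w mu a.
Proof.
move=> GO; elim=> {d} [_ [c Gc ->]||x y _ [a [aO ->]] _ [b [bO ->]]
  |z x _ [a [aO ->]]|x y _ [a [aO ->]]|x y _ [a [aO ->]]].
- exists (refined_idem (existT _ mu c)); split; first exact/refined_ideal_in/GO.
  by have [_ _ _ ->] := refined_idemP (existT _ mu c); rewrite bq_esum.
- by exists 0; split; [exact: gs0 | rewrite linear0].
- by exists (a + b); split; [exact: gsD | rewrite linearD].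
- by exists (z *: a); split; [exact: gsZ | rewrite linearZ].
- have [b ->] := loc_surj x; exists (b ** e mu ** a); split; first exact: gid_mull.
  exact: loc_mul.
have [b ->] := loc_surj x; exists (a ** (e mu ** b)); split; first exact: gid_mulr.
by rewrite amulA; exact: loc_mul.
Qed.

(** The idempotents [e_l] are recovered from the finer ones by induction on [l]:
  they agree modulo the ideal generated by the [e_m] with [m < l]. *)
Lemma refined_ideal_esum (Om : set type) l :
  (forall a : type, (tag a <= l)%O -> Om a) -> refined_ideal Om (e l).
Proof.
pose Q l := (forall a : type, (tag a <= l)%O -> Om a) -> refined_ideal Om (e l).
suff h : forall l, Q l by exact: h.
apply: (lower_finite_ind (gt_lower_finite T)) => {}l IH Ol.
have ltO a : lt_ideal w l a -> refined_ideal Om a.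
  apply: ideal_gen_sub => {a} _ [m /= ml ->].
  by apply: IH => // a am; apply: Ol; exact: le_trans am (ltW ml).
have GO (c : B l) : [set: B l] c -> Om (existT _ l c) by move=> _; apply: Ol => /=.
have := weight_ideal_lift GO (weight_ideal_full (bq_basis (R l)) (loc w l (e l))).
case=> a [aO /loc_eq].
rewrite !esum_idem => /(nge_mull T) /ltO; rewrite (gbBr mulb) !amulA !esum_idem => h.
rewrite -[e l](subrK (e l ** a ** e l)).
by apply: gsD => //; apply/gid_mulr/gid_mull.
Qed.

Lemma refined_ideal_lt (Om : set type) mu :
  (forall a : type, (tag a < mu)%O -> Om a) ->
  forall x, lt_ideal w mu x -> refined_ideal Om x.
Proof.
move=> mO; apply: ideal_gen_sub => _ [m /= ml ->].
by apply: refined_ideal_esum => a am; apply: mO; exact: le_lt_trans am ml.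
Qed.

Section Step.
Variables (P : gmod A) (D : dual_basis P) (mu : L) (c : B mu) (Om Om' : set type).
Local Notation a := (existT _ mu c : type).
Hypotheses (Om_low : forall x y : type, (x <= y)%O -> Om y -> Om x) (Oma : ~ Om a).
Hypothesis Om_lt : forall x : type, (x < a)%O -> Om x.
Hypothesis Om'E : forall x, Om' x <-> Om x \/ x = a.

Let actb := act_bilin P.
Local Notation W := (strat_mod w mu P).
Local Notation cls := (scl w mu P).
Local Notation type_sub O :=
  (ideal_mod (weight_ideal (bq_wts (R mu)) [set c' | O (existT _ mu c')]
              : gideal (A_loc w mu)) W).

Let tag_lt (x : type) : (tag x < mu)%O -> Om x.
Proof.
by move=> xm; apply: Om_lt; rewrite Order.SigmaOrder.ltEsig /= (ltW xm) (lt_geF xm).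
Qed.

Let type_lift (O : set type) p : (forall x, lt_ideal w mu x -> refined_ideal O x) ->
  act (e mu) p = p -> type_sub O (cls p) -> ideal_mod (refined_ideal O) P p.
Proof.
move=> ltO ep pO.
have [p' [p'O pp']] : exists p', ideal_mod (refined_ideal O) P p' /\ cls p = cls p'.
  move: (cls p) pO; apply: ideal_mod_ind => [|_ _ [u [uO ->]] [v [vO ->]]|d z dO].
  - by exists 0; rewrite linear0; split=> //; exact: gs0.
  - by exists (u + v); rewrite linearD; split=> //; exact: gsD.
  have [x [xO ->]] := weight_ideal_lift (Om := O) (fun _ h => h) dO.
  have [v ->] := scl_surj z; exists (act x (act (e mu) v)).
  by rewrite scl_act; split=> //; exact: ideal_mod_in.
move/cl_eq/(nge_lt_mod T): pp'; rewrite -actA esum_idem (gbBr actb) ep => h.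
rewrite -[p](subrK (act (e mu) p')); apply: gsD; last exact: gsm_act.
by apply: ideal_modS h; exact: ltO.
Qed.

Let refined_idem_cls (x : B mu) u :
  [/\ act (e mu) (act (refined_idem (existT _ mu x)) u) =
         act (refined_idem (existT _ mu x)) u &
      cls (act (refined_idem (existT _ mu x)) u) = act (bq_idem (R mu) x) (cls u)].
Proof.
have [_ el er <-] := refined_idemP (existT _ mu x); split; first by rewrite -actA el.
by rewrite scl_act -actA er.
Qed.

Let type_sub_refined_idem (O : set type) x u : O (existT _ mu x) ->
  type_sub O (cls (act (refined_idem (existT _ mu x)) u)).
Proof.
move=> Ox; have [_ ->] := refined_idem_cls x u; apply: ideal_mod_in; apply: IG_in.
by exists x => //; rewrite bq_esum.
Qed.

(** Adding the type [a] to a lower set of types changes [P] only in the stratum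
  [mu], where it adds the type [c]. *)
Lemma step_section (U : gmod (A_loc w mu)) (f : {linear gmod_sub (type_sub Om') -> U}) :
  ghom 0 f -> Defs.surj f -> (forall y, f y = 0 <-> type_sub Om (val y)) ->
  giso (gsection (ideal_mod (refined_ideal Om) P) (ideal_mod (refined_ideal Om') P))
       (standardize U).
Proof.
move=> fh fs fk; have ltO := refined_ideal_lt tag_lt.
have OO' x : refined_ideal Om x -> refined_ideal Om' x.
  move: x; apply: ideal_gen_sub => _ [y yO ->].
  by apply/refined_ideal_in/Om'E; left.
apply: (strat_subquotient D T fh fs fk).
- by move=> x p /ltO; exact: ideal_mod_in.
- by move=> p; apply: type_lift.
- by move=> p; apply: type_lift => x /ltO/OO'.
- move=> N N1 Ne; apply: ideal_mod_span => x u xO; elim: xO u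
    => {x} [_ [y /Om'E[yO|->] ->]||x y _ hx _ hy|z x _ hx|x y _ hy|x y _ hy] u.
  + exact/N1/ideal_mod_in/refined_ideal_in.
  + apply: Ne; first by have [] := refined_idem_cls c u.
    by apply: type_sub_refined_idem; apply/Om'E; right.
  + by rewrite (gb0l actb); exact: gs0.
  + by rewrite (gbDl actb); exact: gsD.
  + by rewrite (gbZl actb); exact: gsZ.
  + by rewrite actA; exact: gsm_act.
  by rewrite actA; exact: hy.
move=> Q QD QJ QW; apply: ideal_mod_ind => [||x u xO].
- by apply: QJ; exact: gs0.
- exact: QD.
have [s [us sx _]] := idsum_local (lu_unital A) x.
rewrite -sx; move: (idsum _ s) => b; rewrite {s us sx} actA.
elim: xO b u => {x} [_ [[nu y] yO ->]||x y _ hx _ hy|z x _ hx|x y _ hy|x y _ hy] b u.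
- have [nm|nm] := pselect (nu = mu).
    subst nu; apply: QW; first by have [] := refined_idem_cls y u.
    exact: type_sub_refined_idem.
  (* nu is not above mu: otherwise (nu, y), hence a, would lie in Om *)
  apply: QJ; apply: gsm_act; apply: ideal_mod_in.
  have [_ <- _ _] := refined_idemP (existT _ nu y); apply: gid_mulr; apply: IG_in.
  exists nu => //; apply/negP => mn; apply: Oma; apply: Om_low yO.
  apply: ltW; rewrite Order.SigmaOrder.ltEsig /= mn /=.
  have {}mn : (mu < nu)%O by rewrite lt_neqAle mn andbT; apply/eqP => h; exact: nm.
  by rewrite (lt_geF mn).
- by apply: QJ; rewrite (gb0l actb) (gb0r actb); exact: gs0.
- by rewrite (gbDl actb) (gbDr actb); exact: QD.
- by rewrite (gbZl actb) (gbZr actb) -(gbZl actb); exact: hx.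
- by rewrite [act (x ** y) u]actA -[act b _]actA; exact: hy.
by rewrite [act (y ** x) u]actA; exact: hy.
Qed.

Lemma step_layer : tame (fun p : P => act (e mu) p = p) ->
  pure_layer R a (gsection (ideal_mod (refined_ideal Om) P) (ideal_mod (refined_ideal Om') P)).
Proof.
move=> Pt; exists (gsection (type_sub Om) (type_sub Om')); split.
  apply: (std_layer_section _ (strat_dual_basis D T mu)).
  - exact: tame_strat.
  - move=> x y yx /=; apply: Om_low.
    by rewrite Order.SigmaOrder.leEsig /= lexx tagged_asE.
  - exact: Oma.
  - move=> x xc /=; apply: Om_lt.
    by rewrite Order.SigmaOrder.ltEsig /= lexx tagged_asE.
  move=> x /=; rewrite Om'E; split=> [[|/eqP]|[|->]]; [by left| |by left|by right].
  by rewrite eq_Tagged /= => /eqP; right.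
apply: (step_section (U := gsection (type_sub Om) (type_sub Om'))
  (f := qpi (restr_submod (type_sub Om) (type_sub Om')))).
- split=> [x y|n y yn]; last by rewrite addr0; exact: gdeg_qpi.
  exact/esym/(quo_actE (restr_submod (type_sub Om) (type_sub Om'))).
- move=> y; have [x ->] := qpi_surj (W := restr_submod (type_sub Om) (type_sub Om')) y.
  by exists x.
exact: (qpi_ker (restr_submod (type_sub Om) (type_sub Om'))).
Qed.

End Step.
End RefinedIdeals.

(** * Cyclic modules and graded local algebras *)

Section Cyclic.
Variables (k : closedFieldType) (A : lualg k) (V : gmod A).
Let actb := act_bilin V.

Lemma local_unit (v : V) : exists a : A, act a v = v.
Proof.
have [s [_ vE]] := act_unital v; exists (idsum (lu_one A) s).
by rewrite -act_idsum -vE.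
Qed.

Section CyclicSubmodule.
Variables (d : int) (v : V) (vd : gdeg d v).

Let cyc (x : V) : Prop := exists a : A, x = act a v.

Let cyc0 : cyc 0. Proof. by exists 0; rewrite (gb0l actb). Qed.

Let cycD x y : cyc x -> cyc y -> cyc (x + y).
Proof. by move=> [a ->] [b ->]; exists (a + b); rewrite (gbDl actb). Qed.

Let cycZ (c : k) x : cyc x -> cyc (c *: x).
Proof. by move=> [a ->]; exists (c *: a); rewrite (gbZl actb). Qed.

Let cyc_comp n x : cyc x -> cyc (gcomp n x).
Proof. by move=> [a ->]; exists (gcomp (n - d) a); rewrite (gcomp_degr actb _ _ vd). Qed.

Let cyc_act a x : cyc x -> cyc (act a x).
Proof. by move=> [b ->]; exists (a ** b); rewrite actA. Qed.

Definition cyclic_sub : gsubmod V :=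
  @GSubmod _ _ V (@GSubsp _ V cyc cyc0 cycD cycZ cyc_comp) cyc_act.

End CyclicSubmodule.

Lemma irreducible_gen d (v : V) : irreducible V -> gdeg d v -> v <> 0 ->
  forall x : V, exists a : A, x = act a v.
Proof.
move=> [_ irr] vd v0; have [/(_ v) h|//] := irr (cyclic_sub vd).
by case: v0; apply: h; have [a av] := local_unit v; exists a.
Qed.

(** A projective module with a homogeneous generator [u] of degree 0 has a dual
  basis with one element: split the surjection [a |-> a u]. *)
Lemma cyclic_split (u : V) : projective V -> gdeg 0 u ->
  (forall x : V, exists a : A, x = act a u) ->
  exists f : {linear V -> A}, [/\ forall a x, f (act a x) = a ** f x,
    forall d x, gdeg d x -> gdeg d (f x) & forall x, act (f x) u = x].
Proof.
move=> Vp ud ugen; have gh : ghom (V := regular A) 0 (actr u).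
  split=> [a x|n x xn]; first by rewrite !actrE actA.
  by have := gb_deg actb xn ud.
have gs : Defs.surj (actr u) by move=> x; have [a ->] := ugen x; exists a.
have ih : ghom 0 (idfun : {linear V -> V}) by split=> // n v; rewrite addr0.
have [f [fh fE]] := Vp (regular A) V (actr u) idfun gh gs ih; exists f; split.
- exact: (gh_act fh).
- by move=> d x /(gh_deg fh); rewrite addr0.
exact: fE.
Qed.

Lemma cyclic_dual_basis (u : V) (f : {linear V -> A}) : gdeg 0 u ->
  (forall a x, f (act a x) = a ** f x) -> (forall d x, gdeg d x -> gdeg d (f x)) ->
  (forall x, act (f x) u = x) -> dual_basis V.
Proof.
move=> ud fa fd fE.
apply: (@DualBasis _ _ _ unit (fun=> 0) (fun=> u) (fun=> f)) => //.
  by move=> _ d x; rewrite subr0; exact: fd.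
by move=> x; exists [:: tt]; split; rewrite ?big_seq1 ?fE //; case.
Defined.

End Cyclic.

Section Local.
Variables (k : closedFieldType) (C : lualg k) (u : C).
Hypotheses (ul : forall a, u ** a = a) (ur : forall a, a ** u = a).
Let mulb := amul_bilin C.

(** Zorn's lemma is applied to the sets [X] for which the union of [N] and [X] is a
  proper submodule, so that the empty chain is bounded. *)
Lemma maximal_above (N : gsubmod (regular C)) : ~ N u ->
  exists M : gsubmod (regular C), maximal_submod M /\ forall x, N x -> M x.
Proof.
move=> Nu; pose S (X : set C) := exists M : gsubmod (regular C),
  (forall x, M x <-> N x \/ X x) /\ ~ M u.
have [|X [[M [ME Mu]] Xmax]] := @Zorn_bigcup C S.
  move=> F FS tot; pose U (x : C) := N x \/ (\bigcup_(X in F) X) x.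
  have pick x y : U x -> U y -> exists M : gsubmod (regular C),
      [/\ M x, M y, forall z, M z -> U z & ~ M u].
    have one X z : F X -> N z \/ X z -> exists M : gsubmod (regular C),
        [/\ forall z, M z <-> N z \/ X z & ~ M u].
      by move=> /FS [M [h1 h2]] _; exists M.
    have sub X z : F X -> N z \/ X z -> U z.
      by move=> FX [|Xz]; [left|right; exists X].
    move=> [Nx|[X FX Xx]] [Ny|[Y FY Yy]].
    + by exists N; split=> // z; left.
    + have [M [ME Mu]] := one Y y FY (or_intror Yy); exists M.
      by split=> //; [apply/ME; left|apply/ME; right|move=> z /ME; exact: sub].
    + have [M [ME Mu]] := one X x FX (or_intror Xx); exists M.
      by split=> //; [apply/ME; right|apply/ME; left|move=> z /ME; exact: sub].
    have [XY|YX] := tot X Y FX FY.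
      have [M [ME Mu]] := one Y y FY (or_intror Yy); exists M.
      by split=> //; [apply/ME; right; exact: XY|apply/ME; right|move=> z /ME; exact: sub].
    have [M [ME Mu]] := one X x FX (or_intror Xx); exists M.
    by split=> //; [apply/ME; right|apply/ME; right; exact: YX|move=> z /ME; exact: sub].
  have U0 : U 0 by left; exact: gs0.
  have UD x y : U x -> U y -> U (x + y).
    by move=> xU yU; have [M [Mx My MU _]] := pick x y xU yU; apply/MU/gsD.
  have UZ (c : k) x : U x -> U (c *: x).
    by move=> xU; have [M [Mx _ MU _]] := pick x x xU xU; apply/MU/gsZ.
  have Uc d x : U x -> U (gcomp d x).
    by move=> xU; have [M [Mx _ MU _]] := pick x x xU xU; apply/MU/(gs_comp d).
  have Ua a x : U x -> U (a ** x).
    move=> xU; have [M [Mx _ MU _]] := pick x x xU xU.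
    by apply: MU; exact: (@gsm_act _ _ (regular C) M a _ Mx).
  exists (@GSubmod _ _ (regular C) (@GSubsp _ C U U0 UD UZ Uc) Ua); split=> // uU.
  by have [M [Mu _ _]] := pick u u uU uU.
exists M; split=> [|x Nx]; last by apply/ME; left.
split; first by exists u.
move=> M' MM' [v M'v] x M'x.
have M'u : ~ M' u.
  move=> M'u; apply: M'v; have := @gsm_act _ _ (regular C) M' v _ M'u.
  by rewrite -[X in M' X]/(v ** u) ur.
apply: contrapT => Mx; apply: (Xmax M').
  split=> [y Xy|M'X]; first by apply: MM'; apply/ME; right.
  by apply: Mx; apply/ME; right; exact: M'X.
exists M'; split=> // y; split=> [|[Ny|//]]; first by right.
by apply: MM'; apply/ME; left.
Qed.

(** If [u - p] did not generate the algebra, it would lie in a maximal submodule,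
  which also contains [p] and hence the unit [u]. So [u] is a multiple of [u - p],
  which kills [p]. *)
Lemma radical_idem (p : C) : gdeg 0 p -> p ** p = p ->
  radical (V := regular C) p -> p = 0.
Proof.
move=> pd pp prad; have u0 : gdeg 0 u.
  have [s [_ sl _]] := idsum_local (lu_unital C) u.
  by rewrite -sl ur; exact: (idsum_deg0 (lu_unital C)).
have qd : gdeg 0 (u - p) by rewrite /gdeg linearB u0 pd.
have [[a uE]|Nu] := pselect (cyclic_sub (V := regular C) qd u).
  have {}uE : u = a ** (u - p) by exact: uE.
  have : u ** p = 0.
    rewrite uE -amulA (gbBl mulb) ul pp subrr.
    exact: (gb0r mulb).
  by rewrite ul.
have [M [Mmax MN]] := maximal_above Nu; case: Nu; have [[v Mv] _] := Mmax.
case: Mv; rewrite -[v]ur; apply: (@gsm_act _ _ (regular C) M v).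
rewrite -[u](subrK p); apply: gsD; last exact: prad.
by apply: MN; exists u; rewrite -[RHS]/(u ** (u - p)) ul.
Qed.

(** One of [p] and [u - p] is in the kernel of [eps], hence in the radical. *)
Lemma local_idem (p : C) : graded_local C -> gdeg 0 p -> p ** p = p -> p <> 0 -> p = u.
Proof.
move=> [eps [epss epsM _ epsr]] pd pp p0.
have u0 : gdeg 0 u.
  have [s [_ sl _]] := idsum_local (lu_unital C) u.
  by rewrite -sl ur; exact: (idsum_deg0 (lu_unital C)).
have epsp : eps p <> 0 by move=> /epsr /(radical_idem pd pp).
have epsu : eps u = 1.
  have [x x1] := epss (1 : k^o); have := epsM x u; rewrite ur x1.
  by rewrite mul1r => <-.
have qq : (u - p) ** (u - p) = u - p.
  by rewrite (gbBl mulb) ul (gbBr mulb) ur pp subrr subr0.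
have qd : gdeg 0 (u - p) by rewrite /gdeg linearB u0 pd.
apply/esym/eqP; rewrite -subr_eq0; apply/eqP/(radical_idem qd qq)/epsr.
rewrite linearB epsu; have := epsM p p; rewrite pp => ep.
apply/eqP; rewrite subr_eq0; apply/eqP.
have epsp' : (eps p : k) != 0 by apply/eqP.
by apply: (mulfI epsp'); rewrite mulr1 -ep.
Qed.

End Local.

Section StandardModule.
Variables (k : closedFieldType) (D : lualg k) (disp : Order.disp_t).
Variables (Bl : finPOrderType disp) (R : baqh D Bl) (c : Bl).

Local Notation u := (bq_idem R c).

Definition std_el (y : D) : std_mod R c := lid (bq_wts R) c y.

Lemma std_el_linear : linear std_el.
Proof. by move=> a x y; exact: (@lid_linear k (bq_alg R) _ _ (bq_wts R) c a x y). Qed.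

HB.instance Definition _ := GRing.isLinear.Build k D (std_mod R c) _ std_el std_el_linear.

Lemma std_el_surj z : exists y, z = std_el y.
Proof. exact: (@lid_surj k (bq_alg R) _ _ (bq_wts R) c z). Qed.

Lemma std_el_act d y : act d (std_el y) = std_el (d ** y).
Proof.
apply: val_inj; apply: etrans (esym (qpi_mul (nge_ideal (bq_wts R) c) _ _)) _.
by congr (qpi _ _); rewrite amulA.
Qed.

Lemma std_el_eq0 y : std_el y = 0 <-> nge_ideal (bq_wts R) c (y ** u).
Proof.
rewrite -(linear0 std_el) -bq_esum.
have := @lid_eq k (bq_alg R) _ _ (bq_wts R) c y 0.
by rewrite (gb0l (amul_bilin (bq_alg R))) subr0.
Qed.

Lemma std_el_deg n y : gdeg n y -> gdeg n (std_el y).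
Proof. exact: (@lid_deg k (bq_alg R) _ _ (bq_wts R) c n y). Qed.

Lemma std_elu y : std_el (y ** u) = std_el y.
Proof. by rewrite -bq_esum; exact: (@lid_e k (bq_alg R) _ _ (bq_wts R) c y). Qed.

End StandardModule.

(** * The top of the irreducible module L(b) *)

Section Irreducible.
Variables (k : closedFieldType) (A : lualg k) (disp dB : Order.disp_t).
Variables (L : porderType disp) (w : weights A L).
Variables (B : L -> finPOrderType dB) (R : forall l, baqh (A_loc w l) (B l)).
Variables (mu : L) (c : B mu) (Pl Ll : gmod (A_loc w mu)) (Lb : gmod A).
Hypotheses (Ll_irr : irreducible Ll) (Pl_cover : proj_cover Pl Ll).
Hypotheses (Ll_head : is_head (std_mod (R mu) c) Ll).
Hypothesis Lb_quot : irr_quotient (standardize Pl) Lb.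

Local Notation e := (esum w mu).
Local Notation J := (nge_ideal w mu).
Local Notation eps := (refined_idem R (existT _ mu c)).

(** The restriction of [standardize Pl -> Lb] to [Pl] has the same kernel as
  [Pl -> Ll], so [Ll] embeds into [Lb]. The image of the generator of the standard
  module with head [Ll] is then a vector of [Lb] that is fixed by the idempotent of
  type [b] and killed by everything of type not above [b]. *)
Lemma irr_top_vector : (forall j (x : Lb), J j -> act j x = 0) /\
  exists v : Lb, [/\ v <> 0, gdeg 0 v, act eps v = v &
    forall x, nge_ideal (bq_wts (R mu)) c (loc w mu x : bq_alg (R mu)) -> act e (act x v) = 0].
Proof.
have [[[l0 l00] Lb_sub] [pi [pih pis]]] := Lb_quot.
have Lb_irr : irreducible Lb by split=> //; exists l0.
have [_ [kap [kaph kaps super]]] := Pl_cover; have [ph [phh phs _]] := Ll_head.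
pose tn (m : leftid_bimod (ebar w mu)) z : standardize Pl := tens m z.
have piJ j x : J j -> act j x = 0 :> Lb.
  move=> Jj; have [t <-] := pis x; rewrite -(gh_act pih).
  have [s ->] := tens_gen t; rewrite (gb_sumr (act_bilin (standardize Pl))) big1.
    by rewrite linear0.
  move=> [m z] _; rewrite -[LHS]/(act j (tn m z)); have [a ->] := lid_surj m.
  by rewrite std_act lid_nge; [exact: tens0l|exact: gid_mulr].
split=> //; pose iotaf z := pi (tn (lid w mu e) z).
have iota_lin : linear iotaf.
  by move=> x y z; rewrite /iotaf /tn tensDr tensZr linearP.
pose iota : {linear Pl -> Lb} := lin_of iota_lin.
have iotaE z : iota z = pi (tn (lid w mu e) z) by [].
have iota_deg n z : gdeg n z -> gdeg n (iota z).
  move=> zn; have h := gdeg_tens (lid_deg w mu (esum0 w mu)) zn.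
  by have := gh_deg pih h; rewrite addr0 add0r.
have iota_act b z : iota (act (loc w mu b) z) = act (e ** b) (iota z).
  rewrite !iotaE /tn -std_loc esum_idem -(gh_act pih); congr (pi _).
  by rewrite std_act lid_e.
have iota_gen (x : Lb) : (forall z, iota z = 0) -> x = 0.
  move=> i0; have [t <-] := pis x; have [s ->] := tens_gen t.
  rewrite linear_sum big1 // => -[m z] _; have [a ->] := lid_surj m.
  have -> : tens (lid w mu a) z = act a (tn (lid w mu e) z).
    by rewrite /tn std_act lid_e.
  rewrite (gh_act pih) -[pi _]/(iota z) i0; exact: (gb0r (act_bilin Lb)).
have ker0 : iota 0 = 0 by exact: linear0.
have kerD x y : iota x = 0 -> iota y = 0 -> iota (x + y) = 0.
  by move=> x0 y0; rewrite linearD x0 y0 addr0.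
have kerZ (z : k) x : iota x = 0 -> iota (z *: x) = 0.
  by move=> x0; rewrite (linearZZ iota) x0 scaler0.
have kerc d x : iota x = 0 -> iota (gcomp d x) = 0.
  by move=> x0; rewrite (deg0_comp _ _ iota_deg) x0 linear0.
have kera a x : iota x = 0 -> iota (act a x) = 0.
  have [b ->] := loc_surj a; move=> x0; rewrite iota_act x0.
  exact: (gb0r (act_bilin Lb)).
pose K : gsubmod Pl := @GSubmod _ _ Pl
  (@GSubsp _ Pl (fun x => iota x = 0) ker0 kerD kerZ kerc) kera.
have Kproper : ~ forall x, iota x = 0.
  by move=> i0; apply: l00; exact: iota_gen.
(* If iota n <> 0 with kap n = 0, then n generates Lb, so Ker iota and the
   superfluous Ker kap together span Pl. *)
have kap_iota_hom d n : gdeg d n -> kap n = 0 -> iota n = 0.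
  move=> nd kn; apply: contrapT => n0.
  have gen := irreducible_gen Lb_irr (iota_deg _ _ nd) n0.
  suff : forall x, K x by move/(_ n).
  apply: super => x; have [a aE] := gen (iota x).
  have ex : act e (iota x) = iota x.
    by rewrite iotaE -(gh_act pih) /tn std_act esum_idem.
  exists (x - act (loc w mu a) n).
    have : iota (x - act (loc w mu a) n) = 0.
      by rewrite linearB iota_act actA -aE ex subrr.
    exact.
  rewrite opprB addrC subrK (gh_act kaph) kn; exact: (gb0r (act_bilin Ll)).
have kap_iota n : kap n = 0 -> iota n = 0.
  move=> kn; rewrite [n]gsuppE linear_sum big1 // => d _.
  apply: (kap_iota_hom d); first exact: gcomp_deg.
  by rewrite (ghom0_comp _ _ kaph) kn linear0.
(* Symmetrically, if kap n <> 0 with iota n = 0, then Ker iota maps onto Ll. *)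
have iota_kap_hom d n : gdeg d n -> iota n = 0 -> kap n = 0.
  move=> nd n0; apply: contrapT => kn.
  have knd : gdeg d (kap n) by have := gh_deg kaph nd; rewrite addr0.
  have gen := irreducible_gen Ll_irr knd kn; apply: Kproper.
  apply: (super K) => x; have [a aE] := gen (kap x); exists (act a n).
    exact: (kera a n n0).
  by rewrite linearB (gh_act kaph) -aE subrr.
pose one1 : std_mod (R mu) c := std_el (R mu) c (bq_idem (R mu) c).
have v'd : gdeg 0 (ph one1).
  by have := gh_deg phh (std_el_deg (R mu) c (bq_idem_deg (R mu) c)); rewrite addr0.
have v'u : act (bq_idem (R mu) c) (ph one1) = ph one1.
  by rewrite -(gh_act phh) std_el_act bq_idem_idem.
have v'0 : ph one1 <> 0.
  move=> v'0; have [[x0 x00] _] := Ll_irr; apply: x00; have [y <-] := phs x0.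
  have [d ->] := std_el_surj y; rewrite -std_elu -std_el_act (gh_act phh) v'0.
  exact: (gb0r (act_bilin Ll)).
have [z0 z0E] := kaps (ph one1).
pose z := act (bq_idem (R mu) c) (gcomp 0 z0).
have kz : kap z = ph one1.
  by rewrite /z (gh_act kaph) (ghom0_comp _ _ kaph) z0E v'd v'u.
have zd : gdeg 0 z.
  have := gb_deg (act_bilin Pl) (bq_idem_deg (R mu) c) (gcomp_deg 0 z0).
  by rewrite addr0.
have [_ eeps _ epsE] := refined_idemP R (existT _ mu c).
exists (iota z); split.
- by move=> /(iota_kap_hom _ _ zd); rewrite kz.
- exact: iota_deg.
- have zz : act (loc w mu eps) z = z.
    by rewrite [loc _ _ _]epsE /z -actA bq_idem_idem.
  by rewrite -{2}zz iota_act [e ** _]eeps.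
move=> x Jx; rewrite -actA -iota_act; apply: kap_iota.
rewrite (gh_act kaph) kz -(gh_act phh) std_el_act.
have /std_el_eq0 -> : nge_ideal (bq_wts (R mu)) c
    (loc w mu x ** bq_idem (R mu) c ** bq_idem (R mu) c : bq_alg (R mu)).
  by apply: gid_mulr; apply: gid_mulr.
exact: linear0.
Qed.

End Irreducible.

(** * Finiteness of the strata *)

Section FiniteDimension.
Variables (k : closedFieldType) (V : lmodType k).

Lemma fin_dim0 : fin_dim (fun v : V => v = 0).
Proof. by exists 0%N, (fun=> 0) => _ ->; exists (fun=> 0); rewrite big_ord0. Qed.

Lemma fin_dimD (E F : V -> Prop) : fin_dim E -> fin_dim F ->
  fin_dim (fun v => exists x y, [/\ E x, F y & v = x + y]).
Proof.
move=> [m [a aE]] [n [b bE]].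
exists (m + n)%N, (fun i => match fintype.split i with inl j => a j | inr j => b j end).
move=> _ [x [y [/aE[c ->] /bE[d ->] ->]]].
exists (fun i => match fintype.split i with inl j => c j | inr j => d j end).
rewrite big_split_ord /=; congr (_ + _); apply: eq_bigr => i _.
  by rewrite (unsplitK (inl i)).
by rewrite (unsplitK (inr i)).
Qed.

Lemma fin_dimS (E F : V -> Prop) : (forall v, E v -> F v) -> fin_dim F -> fin_dim E.
Proof. by move=> EF [n [b bE]]; exists n, b => v /EF; exact: bE. Qed.

Lemma fin_dim_sum (T : Type) (s : seq T) (E : T -> V -> Prop) :
  (forall t, fin_dim (E t)) ->
  fin_dim (fun v => exists x : T -> V, (forall t, E t (x t)) /\ v = \sum_(t <- s) x t).
Proof.
move=> Ef; elim: s => [|t s IH].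
  by apply: fin_dimS fin_dim0 => v [x [_ ->]]; rewrite big_nil.
apply: fin_dimS (fin_dimD (Ef t) IH) => v [x [xE ->]].
rewrite big_cons; exists (x t), (\sum_(t' <- s) x t'); split=> //.
by exists x.
Qed.

End FiniteDimension.

Section TameStratum.
Variables (k : closedFieldType) (A : lualg k) (A_lfd : lfd_alg A) (A_bb : bb_alg A).
Variables (disp : Order.disp_t) (L : porderType disp) (w : weights A L).
Variable T : gtbasis w.

Let mulb := amul_bilin A.
Local Notation e l := (esum w l).

Lemma corner_lfd l m d :
  fin_dim (fun x : A => exists a, gdeg d a /\ x = e l ** a ** e m).
Proof.
have [r [_ _ rE]] := esum_seq T l; have [s [_ _ sE]] := esum_seq T m.
have h i j := A_lfd (@spi _ _ _ _ w i) (@spi _ _ _ _ w j) d.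
apply: fin_dimS (fin_dim_sum r (fun i => fin_dim_sum s (fun j => h i j))).
move=> _ [a [ad ->]].
exists (fun i => \sum_(j <- s) spone i ** a ** spone j); split.
  move=> i; exists (fun j => spone i ** a ** spone j); split=> // j; split.
    have lu := lu_unital A.
    have := gb_deg mulb (gb_deg mulb (one_deg0 lu (spi i)) ad) (one_deg0 lu (spi j)).
    by rewrite add0r addr0.
  rewrite -!amulA [spone j ** _](lu_idem (lu_unital A)) !amulA.
  by rewrite [_ ** spone i](lu_idem (lu_unital A)).
rewrite rE sE !(gb_suml mulb); apply: eq_bigr => i _.
by rewrite (gb_sumr mulb).
Qed.

Lemma seq_bound (I : eqType) (s : seq I) (Q : I -> int -> Prop) :
  (forall i, exists N : int, forall d, (d < N)%R -> Q i d) ->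
  exists N : int, forall d, (d < N)%R -> forall i, i \in s -> Q i d.
Proof.
move=> h; elim: s => [|i s [N IH]]; first by exists 0.
have [M MQ] := h i; exists (Order.min N M) => d; rewrite lt_min => /andP[dN dM] j.
rewrite inE => /orP[/eqP->|]; [exact: MQ | exact: IH].
Qed.

Lemma corner_bb l m : exists N : int, forall d, (d < N)%R ->
  forall a, gdeg d a -> e l ** a ** e m = 0.
Proof.
have [r [_ _ rE]] := esum_seq T l; have [s [_ _ sE]] := esum_seq T m.
have lu := lu_unital A.
have h (i j : spec w) : exists N : int, forall d, (d < N)%R ->
    forall a, gdeg d a -> spone i ** a ** spone j = 0.
  have [N NE] := A_bb (spi i) (spi j); exists N => d dN a ad; apply: (NE d dN).
  split.
    have := gb_deg mulb (gb_deg mulb (one_deg0 lu (spi i)) ad) (one_deg0 lu (spi j)).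
    by rewrite add0r addr0.
  rewrite -!amulA [spone j ** _](lu_idem lu) !amulA.
  by rewrite [_ ** spone i](lu_idem lu).
have [N NE] := seq_bound r (fun i => seq_bound s (h i)).
exists N => d dN a ad; rewrite rE sE !(gb_suml mulb).
apply: big1_seq => i /= ir; rewrite (gb_sumr mulb).
by apply: big1_seq => j /= js; exact: (NE _ dN i ir j js a ad).
Qed.

Lemma tame_cyclic (P : gmod A) (l m : L) (u : P) (f : {linear P -> A}) :
  gdeg 0 u -> act (e l) u = u -> (forall d x, gdeg d x -> gdeg d (f x)) ->
  (forall x, act (f x) u = x) -> tame (fun p : P => act (e m) p = p).
Proof.
move=> ud eu fd fE.
have pE p : act (e m) p = p -> p = act (e m ** f p ** e l) u.
  by move=> ep; rewrite !actA eu fE.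
split=> [d|].
  have [n [b bE]] := corner_lfd m l d; exists n, (fun i => act (b i) u).
  move=> p [pd ep]; rewrite (pE p ep).
  have [|c ->] := bE (e m ** f p ** e l).
    by exists (f p); split=> //; exact: fd.
  exists c; rewrite (gb_suml (act_bilin P)); apply: eq_bigr => i _.
  exact: (gbZl (act_bilin P)).
have [N NE] := corner_bb m l; exists N => d dN p pd ep.
by rewrite (pE p ep) (NE d dN _ (fd _ _ pd)) (gb0l (act_bilin P)).
Qed.

End TameStratum.

(** * The top section *)

Section Top.
Variables (k : closedFieldType) (A : lualg k) (disp dB : Order.disp_t).
Variables (L : porderType disp) (w : weights A L) (T : gtbasis w).
Variables (B : L -> finPOrderType dB) (R : forall l, baqh (A_loc w l) (B l)).
Variables (mu : L) (c : B mu) (P Lb : gmod A) (D : dual_basis P).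
Variables (q : {linear P -> Lb}) (u : P).

Local Notation e := (esum w mu).
Local Notation J := (nge_ideal w mu).
Local Notation W := (strat_mod w mu P).
Local Notation cls := (scl w mu P).
Local Notation uc := (bq_idem (R mu) c).
Local Notation J' := (nge_ideal (bq_wts (R mu)) c : gideal (A_loc w mu)).
Local Notation sub G := (ideal_mod (weight_ideal (bq_wts (R mu)) G : gideal (A_loc w mu)) W).

Hypotheses (qh : ghom 0 q) (ud : gdeg 0 u) (eu : act e u = u).
Hypotheses (ugen : forall x : P, exists a : A, x = act a u).
Hypotheses (ucu : act uc (cls u) = cls u) (qu0 : q u <> 0).
Hypothesis Lb_kill : forall j (x : Lb), J j -> act j x = 0.
Hypothesis qu_kill : forall x, J' (loc w mu x) -> act e (act x (q u)) = 0.

Let Db := amul_bilin (A_loc w mu).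

Lemma top_not_killed (d : A_loc w mu) : J' d -> act d (cls u) <> cls u.
Proof.
have [x ->] := loc_surj d; move=> Jx; rewrite scl_act eu => /cl_eq uJ.
have qJ p : ideal_mod J P p -> q p = 0.
  move: p; apply: ideal_mod_ind => [|p p' h h'|a p Ja].
  - exact: linear0.
  - by rewrite linearD h h' addr0.
  by rewrite (gh_act qh); exact: Lb_kill.
apply: qu0; have := qJ _ uJ; rewrite (gbBr (act_bilin P)) eu linearB.
by rewrite !(gh_act qh) qu_kill // sub0r => /eqP; rewrite oppr_eq0 => /eqP.
Qed.

Lemma top_gen z : exists d : A_loc w mu, z = act d (cls u).
Proof.
have [p ->] := scl_surj z; have [a ->] := ugen p; exists (loc w mu a).
by rewrite scl_act eu.
Qed.

(** Because the Cartan algebra of [c] is graded local, the splitting of the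
  projective module [W] onto its generator is, modulo smaller weights, the
  identity of that algebra: the top section has multiplicity exactly one. *)
Lemma top_section (G G' : set (B mu)) : (forall x, G x <-> (x < c)%O) -> G' c ->
  exists f : {linear gmod_sub (sub G') -> std_mod (R mu) c},
    [/\ ghom 0 f, Defs.surj f & forall y, f y = 0 <-> sub G (val y)].
Proof.
move=> GE G'c; have zd : gdeg 0 (cls u) by exact: scl_deg.
have Wproj : projective W := dual_basis_projective (strat_dual_basis D T mu).
have [s [sa sd sE]] := cyclic_split Wproj zd top_gen.
pose t z := s z ** uc.
have ta d z : t (act d z) = d ** t z by rewrite /t sa amulA.
have tE z : act (t z) (cls u) = z by rewrite /t actA ucu sE.
have td d z : gdeg d z -> gdeg d (t z).
  by move=> /sd zd'; have := gb_deg Db zd' (bq_idem_deg (R mu) c); rewrite addr0.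
have tu z : t z ** uc = t z by rewrite /t -amulA bq_idem_idem.
have tlin : linear t by move=> a x y; rewrite /t linearP (gbDl Db) (gbZl Db).
pose p := t (cls u).
have up : uc ** p = p by rewrite /p -ta ucu.
have pp : p ** p = p by rewrite {2}/p -ta tE.
have eqc : esum (bq_wts (R mu)) c = uc := bq_esum (R mu) c.
(* the class of p in the Cartan algebra is a nonzero idempotent *)
have pJ : J' (p - uc).
  pose C := A_loc (bq_wts (R mu)) c.
  pose lc : A_loc w mu -> C := @loc k (bq_alg (R mu)) _ _ (bq_wts (R mu)) c.
  have lc0 : lc 0 = 0 by exact: (linear0 (@loc k (bq_alg (R mu)) _ _ (bq_wts (R mu)) c)).
  have lc_eq a b : lc a = lc b -> J' (uc ** a ** uc - uc ** b ** uc).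
    by move/(@loc_eq k (bq_alg (R mu))); rewrite eqc.
  have lcM a b : lc a ** lc b = lc (a ** uc ** b).
    by rewrite -eqc; exact: (@loc_mul k (bq_alg (R mu))).
  have lc_surj x : exists a, x = lc a := @loc_surj k (bq_alg (R mu)) _ _ (bq_wts (R mu)) c x.
  have lce : lc uc = lu_one C tt.
    by rewrite -eqc; exact/esym/(@loc_one k (bq_alg (R mu))).
  have lcu a : lc uc ** lc a = lc a.
    by rewrite lcM bq_idem_idem -eqc; exact: (@loc_el k (bq_alg (R mu))).
  have ulc a : lc a ** lc uc = lc a.
    by rewrite lcM -amulA bq_idem_idem -eqc; exact: (@loc_er k (bq_alg (R mu))).
  have ul x : lc uc ** x = x by have [a ->] := lc_surj x.
  have ur x : x ** lc uc = x by have [a ->] := lc_surj x.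
  have pd : gdeg 0 (lc p).
    by apply: (@loc_deg k (bq_alg (R mu))); exact: td.
  have lpp : lc p ** lc p = lc p by rewrite lcM -amulA up pp.
  have p0 : lc p <> 0.
    rewrite -lc0 => /lc_eq; rewrite (gb0r Db) (gb0l Db) subr0 up tu => Jp.
    by apply: (top_not_killed Jp); exact: tE.
  have := local_idem ul ur (bq_local (R mu) c) pd lpp p0 => /lc_eq.
  by rewrite up tu !bq_idem_idem.
have flin : linear (fun y : gmod_sub (sub G') => std_el (R mu) c (t (val y))).
  by move=> a x y; rewrite linearP tlin linearP.
exists (lin_of flin); split.
- split=> [a y|n y /gdeg_gsub yn].
    rewrite -[LHS]/(std_el (R mu) c (t (act a (val y)))).
    by rewrite -[RHS]/(act a (std_el (R mu) c (t (val y)))) std_el_act -ta.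
  by rewrite addr0; apply: std_el_deg; exact: td.
- move=> z; have [a ->] := std_el_surj z.
  have zG' : sub G' (act a (cls u)).
    apply: gsm_act; rewrite -ucu; apply: ideal_mod_in; apply: IG_in.
    by exists c => //; rewrite eqc.
  exists (sub_in zG'); rewrite -[LHS]/(std_el (R mu) c (t (act a (cls u)))) ta.
  apply/eqP; rewrite -subr_eq0 -(linearB (std_el (R mu) c)); apply/eqP/std_el_eq0.
  rewrite (gbBl Db) -amulA tu -(gbBr Db); exact: (gid_mull (g := J')).
move=> y; rewrite -[X in X = 0]/(std_el (R mu) c (t (val y))); split.
  move/std_el_eq0; rewrite tu => Jt; rewrite -[val y]tE; apply: ideal_mod_in.
  have := nge_mulr (bq_basis (R mu)) Jt; rewrite eqc [_ ** uc]tu.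
  by apply: weight_ideal_sub => x /GE.
move=> Gy; apply/std_el_eq0; rewrite tu.
move: (val y) Gy; apply: ideal_mod_ind => [|x x' h h'|d x Gd].
- have -> : t 0 = 0 by rewrite /t linear0 (gb0l Db).
  exact: (@gs0 _ _ J').
- have -> : t (x + x') = t x + t x' by rewrite /t linearD (gbDl Db).
  exact: (@gsD _ _ J').
rewrite ta; apply: (gid_mulr (g := J')); move: Gd; apply: weight_ideal_sub => z /GE zc /=.
by rewrite lt_geF.
Qed.

End Top.

(** * The flag *)

Section LinearExtension.
Variables (disp : Order.disp_t) (X : porderType disp).
Hypothesis lfin : forall x : X, finite_set [set y | (y <= x)%O].

(** The elements below [b], along a linear extension that ends with [b]. *)
Definition down_seq (b : X) : seq X :=
  rcons (sort (fun x y => height x <= height y)%N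
           (fset_set [set x | (x < b)%O] : seq X)) b.

Let lt_fin (b : X) : finite_set [set x | (x < b)%O].
Proof. by apply: sub_finite_set (lfin b) => x /= /ltW. Qed.

Lemma mem_down_seq b x : (x \in down_seq b) = (x <= b)%O.
Proof.
rewrite mem_rcons inE mem_sort /= in_fset_set // le_eqVlt; congr (_ || _).
by apply/idP/idP; rewrite inE.
Qed.

Lemma down_seq_uniq b : uniq (down_seq b).
Proof.
rewrite rcons_uniq mem_sort sort_uniq fset_uniq andbT in_fset_set //.
by apply/negP; rewrite inE /= ltxx.
Qed.

Lemma down_seq_index b x y : y \in down_seq b -> (x < y)%O ->
  (index x (down_seq b) < index y (down_seq b))%N.
Proof.
move=> yb xy; have xb : x \in down_seq b.
  by rewrite mem_down_seq (le_trans (ltW xy)) // -mem_down_seq.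
have srt : sorted (fun x y => height x <= height y)%N (down_seq b).
  rewrite /down_seq; set s := sort _ _.
  have ss : sorted (fun x y => height x <= height y)%N s.
    by apply: sort_sorted => u v; exact: leq_total.
  have ht : transitive (fun x y : X => height x <= height y)%N.
    by move=> u v z; exact: leq_trans.
  rewrite sorted_pairwise // pairwise_rcons -sorted_pairwise // ss andbT.
  apply/allP => z; rewrite mem_sort in_fset_set // inE /= => zb.
  exact/ltnW/height_lt.
rewrite ltnNge; apply/negP => yx.
have := sorted_leq_nth (fun u v z => @leq_trans _ _ _) (fun u => leqnn _) b srt.
move=> /(_ (index y (down_seq b)) (index x (down_seq b))).
rewrite !inE !index_mem => /(_ yb xb yx); rewrite !nth_index //.
by rewrite leqNgt (height_lt lfin xy).
Qed.

Lemma take_down_max b x : (x \in take (size (down_seq b)).-1 (down_seq b)) = (x < b)%O.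
Proof.
rewrite /down_seq size_rcons -cats1 take_size_cat //.
by rewrite mem_sort in_fset_set //; apply/idP/idP; rewrite inE.
Qed.

Lemma take_down_low b r x y : (x <= y)%O -> y \in take r (down_seq b) ->
  x \in take r (down_seq b).
Proof.
rewrite le_eqVlt => /orP[/eqP->//|xy] yr; have yb := mem_take yr.
have xb : x \in down_seq b.
  by rewrite mem_down_seq (le_trans (ltW xy)) // -mem_down_seq.
move: yr; rewrite !in_take //; exact/ltn_trans/down_seq_index.
Qed.

Lemma take_down_lt b r x : (r < size (down_seq b))%N ->
  (x < nth b (down_seq b) r)%O -> x \in take r (down_seq b).
Proof.
move=> rs xr; have rb := mem_nth b rs.
have xb : x \in down_seq b.
  by rewrite mem_down_seq (le_trans (ltW xr)) // -mem_down_seq.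
by rewrite in_take // -[r](index_uniq b rs (down_seq_uniq b)); exact: down_seq_index.
Qed.

End LinearExtension.

Lemma sigma_lower_finite (d dB : Order.disp_t) (L : porderType d)
    (B : L -> finPOrderType dB) (a : {l : L & B l}) :
  (forall l : L, finite_set [set m | (m <= l)%O]) -> finite_set [set x | (x <= a)%O].
Proof.
move=> lfin; apply: (sub_finite_set
  (B := \bigcup_(l in [set m | (m <= tag a)%O]) ((fun c => existT _ l c) @` [set: B l]))).
  move=> [l c] /=; rewrite Order.SigmaOrder.leEsig /= => /andP[la _].
  by exists l => //; exists c.
by apply: bigcup_finite => // l _; exact/finite_image/finite_finset.
Qed.

Section Main.
Variables (k : closedFieldType) (A : lualg k) (A_lfd : lfd_alg A) (A_bb : bb_alg A).
Variables (disp dB : Order.disp_t) (L : porderType disp) (w : weights A L).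
Variables (T : gtbasis w) (B : L -> finPOrderType dB).
Variable R : forall l, baqh (A_loc w l) (B l).
Variables (mu : L) (c : B mu) (Pl Ll : gmod (A_loc w mu)) (P Lb : gmod A).
Hypotheses (Ll_irr : irreducible Ll) (Pl_cover : proj_cover Pl Ll).
Hypotheses (Ll_head : is_head (std_mod (R mu) c) Ll).
Hypotheses (Lb_quot : irr_quotient (standardize Pl) Lb) (P_cover : proj_cover P Lb).

Local Notation b := (existT _ mu c : {l : L & B l}).
Local Notation e := (esum w mu).
Local Notation eps := (refined_idem R b).

(** The lift [u] of the top vector of [Lb] generates [P], so the ideal of the types
  up to [b] already gives all of [P]; these types are added one at a time. *)
Lemma cover_flag :
  exists (n : nat) (F : nat -> gsubmod P) (t : 'I_n.+1 -> {l : L & B l}),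
    [/\ pure_flag R F t, t ord_max = b,
        giso (gsection (F n) (F n.+1)) (pure_std R b) &
        forall r : 'I_n.+1, r != ord_max -> (t r < b)%O].
Proof.
have [Pproj [q [qh qs super]]] := P_cover.
have [Lb_kill [v [v0 vd epsv vkill]]] :=
  irr_top_vector Ll_irr Pl_cover Ll_head Lb_quot.
have [eps0 eeps epse epsl] := refined_idemP R b.
have [u0 u0E] := qs v; pose u := act eps (gcomp 0 u0).
have qu : q u = v.
  by rewrite /u (gh_act qh) (ghom0_comp _ _ qh) u0E vd.
have ud : gdeg 0 u.
  by have := gb_deg (act_bilin P) eps0 (gcomp_deg 0 u0); rewrite addr0.
have eu : act e u = u by rewrite -actA [e ** _]eeps.
(* Ker q is superfluous and A u maps onto Lb *)
have ugen x : exists a : A, x = act a u.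
  have vgen := irreducible_gen Lb_quot.1 vd v0.
  apply: (super (cyclic_sub ud)) => y; have [a aE] := vgen (q y).
  exists (act a u); first by exists a.
  by rewrite linearB (gh_act qh) qu -aE subrr.
have [f [fa fd fE]] := cyclic_split Pproj ud ugen.
pose D := cyclic_dual_basis ud fa fd fE.
have Pt m := tame_cyclic A_lfd A_bb T m ud eu fd fE.
have lfin (a : {l : L & B l}) := sigma_lower_finite a (gt_lower_finite T).
pose ts := down_seq b; pose n := (size ts).-1.
have nE : size ts = n.+1 by rewrite /n /ts /down_seq size_rcons.
pose Om r : set {l : L & B l} := [set x | x \in take r ts].
pose F r := ideal_mod (refined_ideal R (Om r)) P.
pose t (i : 'I_n.+1) := nth b ts i.
have nth_n : nth b ts n = b.
  by rewrite /n /ts /down_seq nth_rcons size_rcons /= ltnn eqxx.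
have Om_low r x y : (x <= y)%O -> Om r y -> Om r x.
  by move=> xy; exact: (take_down_low lfin xy).
have Om_notin r : (r < n.+1)%N -> ~ Om r (nth b ts r).
  rewrite -nE => rn; rewrite /Om /= in_take ?mem_nth // index_uniq //.
    by rewrite ltnn.
  exact: down_seq_uniq.
have Om_lt r x : (r < n.+1)%N -> (x < nth b ts r)%O -> Om r x.
  by rewrite -nE => rn; exact: (take_down_lt lfin rn).
have OmS r x : (r < n.+1)%N -> Om r.+1 x <-> Om r x \/ x = nth b ts r.
  rewrite -nE => rn; rewrite /Om /= (take_nth b rn) mem_rcons inE.
  split=> [/orP[/eqP|]|[->|->]]; [by right|by left|by rewrite orbT|by rewrite eqxx].
have t_max : t ord_max = b by exact: nth_n.
exists n, F, t; split=> //.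
- split.
  + have h0 a : refined_ideal R (Om 0%N) a -> a = 0.
      elim=> {a} [x [z z0 _]||x y _ -> _ ->|z x _ ->|x y _ ->|x y _ ->].
      * by move: z0; rewrite /Om /= take0.
      * by [].
      * by rewrite addr0.
      * by rewrite scaler0.
      * exact: (gb0r (amul_bilin A)).
      exact: (gb0l (amul_bilin A)).
    apply: ideal_mod_ind => [|x y -> ->|a x /h0 ->] //; first by rewrite addr0.
    exact: (gb0l (act_bilin P)).
  + move=> x; have [a ->] := ugen x; apply: gsm_act; apply: ideal_mod_in.
    by apply: refined_ideal_in; apply/(OmS n b (ltnSn n)); right.
  + move=> r rn; apply: ideal_modS => a.
    move: a; apply: ideal_gen_sub => _ [x xr ->].
    by apply: refined_ideal_in; apply/(OmS r x rn); left.
  + move=> i j /eqP; rewrite nth_uniq ?nE ?ltn_ord ?down_seq_uniq // => /eqP ij.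
    exact: val_inj.
  move=> r; rewrite /F; have rn := ltn_ord r.
  have := Om_notin r rn; have := Om_lt r ^~ rn; have := OmS r ^~ rn.
  rewrite -/(t r); case: (t r) => nu d Om'E Omlt Omd.
  exact: (step_layer T R D (@Om_low r) Omd Omlt Om'E (Pt nu)).
- have Om'E x := OmS n x (ltnSn n); have Omlt x := @Om_lt n x (ltnSn n).
  have Omd := @Om_notin n (ltnSn n); rewrite nth_n in Omd.
  have {}Omlt x : (x < b)%O -> Om n x by move=> xb; apply: Omlt; rewrite nth_n.
  have {}Om'E x : Om n.+1 x <-> Om n x \/ x = b by rewrite Om'E nth_n.
  have ucu : act (bq_idem (R mu) c) (scl w mu P u) = scl w mu P u.
    have -> : scl w mu P u = act (bq_idem (R mu) c) (scl w mu P (gcomp 0 u0)).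
      by rewrite -[bq_idem _ _]epsl scl_act -actA [eps ** _]epse.
    by rewrite -actA bq_idem_idem.
  have qukill x : nge_ideal (bq_wts (R mu)) c (loc w mu x : bq_alg (R mu)) ->
    act e (act x (q u)) = 0 by rewrite qu; exact: vkill.
  have qu0 : q u <> 0 by rewrite qu.
  have GE d : Om n (existT _ mu d) <-> (d < c)%O.
    rewrite /Om /= /n /ts take_down_max // Order.SigmaOrder.ltEsig /=.
    by rewrite lexx tagged_asE.
  have G'c : Om n.+1 b by apply/Om'E; right.
  have [g [gh gs gk]] := top_section (B := B)
    (G' := [set d | Om n.+1 (existT _ mu d)]) T D qh ud eu ugen ucu qu0 Lb_kill qukill GE G'c.
  exact: (step_section T D (@Om_low n) Omd Omlt Om'E gh gs gk).
move=> r rmax; have rn : (r < n)%N.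
  have := ltn_ord r; rewrite ltnS leq_eqVlt => /orP[/eqP rE|//].
  by case/eqP: rmax; exact: val_inj.
rewrite -(take_down_max lfin) -/ts -/n /t -(nth_take b rn) mem_nth //.
by rewrite size_take nE ltnSn.
Qed.

End Main.

Theorem corollary12p7 (k : closedFieldType)
  (A : lualg k) (A_lfd : lfd_alg A) (A_bb : bb_alg A)
  (disp : Order.disp_t) (L : porderType disp) (w : weights A L)
  (T : gtbasis w)
  (dB : Order.disp_t) (B : L -> finPOrderType dB)
  (Lloc Ploc : forall l : L, B l -> gmod (A_loc w l))
  (Lloc_irr : forall l, full_irr (Lloc l))
  (Ploc_cover : forall l (b : B l), proj_cover (Ploc l b) (Lloc l b))
  (R : forall l, baqh (A_loc w l) (B l))
  (Lloc_head : forall l (b : B l), is_head (std_mod (R l) b) (Lloc l b))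
  (Lirr P : {l : L & B l} -> gmod A)
  (Lirr_quot : forall b, irr_quotient (standardize (Ploc (tag b) (tagged b))) (Lirr b))
  (P_cover : forall b, proj_cover (P b) (Lirr b))
  (b : {l : L & B l}) :
  exists (n : nat) (F : nat -> gsubmod (P b)) (t : 'I_n.+1 -> {l : L & B l}),
    [/\ pure_flag R F t,
        t ord_max = b,
        giso (gsection (F n) (F n.+1)) (pure_std R b) &
        forall r : 'I_n.+1, r != ord_max -> (t r < b)%O].
Proof.
case: b => mu c; have [irr _ _] := Lloc_irr mu.
exact: (cover_flag A_lfd A_bb T (irr c) (Ploc_cover mu c) (Lloc_head mu c)
  (Lirr_quot (existT _ mu c)) (P_cover (existT _ mu c))).
Qed.
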